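(* Let $s\ge2$ be an integer. If $\phi\in C^\infty(\mathbb{R}/\mathbb{Z})$ and $c\in I_s^\infty$, then both $T(\phi)c$ and $cT(\phi)$ are in $I_s^\infty$. If $\phi$ and $\psi$ are in $C^\infty(\mathbb{R}/\mathbb{Z})$, then $$T(\phi)T(\psi)-T(\phi\psi)\in I_s^\infty.$$ Consequently, $HS^\infty(s)$ is a dense $*$-subalgebra of $HS(s)$, with $a^*=T(\overline{\phi})+c^*$ for $a=T(\phi)+c\in HS^\infty(s)$ ($\phi\in C^\infty(\mathbb{R}/\mathbb{Z})$, $c\in I_s^\infty$). Moreover, $I_s^\infty$ is a two-sided ideal of $HS^\infty(s)$ with $$HS^\infty(s)/I_s^\infty\cong C^\infty(\mathbb{R}/\mathbb{Z}),$$ and the quotient map $q:HS^\infty(s)\to C^\infty(\mathbb{R}/\mathbb{Z})$ acts as $q(T(\phi)+c)=\phi$ for $\phi\in C^\infty(\mathbb{R}/\mathbb{Z})$ and $c\in I_s^\infty$.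
   Context: $\mathbb{Z}_s$ is the compact ring of $s$-adic integers $x=\sum_{j\ge0}x_js^j$, $0\le x_j\le s-1$ (i.e. $\varprojlim\mathbb{Z}/s^n\mathbb{Z}$), and $\mathbb{Z}_s^\times=\{x\in\mathbb{Z}_s: x_0\ne0\}$ (a clopen subset; the elements of $s$-adic norm $1$). $H=\ell^2(\mathbb{Z})$ has canonical basis $\{E_l\}_{l\in\mathbb{Z}}$; $VE_l=E_{sl}$ and $M_fE_l=f(l)E_l$ for $f\in C(\mathbb{Z}_s)$. $HS(s)\subseteq B(H)$ is the C$^*$-algebra generated by $V$ and all $M_f$, $f\in C(\mathbb{Z}_s)$. Every nonzero $l\in\mathbb{Z}$ is written uniquely as $l=s^ml'$ with $m\ge0$, $s\nmid l'$. For $F\in C_0(\mathbb{Z}_{\ge0}\times\mathbb{Z}_s^\times)$ put $M_FE_{s^ml'}=F(m,l')E_{s^ml'}$, $M_FE_0=0$. RD (rapid decay) means decaying faster than any inverse polynomial in the indices. $I_s^\infty\subseteq HS(s)$ is the set of norm-convergent sums $a=\sum_{n\ge0}V^nM_{F_n}+\sum_{n<0}M_{F_n}(V^* )^{-n}$ with $F_n\in C_0(\mathbb{Z}_{\ge0}\times\mathbb{Z}_s^\times)$ and $\{\sup_x|F_n(m,x)|\}_{m,n}$ RD in $(m,n)$. For $\phi\in C^\infty(\mathbb{R}/\mathbb{Z})$ with Fourier coefficients $\phi_m$, $T(\phi)=\sum_{m\ge0}\phi_mV^m+\sum_{m<0}\phi_m(V^* )^{-m}$ (norm convergent). The smooth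 Hensel-Steinitz algebra is $HS^\infty(s)=\{T(\phi)+c:\phi\in C^\infty(\mathbb{R}/\mathbb{Z}),\,c\in I_s^\infty\}$. *)

(* Defs.v *)
From HB Require Import structures.
From mathcomp Require Import all_boot all_order all_algebra.
From mathcomp Require Import all_classical all_reals all_analysis.
From mathcomp Require Import complex ring lra.

Set Implicit Arguments.
Unset Strict Implicit.
Unset Printing Implicit Defensive.

Import Order.TTheory GRing.Theory Num.Theory.
Import numFieldNormedType.Exports.

Local Open Scope classical_set_scope.
Local Open Scope ring_scope.

Section hilbert_space.
Context {R : realType}.

(* R[i]^o rather than R[i]: only the former carries a topology and the
   R[i]-module structure in the libraries. *)
Definition sqsum (u : int -> R[i]^o) : \bar R :=
  (\esum_(l in [set: int]) ((Normc.normc (u l)) ^+ 2)%:E)%E.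

Definition ell2_pred : {pred int -> R[i]^o} :=
  mem [set u : int -> R[i]^o | (sqsum u < +oo)%E].

Lemma ell2P (u : int -> R[i]^o) : reflect (sqsum u < +oo)%E (u \in ell2_pred).
Proof. by apply: (iffP idP) => [/set_mem|/mem_set]. Qed.

Lemma normcZD_sqr (k z w : R[i]) :
  Normc.normc (k * z + w) ^+ 2 <=
  (2 * Normc.normc k ^+ 2) * Normc.normc z ^+ 2 + 2 * Normc.normc w ^+ 2.
Proof.
have normcD (a b : R[i]) :
    Normc.normc (a + b) <= Normc.normc a + Normc.normc b.
  by have := ler_normD a b; rewrite !normc_def; case: a b => [a1 a2] [b1 b2] /=;
    simpc => /andP[].
have h0 (a : R[i]) : 0 <= Normc.normc a by case: a => *; exact: sqrtr_ge0.
apply: (@le_trans _ _ ((Normc.normc (k * z) + Normc.normc w) ^+ 2)).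
  by rewrite ler_sqr ?nnegrE ?addr_ge0.
rewrite Normc.normcM -mulrA -exprMn.
set a := _ * _; set b := Normc.normc w.
rewrite -subr_ge0 (_ : _ - _ = (a - b) ^+ 2) ?sqr_ge0//.
by rewrite sqrrB sqrrD !mulr_natl !mulr2n; ring.
Qed.

Lemma sqsum_scale_lty (c : R) (w : int -> R[i]^o) :
  0 <= c -> (sqsum w < +oo)%E ->
  (\esum_(l in [set: int]) (c * Normc.normc (w l) ^+ 2)%:E < +oo)%E.
Proof.
move=> c0 w2.
have sq0 (l : int) : (0 <= ((Normc.normc (w l)) ^+ 2)%:E)%E.
  by rewrite lee_fin sqr_ge0.
apply: (@le_lt_trans _ _ (c%:E * sqsum w)%E); last first.
  rewrite -(@fineK _ (sqsum w)) -?EFinM ?ltry//.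
  by rewrite ge0_fin_numE// esum_ge0.
apply: ge_ereal_sup => _ [X XT <-].
under eq_fsbigr do rewrite EFinM.
rewrite -ge0_mule_fsumr//; apply: lee_pmul => //; first exact: fsume_ge0.
by apply: ereal_sup_ubound; exists X.
Qed.

Lemma ell2_submod_closed : submod_closed ell2_pred.
Proof.
split.
  apply/ell2P; rewrite /sqsum esum1 ?ltry// => l _ /=.
  by rewrite /= expr0n/= addr0 sqrtr0 expr0n.
move=> k u v /ell2P u2 /ell2P v2; apply/ell2P.
have k0 : 0 <= 2 * Normc.normc k ^+ 2 by rewrite mulr_ge0 ?sqr_ge0.
apply: le_lt_trans (lte_add_pinfty (sqsum_scale_lty k0 u2) (@sqsum_scale_lty 2 v _ v2)) => //.
rewrite -esumD => [|l _|l _]; last 2 first.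
- by rewrite lee_fin; exact: mulr_ge0 k0 (sqr_ge0 _).
- by rewrite lee_fin; exact: mulr_ge0 (ler0n _ 2) (sqr_ge0 _).
by apply: le_esum => l _; rewrite lee_fin; exact: normcZD_sqr.
Qed.

HB.instance Definition _ :=
  GRing.isSubmodClosed.Build R[i] (int -> R[i]^o) ell2_pred ell2_submod_closed.
End hilbert_space.
Arguments ell2_pred R : clear implicits.

Record ell2 (R : realType) := Ell2 {
  ell2_val :> int -> R[i]^o;
  ell2_valP : ell2_val \in ell2_pred R }.

HB.instance Definition _ R := [isSub for @ell2_val R].
HB.instance Definition _ R := [Choice of ell2 R by <:].
HB.instance Definition _ R := [SubChoice_isSubLmodule of ell2 R by <:].

Definition operator (R : realType) : Type := ell2 R -> ell2 R.

Section operators.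
Context {R : realType}.
Implicit Types (x y : ell2 R) (A B : operator R).

Definition csum (u : int -> R[i]^o) : R[i] :=
  limn (fun N => \sum_(k < N) u (Posz k)) +
  limn (fun N => \sum_(k < N) u (Negz k)).

Definition dot x y : R[i] := csum (fun l => x l * ((y l)^*)%C).

Definition l2norm x : R := Num.sqrt (fine (sqsum x)).

Definition opnorm A : \bar R :=
  ereal_sup [set (l2norm (A x))%:E | x in [set x | l2norm x <= 1]].

Definition bounded_operators : set (operator R) :=
  [set A | linear A /\ (opnorm A < +oo)%E].

Definition is_adjoint A B :=
  bounded_operators B /\ forall x y, dot (A x) y = dot x (B y).

(* The adjoint; 0 is a default value never taken when A is bounded. *)
Definition adj A : operator R := xget 0 [set B | is_adjoint A B].

Definition op_cvg (u : nat -> operator R) A :=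
  bounded_operators A /\ (opnorm (u n - A) @[n --> \oo] --> 0%E).

(* A = \sum_(n >= 0) u_n + \sum_(n < 0) u_n, both series converging in norm. *)
Definition op_bisum (u : int -> operator R) A :=
  exists A1 A2, [/\ op_cvg (fun N => \sum_(k < N) u (Posz k)) A1,
                    op_cvg (fun N => \sum_(k < N) u (Negz k)) A2 &
                    A = A1 + A2].

Definition star_subalgebra (S : set (operator R)) :=
  [/\ S `<=` bounded_operators, S 0,
      (forall (k : R[i]) A B, S A -> S B -> S (k *: A + B)),
      (forall A B, S A -> S B -> S (A \o B)) &
      (forall A, S A -> S (adj A))].

Definition norm_closed (S : set (operator R)) :=
  forall u A, (forall n : nat, S (u n)) -> op_cvg u A -> S A.

Definition cstar_generated (G : set (operator R)) : set (operator R) :=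
  smallest [set S | star_subalgebra S /\ norm_closed S] G.

Definition dense_in (S S' : set (operator R)) :=
  forall A, S' A -> exists2 u : nat -> operator R,
    (forall n, S (u n)) & op_cvg u A.

Definition two_sided_ideal (I S : set (operator R)) :=
  [/\ I `<=` S, I 0,
      (forall (k : R[i]) A B, I A -> I B -> I (k *: A + B)) &
      (forall A C, S A -> I C -> I (A \o C) /\ I (C \o A))].

Definition coset (I : set (operator R)) A : set (operator R) :=
  [set A + C | C in I].

(* x \in l^2 with coordinates u; 0 is a default value when u is not in l^2. *)
Definition mk_ell2 (u : int -> R[i]^o) : ell2 R := insubd 0 u.

Definition ell2_basis (l : int) : ell2 R := mk_ell2 (fun k => (k == l)%:R).

Definition diag_op (g : int -> R[i]) : operator R :=
  fun x => mk_ell2 (fun l => g l * x l).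

Definition shift_op (s : nat) : operator R :=
  fun x => mk_ell2 (fun k => if (s%:Z %| k)%Z then x (k %/ s%:Z)%Z else 0).

Lemma basis_subproof (l : int) (c : R[i]) :
  (fun k => c * (k == l)%:R) \in ell2_pred R.
Proof.
apply/ell2P.
have -> : sqsum (fun k => c * (k == l)%:R) =
    (\esum_(k in [set l]) ((Normc.normc (c * (k == l)%:R)) ^+ 2)%:E)%E.
  rewrite [RHS]esum_mkcond /sqsum; apply: eq_esum => k _.
  case: ifPn => // kl; have /negPf-> : k != l.
    by apply: contraNneq kl => ->; exact/mem_set.
  by rewrite mulr0 Normc.normc0 expr0n.
by rewrite esum_set1 ?ltry// lee_fin sqr_ge0.
Qed.

Lemma basisE (l k : int) : ell2_basis l k = (k == l)%:R.
Proof.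
have e : (fun j => (j == l)%:R) = (fun j => 1 * (j == l)%:R) :> (int -> R[i]^o).
  by apply/funext => j; rewrite mul1r.
by rewrite /ell2_basis /mk_ell2 e insubdK ?basis_subproof//= mul1r.
Qed.

Lemma diag_op_basis (g : int -> R[i]) (l : int) :
  diag_op g (ell2_basis l) = g l *: ell2_basis l.
Proof.
have e : (fun k => g k * ell2_basis l k) = (fun k => g l * (k == l)%:R) :> (int -> R[i]^o).
  by apply/funext => k; rewrite basisE; case: eqP => [->|]//; rewrite !mulr0.
apply/val_inj/funext => k.
rewrite /diag_op /mk_ell2 e insubdK ?basis_subproof//.
by rewrite -basisE.
Qed.

Lemma shift_op_basis (s : nat) (l : int) : (0 < s)%N ->
  shift_op s (ell2_basis l) = ell2_basis (s%:Z * l).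
Proof.
move=> s0; congr mk_ell2; apply/funext => k; rewrite basisE.
have sz : s%:Z != 0 by rewrite eqz_nat -lt0n.
case: ifPn => [/dvdzP[q ->]|sk].
  by rewrite mulzK// mulrC (inj_eq (mulfI sz)).
by case: eqP sk => // ->; rewrite dvdz_mulr.
Qed.

Lemma diag_opE (g : int -> R[i]) x (l : int) :
  (exists M, forall k, Normc.normc (g k) <= M) -> diag_op g x l = g l * x l.
Proof.
move=> [M gM]; rewrite /diag_op /mk_ell2 insubdK//; apply/ell2P.
apply: (@le_lt_trans _ _
    (\esum_(k in [set: int]) (M ^+ 2 * Normc.normc (x k) ^+ 2)%:E)%E); last first.
  by apply: sqsum_scale_lty; [exact: sqr_ge0|exact/ell2P/ell2_valP].
apply: le_esum => k _; rewrite lee_fin Normc.normcM exprMn.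
apply: ler_wpM2r; first exact: sqr_ge0.
have n0 : 0 <= Normc.normc (g k) by case: (g k) => *; exact: sqrtr_ge0.
by rewrite ler_sqr ?nnegrE// (le_trans n0).
Qed.

Lemma shift_opE (s : nat) x (k : int) : (0 < s)%N ->
  shift_op s x k = if (s%:Z %| k)%Z then x (k %/ s%:Z)%Z else 0.
Proof.
move=> s0; have sz : s%:Z != 0 by rewrite eqz_nat -lt0n.
rewrite /shift_op /mk_ell2 insubdK//; apply/ell2P.
suff -> : sqsum (fun k => if (s%:Z %| k)%Z then x (k %/ s%:Z)%Z else 0) = sqsum x.
  exact/ell2P/ell2_valP.
rewrite /sqsum -[LHS](eq_esum (a := fun k => if k \in [set k | (s%:Z %| k)%Z]
    then ((Normc.normc (x (k %/ s%:Z)%Z)) ^+ 2)%:E else 0%E)); last first.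
  move=> j _; rewrite mem_setE unfold_in/=; case: ifPn => // _.
  by rewrite /= expr0n/= addr0 sqrtr0 expr0n.
rewrite -esum_mkcond (@reindex_esum _ _ _ setT _ (fun l => l * s%:Z)).
  by apply: eq_esum => l _; rewrite mulzK.
split.
- by move=> l _ /=; rewrite dvdz_mull.
- by move=> l m _ _; exact: (mulIf sz).
- by move=> _ /dvdzP[q ->]; exists q.
Qed.

End operators.

(* The s-adic integers, by their digits; meaningful for s >= 2, when 'Z_s has
   exactly s elements. *)
Definition padic (s : nat) : Type :=
  prod_topology (fun _ : nat => discrete_topology 'Z_s).

Definition padic_unit (s : nat) : set (padic s) :=
  [set x | (x 0%N : 'Z_s) != 0].

(* digits of l in base s, with floor division: -1 = \sum_j (s - 1) s^j *)
Definition padic_of_int (s : nat) (l : int) : padic s :=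
  fun j => (l %/ (s ^ j)%N%:Z)%Z%:~R : 'Z_s.

(* For l != 0 and s >= 2, the m and l' such that l = s^m * l', ~ s %| l'. *)
Definition s_val (s : nat) (l : int) : nat :=
  \max_(k < `|l|%N.+1 | (s ^ k %| `|l|)%N) k.

Definition s_unit (s : nat) (l : int) : int :=
  (l %/ (s ^ s_val s l)%N%:Z)%Z.

Section hensel_steinitz.
Context {R : realType}.
Variable s : nat.

Let V : operator R := shift_op s.

(* V^n for n >= 0, (V^* )^(-n) for n < 0 *)
Definition shift_pow (n : int) : operator R :=
  match n with
  | Posz k => iter k V
  | Negz k => iter k.+1 (adj V)
  end.

Definition mult_op (f : padic s -> R[i]^o) : operator R :=
  diag_op (fun l => f (padic_of_int s l)).

Definition HS : set (operator R) :=
  cstar_generated ([set V] `|` [set mult_op f | f in [set f | continuous f]]).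

Definition C0_on (X : topologicalType) (D : set X) (F : X -> R[i]^o) :=
  {within D, continuous F} /\
  forall e : R, 0 < e -> compact (D `&` [set p | e <= Normc.normc (F p)]).

(* Elements of C_0(Z_{>=0} x Z_s^x) are represented by functions on the larger
   space nat * Z_s, the values outside Z_{>=0} x Z_s^x being irrelevant. *)
Definition C0_fun : set (nat * padic s -> R[i]^o) :=
  [set F | C0_on ([set: nat] `*` @padic_unit s) F].

Definition mult_op0 (F : nat * padic s -> R[i]^o) : operator R :=
  diag_op (fun l =>
    if l == 0 then 0 else F (s_val s l, padic_of_int s (s_unit s l))).

Definition rapid_decay (a : nat -> int -> R) :=
  forall k : nat, exists M : R, forall m n,
    (1 + m%:R + `|n|%N%:R) ^+ k * `|a m n| <= M.

Definition Ismooth : set (operator R) :=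
  [set A | exists F : int -> nat * padic s -> R[i]^o,
    [/\ (forall n, C0_fun (F n)),
        rapid_decay (fun m n =>
          sup [set Normc.normc (F n (m, x)) | x in @padic_unit s]) &
        op_bisum (fun n => if 0 <= n then shift_pow n \o mult_op0 (F n)
                           else mult_op0 (F n) \o shift_pow n) A]].

(* C^oo(R/Z), as 1-periodic functions on R *)
Definition smooth_circle : set (R -> R[i]) :=
  [set phi | (forall t, phi (t + 1) = phi t) /\
    forall (n : nat) (t : R),
      derivable (derive1n n (fun u => complex.Re (phi u))) t 1 /\
      derivable (derive1n n (fun u => complex.Im (phi u))) t 1].

Definition cint01 (f : R -> R[i]) : R[i] :=
  ((\int[lebesgue_measure]_(t in `[0, 1]) complex.Re (f t)) +i*
   (\int[lebesgue_measure]_(t in `[0, 1]) complex.Im (f t)))%C.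

(* integral over [0, 1] of phi(t) exp(-2 pi i m t) *)
Definition fourier_coef (phi : R -> R[i]) (m : int) : R[i] :=
  cint01 (fun t => phi t *
    (cos (2 * pi * m%:~R * t) -i* sin (2 * pi * m%:~R * t))%C).

(* 0 is a default value; the series converges for smooth phi. *)
Definition Toeplitz (phi : R -> R[i]) : operator R :=
  xget 0 [set A | op_bisum (fun m => fourier_coef phi m *: shift_pow m) A].

Definition HSsmooth : set (operator R) :=
  [set A | exists phi c,
    [/\ smooth_circle phi, Ismooth c & A = Toeplitz phi + c]].

(* Phi is an isomorphism of *-algebras from the quotient S / I, the set of
   cosets of I in S, onto the smooth functions on the circle. *)
Definition quotient_iso (S I : set (operator R))
    (Phi : set (operator R) -> (R -> R[i])) :=
  [/\ set_bij [set coset I a | a in S] smooth_circle Phi,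
      (forall (k : R[i]) a b, S a -> S b ->
        Phi (coset I (k *: a + b)) =
          fun t => k * Phi (coset I a) t + Phi (coset I b) t),
      (forall a b, S a -> S b ->
        Phi (coset I (a \o b)) =
          fun t => Phi (coset I a) t * Phi (coset I b) t) &
      (forall a, S a ->
        Phi (coset I (adj a)) = fun t => ((Phi (coset I a) t)^*)%C)].

End hensel_steinitz.

(* Main.v *)
(* Everything is read off matrices. The nonzero integers split into the orbits
   {s^m x : m >= 0} of multiplication by s, one for each integer x not divisible
   by s. The elements of the smooth ideal are exactly the bounded operators whose
   matrix vanishes between different orbits and at E_0, and is K(j, m; x) on the
   orbit of x, with K continuous in x in Z_s^x and rapidly decreasing in (j, m).
   T(phi) acts on each orbit by the Toeplitz matrix phi_(j-m), and on E_0 by phi(0).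
   Stability of the ideal is then the fact that the product of a rapidly decreasing
   matrix by one with rapid off-diagonal decay is rapidly decreasing, and
   T(phi) T(psi) - T(phi psi) has entries - sum_(i < 0) phi_(j-i) psi_(i-m), rapidly
   decreasing in (j, m). T(phi) - T(psi) can only lie in the ideal when phi = psi,
   since its entries are constant along diagonals. Density follows by approximating
   f in C(Z_s) by f(0) plus a function vanishing near 0. *)

Require Import Defs.
From HB Require Import structures.
From mathcomp Require Import all_boot all_order all_algebra.
From mathcomp Require Import all_classical all_reals all_analysis.
From mathcomp Require Import complex ring lra zify.

Set Implicit Arguments.
Unset Strict Implicit.
Unset Printing Implicit Defensive.

Import Order.TTheory GRing.Theory Num.Theory.
Import numFieldNormedType.Exports.

Local Open Scope classical_set_scope.
Local Open Scope ring_scope.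

(** Neither [adj] nor [Toeplitz] comes with existence: both are choices by [xget]. Adjoints and
    norm-convergent sums are therefore first constructed by coordinates in the basis E_l, then
    recognised by their matrix entries. An infinite sum is never computed: it is a limit of partial
    sums, compared with another limit of the same sequence. Fourier analysis enters four times.
    Rapid decay of the coefficients, by integration by parts, makes the Toeplitz series converge.
    Inversion at 0 gives the entry phi(0) at E_0, a vector fixed by every power of V. The
    convolution formula runs over all integers, whereas a product of Toeplitz matrices only sees the
    indices i >= 0. Inversion at every point recovers phi from its coefficients. Kernels are taken
    continuous on all of Z_s although only their values on units matter: the units are clopen, so
    cutting a function to 0 elsewhere keeps it continuous. Products with the ideal are estimated on
    one side only; adjoints give the other. *)

Local Notation normc := Normc.normc.

(** * Complex numbers and the space l^2(Z) *)

Section complex_norm.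
Context {R : realType}.
Implicit Types (z w : R[i]).

Lemma normc_ge0 z : 0 <= normc z.
Proof. by case: z => *; exact: sqrtr_ge0. Qed.

Lemma normr_normc z : `|z| = (normc z)%:C%C.
Proof. by rewrite normc_def; case: z. Qed.

Lemma normcD z w : normc (z + w) <= normc z + normc w.
Proof. by have := ler_normD z w; rewrite !normr_normc -rmorphD /= lecR. Qed.

Lemma normcN z : normc (- z) = normc z.
Proof. by have := normrN z; rewrite !normr_normc => /complexI. Qed.

Lemma normcBC z w : normc (z - w) = normc (w - z).
Proof. by rewrite -normcN opprB. Qed.

Lemma normc_conj z : normc (z^*)%C = normc z.
Proof. by case: z => a b /=; rewrite sqrrN. Qed.

Lemma normc_real (r : R) : normc r%:C%C = `|r|.
Proof. by rewrite /= expr0n/= addr0 sqrtr_sqr. Qed.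

Lemma sqr_normcE z : ((normc z ^+ 2)%:C)%C = z * (z^*)%C.
Proof. by rewrite rmorphXn /= -normr_normc sqr_normc. Qed.

Lemma normc_sum (I : Type) (r : seq I) (P : pred I) (F : I -> R[i]) :
  normc (\sum_(i <- r | P i) F i) <= \sum_(i <- r | P i) normc (F i).
Proof.
elim/big_ind2 : _ => //; first by rewrite Normc.normc0.
by move=> a b c d ab cd; apply: le_trans (normcD _ _) (lerD _ _).
Qed.

(** In R[i] the condition 0 < e forces e to be real, so real radii capture the topology. *)
Lemma cvgCP {T} {F : set_system T} {FF : Filter F} (f : T -> R[i]^o) (a : R[i]^o) :
  f @ F --> a <-> forall e : R, 0 < e -> \forall x \near F, normc (a - f x) < e.
Proof.
split=> [/cvgrPdist_lt fa e e0|fa].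
  have := fa e%:C%C; rewrite ltcR => /(_ e0); apply: filterS => x.
  by rewrite normr_normc ltcR.
apply/cvgrPdist_lt => -[e e']; rewrite ltcE /= => /andP[/eqP -> e0].
apply: filterS (fa _ e0) => x.
by rewrite normr_normc ltcE /= eqxx.
Qed.

Lemma cvgC_unique {T} {F : set_system T} {FF : ProperFilter F} (f : T -> R[i]^o)
  (a b : R[i]^o) : f @ F --> a -> f @ F --> b -> a = b.
Proof. exact: (@cvg_unique _ (@norm_hausdorff _ R[i]^o)). Qed.

Lemma cvgC_le (u : nat -> R[i]^o) (a z : R[i]^o) (M : R) :
  u @ \oo --> a -> (\forall n \near \oo, normc (z - u n) <= M) -> normc (z - a) <= M.
Proof.
move=> /cvgCP ua uM; apply/ler_addgt0Pr => e e0.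
have [n [un1 un2]] : exists n, normc (a - u n) < e /\ normc (z - u n) <= M.
  by near \oo => n; exists n; split; near: n; [exact: ua|].
rewrite (_ : z - a = (z - u n) + (u n - a)); last by ring.
by apply: le_trans (normcD _ _) _; rewrite lerD// ?(normcBC (u n)) ltW.
Unshelve. all: by end_near. Qed.

Lemma cvgC_le0 (u : nat -> R[i]^o) (a : R[i]^o) (M : R) :
  u @ \oo --> a -> (\forall n \near \oo, normc (u n) <= M) -> normc a <= M.
Proof.
move=> ua uM; rewrite -normcN -sub0r; apply: cvgC_le ua _.
by apply: filterS uM => n; rewrite sub0r normcN.
Qed.

Lemma cvgC_conj {T} {F : set_system T} {FF : Filter F} (f : T -> R[i]^o) (a : R[i]^o) :
  f @ F --> a -> (fun x => (f x)^*%C : R[i]^o) @ F --> (a^*%C : R[i]^o).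
Proof.
move=> /cvgCP fa; apply/cvgCP => e e0; apply: filterS (fa _ e0) => x.
by rewrite -(normc_conj (a - _)) rmorphB.
Qed.

Lemma cvgC_ReIm (u : nat -> R[i]^o) (a b : R) :
  (fun n => complex.Re (u n)) @ \oo --> a -> (fun n => complex.Im (u n)) @ \oo --> b ->
  u @ \oo --> ((a +i* b)%C : R[i]^o).
Proof.
move=> /cvgrPdist_lt ua /cvgrPdist_lt ub; apply/cvgCP => e e0.
have e20 : 0 < e / 2 by rewrite divr_gt0.
near=> n.
rewrite (_ : (a +i* b)%C - u n = (a - complex.Re (u n))%:C%C + 'i%C * (b - complex.Im (u n))%:C%C); last first.
  by case: (u n) => c d; simpc.
apply: le_lt_trans (normcD _ _) _; rewrite Normc.normcM !normc_real.
rewrite (_ : normc 'i%C = 1) ?mul1r; last by rewrite /= expr0n expr1n add0r sqrtr1.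
rewrite [ltRHS](splitr e) ltrD//; near: n; [exact: ua|exact: ub].
Unshelve. all: by end_near. Qed.

End complex_norm.

(** * Finite windows of integers *)

Section windows.

(** The integers -N <= l < N, listed in the two halves used by [csum] and [op_bisum]: a pair of
    one-sided partial sums becomes one finite sum. *)
Definition win (N : nat) : seq int :=
  map Posz (iota 0 N) ++ map Negz (iota 0 N).

Lemma win_sum (V : nmodType) (u : int -> V) N :
  \sum_(l <- win N) u l = \sum_(k < N) u (Posz k) + \sum_(k < N) u (Negz k).
Proof. by rewrite big_cat/= !big_map -!(big_mkord xpredT (fun k => u (_ k)))/= /index_iota subn0. Qed.

Lemma win_sumS (V : nmodType) (u : int -> V) N :
  \sum_(l <- win N.+1) u l = \sum_(l <- win N) u l + (u (Posz N) + u (Negz N)).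
Proof. by rewrite !win_sum !big_ord_recr/= addrACA. Qed.

Lemma mem_win N (l : int) : (l \in win N) = (- N%:Z <= l < N%:Z).
Proof.
rewrite mem_cat; case: l => n.
  rewrite mem_map; last by move=> ? ? [].
  rewrite mem_iota/= add0n (_ : _ \in map Negz _ = false) ?orbF; last first.
    by apply/mapP => -[].
  lia.
rewrite (mem_map (f := Negz)); last by move=> ? ? [].
rewrite mem_iota/= add0n (_ : _ \in map Posz _ = false) ?orbF; last first.
  by apply/mapP => -[].
rewrite NegzE; lia.
Qed.

Lemma win_uniq N : uniq (win N).
Proof.
rewrite cat_uniq !map_inj_uniq ?iota_uniq//=; try by move=> ? ? [].
by rewrite andbT; apply/hasPn => _ /mapP[n _ ->]; apply/mapP => -[].
Qed.

Lemma seq_sub_win (X : seq int) : exists N, {subset X <= win N}.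
Proof.
elim: X => [|x X [N XN]]; first by exists 0%N.
exists (maxn N (`|x|%N.+1)) => y; rewrite inE mem_win => /orP[/eqP->|/XN].
  by have := leq_maxr N (`|x|%N.+1); lia.
by have := leq_maxl N (`|x|%N.+1); rewrite mem_win; lia.
Qed.

Lemma sub_win N M : (N <= M)%N -> {subset win N <= win M}.
Proof. by move=> NM l; rewrite !mem_win; lia. Qed.

Lemma ler_sum_subseq (R : realType) (X Y : seq int)
  (P : pred int) (F : int -> R) :
  uniq X -> uniq Y -> {subset X <= Y} -> (forall l, 0 <= F l) ->
  \sum_(l <- X | P l) F l <= \sum_(l <- Y | P l) F l.
Proof.
move=> uX uY XY F0.
rewrite [leRHS](bigID (mem X))/= -[leLHS]addr0 lerD//; last exact: sumr_ge0.
rewrite le_eqVlt; apply/orP; left; apply/eqP.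
rewrite -big_filter -[RHS]big_filter; apply: perm_big.
apply: uniq_perm; rewrite ?filter_uniq// => l.
by rewrite !mem_filter; case: (P l) => //=; case: (boolP (l \in X)) => // /XY ->.
Qed.



End windows.

(** * The norm of l^2(Z) and approximation by finite combinations of basis vectors *)

Section ell2_theory.
Context {R : realType}.
Implicit Types (x y : ell2 R).

Lemma ell2_valD x y l : (x + y) l = x l + y l. Proof. by []. Qed.
Lemma ell2_valN x l : (- x) l = - x l. Proof. by []. Qed.
Lemma ell2_valZ (k : R[i]) x l : (k *: x) l = k * x l. Proof. by []. Qed.
Lemma ell2_val0 l : (0 : ell2 R) l = 0. Proof. by []. Qed.
Lemma ell2_val_sum (I : Type) (r : seq I) (P : pred I) (F : I -> ell2 R) l :
  (\sum_(i <- r | P i) F i) l = \sum_(i <- r | P i) F i l.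
Proof. by elim/big_rec2 : _ => // i y1 y2 _ <-. Qed.

Lemma ell2_ext x y : (forall l, x l = y l) -> x = y.
Proof. by move=> xy; apply/val_inj/funext. Qed.

Lemma sqsum_fin_num x : sqsum x \is a fin_num.
Proof.
rewrite ge0_fin_numE; first exact/ell2P/ell2_valP.
by apply: esum_ge0 => l _; rewrite lee_fin sqr_ge0.
Qed.

Lemma sqr_l2norm x : (l2norm x ^+ 2)%:E = sqsum x.
Proof.
rewrite /l2norm sqr_sqrtr; first by rewrite fineK// sqsum_fin_num.
by rewrite fine_ge0// esum_ge0// => l _; rewrite lee_fin sqr_ge0.
Qed.

Lemma l2norm_ge0 x : 0 <= l2norm x. Proof. exact: sqrtr_ge0. Qed.

Lemma l2_ge_seq x (X : seq int) : uniq X ->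
  \sum_(l <- X) normc (x l) ^+ 2 <= l2norm x ^+ 2.
Proof.
move=> uX; rewrite -lee_fin sqr_l2norm; apply: ereal_sup_ubound.
exists [set` X]; first by split => //; exact: finite_seq.
by rewrite -fsbig_seq// sumEFin.
Qed.

Lemma sqsum_le (u : int -> R[i]^o) (C : R) :
  (forall N, \sum_(l <- win N) normc (u l) ^+ 2 <= C) -> (sqsum u <= C%:E)%E.
Proof.
move=> uC; apply: ge_ereal_sup => _ [X [fX _] <-].
have [Y XY] : exists Y : seq int, X = [set` Y] /\ uniq Y.
  have /finite_seqP[Y ->] := fX; exists (undup Y); rewrite undup_uniq; split => //.
  by apply/seteqP; split => l /=; rewrite mem_undup.
case: XY => -> uY; rewrite -fsbig_seq// sumEFin lee_fin.
have [N YN] := seq_sub_win Y.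
apply: le_trans (uC N); apply: ler_sum_subseq => //; first exact: win_uniq.
by move=> l; exact: sqr_ge0.
Qed.

Lemma l2norm_le x (C : R) : 0 <= C ->
  (forall N, \sum_(l <- win N) normc (x l) ^+ 2 <= C ^+ 2) -> l2norm x <= C.
Proof.
move=> C0 /sqsum_le; rewrite -sqr_l2norm lee_fin.
by rewrite ler_sqr ?nnegrE// l2norm_ge0.
Qed.

Lemma mk_ell2E (u : int -> R[i]^o) (C : R) :
  (forall N, \sum_(l <- win N) normc (u l) ^+ 2 <= C) -> forall l, mk_ell2 u l = u l.
Proof.
move=> /sqsum_le uC l; rewrite /mk_ell2 insubdK//; apply/ell2P.
by apply: le_lt_trans uC _; rewrite ltry.
Qed.

Lemma coord_le x l : normc (x l) <= l2norm x.
Proof.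
have := @l2_ge_seq x [:: l]; rewrite /= big_seq1 => /(_ isT).
by rewrite ler_sqr ?nnegrE ?normc_ge0 ?l2norm_ge0.
Qed.

Lemma l2norm0 : l2norm (0 : ell2 R) = 0.
Proof.
apply/eqP; rewrite eq_le l2norm_ge0 andbT; apply: l2norm_le => // N.
by rewrite big1 ?expr0n// => l _; rewrite ell2_val0 Normc.normc0 expr0n.
Qed.

Lemma l2norm_eq0 x : l2norm x = 0 -> x = 0.
Proof.
move=> x0; apply: ell2_ext => l; apply: Normc.eq0_normc; apply/eqP.
by rewrite eq_le normc_ge0 andbT -x0 coord_le.
Qed.

(** Cauchy-Schwarz from 2ab <= t a^2 + b^2 / t at the optimal t = B / A. Shifting A and B by a small
    d keeps t defined when one of them is 0. *)
Lemma sum_CS (I : Type) (r : seq I) (a b : I -> R) (A B : R) :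
  0 <= A -> 0 <= B ->
  \sum_(i <- r) a i ^+ 2 <= A ^+ 2 -> \sum_(i <- r) b i ^+ 2 <= B ^+ 2 ->
  \sum_(i <- r) a i * b i <= A * B.
Proof.
move=> A0 B0 aA bB; apply/ler_addgt0Pr => e e0.
have [d d0 dAB] : exists2 d, 0 < d & (A + d) * (B + d) <= A * B + e.
  exists (Num.min 1 (e / (A + B + 1))).
    by rewrite lt_min ltr01 divr_gt0// ltr_wpDl// addr_ge0.
  have AB1 : 0 < A + B + 1 by rewrite ltr_wpDl// addr_ge0.
  set d := Num.min _ _.
  have d1 : d <= 1 by rewrite ge_min lexx.
  have de : d * (A + B + 1) <= e.
    by rewrite -ler_pdivlMr// ge_min lexx orbT.
  have d0 : 0 < d by rewrite lt_min ltr01 divr_gt0.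
  have : d * d <= d by rewrite ler_piMr// ltW.
  nra.
have Ad : 0 < A + d by rewrite ltr_wpDl.
have Bd : 0 < B + d by rewrite ltr_wpDl.
apply: le_trans dAB.
set t := (B + d) / (A + d).
have t0 : 0 < t by rewrite divr_gt0.
have -> : (A + d) * (B + d) = (t * (A + d) ^+ 2 + t^-1 * (B + d) ^+ 2) / 2.
  by rewrite /t; field; rewrite ?gt_eqF.
apply: (@le_trans _ _ (\sum_(i <- r) (t * a i ^+ 2 + t^-1 * b i ^+ 2) / 2)).
  apply: ler_sum => i _.
  rewrite -subr_ge0 (_ : _ - _ = t^-1 * (t * a i - b i) ^+ 2 / 2).
    by rewrite divr_ge0// mulr_ge0 ?sqr_ge0// invr_ge0 ltW.
  by field; rewrite gt_eqF.
rewrite -mulr_suml big_split/= -!mulr_sumr ler_pM2r// lerD// ler_pM2l ?invr_gt0//.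
  by apply: le_trans aA _; rewrite ler_sqr ?nnegrE ?(ltW Ad)// lerDl ltW.
by apply: le_trans bB _; rewrite ler_sqr ?nnegrE ?(ltW Bd)// lerDl ltW.
Qed.

Lemma l2norm_triangle x y : l2norm (x + y) <= l2norm x + l2norm y.
Proof.
apply: l2norm_le => [|N]; first by rewrite addr_ge0// l2norm_ge0.
have xN := l2_ge_seq x (win_uniq N); have yN := l2_ge_seq y (win_uniq N).
apply: (@le_trans _ _ (\sum_(l <- win N) normc (x l) ^+ 2 +
    (\sum_(l <- win N) normc (x l) * normc (y l)) *+ 2 +
    \sum_(l <- win N) normc (y l) ^+ 2)).
  rewrite -sumrMnl -!big_split/=; apply: ler_sum => l _.
  by rewrite -sqrrD ler_sqr ?nnegrE ?addr_ge0 ?normc_ge0 ?normcD.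
rewrite sqrrD; apply: lerD => //; apply: lerD => //; rewrite lerMn2r/=.
by apply: sum_CS => //; exact: l2norm_ge0.
Qed.

Lemma l2normZ (k : R[i]) x : l2norm (k *: x) <= normc k * l2norm x.
Proof.
apply: l2norm_le => [|N]; first by rewrite mulr_ge0 ?normc_ge0 ?l2norm_ge0.
under eq_bigr do rewrite ell2_valZ Normc.normcM exprMn.
by rewrite -mulr_sumr exprMn ler_wpM2l ?sqr_ge0// l2_ge_seq// win_uniq.
Qed.

Lemma l2normN x : l2norm (- x) = l2norm x.
Proof.
by rewrite /l2norm /sqsum; under eq_esum do rewrite ell2_valN normcN.
Qed.

Lemma basis_comb_coord (X : seq int) (c : int -> R[i]) k : uniq X ->
  (\sum_(l <- X) c l *: (ell2_basis l : ell2 R)) k = if k \in X then c k else 0.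
Proof.
move=> uX; rewrite ell2_val_sum.
under eq_bigr do rewrite ell2_valZ basisE.
case: ifPn => kX.
  rewrite (bigD1_seq k)//= eqxx mulr1 big1 ?addr0// => l lk.
  by rewrite eq_sym (negPf lk) mulr0.
rewrite big_seq big1// => l lX; case: eqP => [kl|]; last by rewrite mulr0.
by rewrite kl lX in kX.
Qed.

Lemma l2norm_win_lt x (e : R) : 0 < e ->
  exists N, l2norm x ^+ 2 - e < \sum_(l <- win N) normc (x l) ^+ 2.
Proof.
move=> e0; apply/not_existsP => H.
have {}H N : \sum_(l <- win N) normc (x l) ^+ 2 <= l2norm x ^+ 2 - e.
  by have /negP := H N; rewrite -leNgt.
have := sqsum_le H; rewrite -sqr_l2norm lee_fin; lra.
Qed.

(** The finite sets only have to exhaust the support of x: windows serve for a general x, initial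
    segments of one orbit serve in [has_mx_comp]. *)
Lemma l2_approx x (X : nat -> seq int) : (forall n, uniq (X n)) ->
  (forall l, x l != 0 -> \forall n \near \oo, l \in X n) ->
  forall e : R, 0 < e -> \forall n \near \oo,
    l2norm (x - \sum_(l <- X n) x l *: ell2_basis l) <= e.
Proof.
move=> uX xX e e0.
have [N xN] := @l2norm_win_lt x (e ^+ 2) (exprn_gt0 2 e0).
have : \forall n \near \oo, forall l, l \in win N -> x l != 0 -> l \in X n.
  elim: (win N) => [|a s IH]; first by near=> n.
  have [xa|xa] := eqVneq (x a) 0.
    apply: filterS IH => n H l; rewrite inE => /orP[/eqP->|/H//].
    by rewrite xa eqxx.
  near=> n => l; rewrite inE => /orP[/eqP->|]; last by move: l; near: n.
  by move=> _; near: n; exact: xX.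
apply: filterS => n Hn; apply: l2norm_le => [|N']; first exact: ltW.
have E l : normc ((x - \sum_(l <- X n) x l *: ell2_basis l) l) ^+ 2 =
    if l \notin X n then normc (x l) ^+ 2 else 0.
  rewrite ell2_valD ell2_valN basis_comb_coord//; case: ifPn => /=.
    by rewrite subrr Normc.normc0 expr0n.
  by rewrite subr0.
under eq_bigr do rewrite E.
rewrite -big_mkcond/=.
have e1 : \sum_(l <- win N) normc (x l) ^+ 2 =
    \sum_(l <- win N | l \in X n) normc (x l) ^+ 2.
  rewrite [LHS](bigID (mem (X n)))/= -[RHS]addr0; congr +%R.
  rewrite big_seq_cond big1// => l /andP[lN lX].
  have [->|x0] := eqVneq (x l) 0; first by rewrite Normc.normc0 expr0n.
  by rewrite Hn in lX.
have sq0 l : 0 <= normc (x l) ^+ 2 by exact: sqr_ge0.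
(* In a window containing both others, the mass inside [X n] already exceeds |x|^2 - e^2, since
   [X n] catches all of [win N]; less than e^2 is left for the mass outside [X n]. *)
have := @l2_ge_seq x (win (maxn N N')) (win_uniq _).
rewrite (bigID (mem (X n)))/=.
have := @ler_sum_subseq R _ _ (mem (X n)) (fun l => normc (x l) ^+ 2)
  (win_uniq N) (win_uniq _) (sub_win (leq_maxl N N')) sq0.
have := @ler_sum_subseq R _ _ (fun l => l \notin X n) (fun l => normc (x l) ^+ 2)
  (win_uniq N') (win_uniq _) (sub_win (leq_maxr N N')) sq0.
rewrite -e1 /=; lra.
Unshelve. all: by end_near. Qed.

Lemma l2_approx_win x (e : R) : 0 < e -> \forall n \near \oo,
  l2norm (x - \sum_(l <- win n) x l *: ell2_basis l) <= e.
Proof.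
move=> e0; apply: l2_approx => // [n|l _]; first exact: win_uniq.
exists (`|l|%N.+1) => // n /= ln; rewrite mem_win; lia.
Qed.

End ell2_theory.

Lemma cvg_bigsum {K : numFieldType} {V : normedModType K} {T : Type}
    {F : set_system T} {FF : Filter F} (I : Type) (r : seq I) (f : I -> T -> V) (a : I -> V) :
  (forall i, f i @ F --> a i) ->
  (fun x => \sum_(i <- r) f i x) @ F --> \sum_(i <- r) a i.
Proof.
move=> fa; elim: r => [|i r IH].
  by under eq_fun do rewrite big_nil; rewrite big_nil; exact: cvg_cst.
by under eq_fun do rewrite big_cons; rewrite big_cons; exact: cvgD.
Qed.

(** * Series dominated by a telescoping series *)

Section series.
Context {R : realType}.

(* telescopes: 1/((n+1)(n+2)) = 1/(n+1) - 1/(n+2) *)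
Definition tele (n : nat) : R := (n.+1%:R * n.+2%:R)^-1.

Lemma tele_gt0 n : 0 < tele n.
Proof. by rewrite invr_gt0 mulr_gt0. Qed.

Lemma teleE n : tele n = n.+1%:R^-1 - n.+2%:R^-1.
Proof.
rewrite /tele -[n.+2%:R]natr1; field.
by rewrite !gt_eqF// ltr_wpDl.
Qed.

Lemma sum_tele p q : (p <= q)%N -> \sum_(p <= k < q) tele k <= p.+1%:R^-1.
Proof.
move=> pq; under eq_bigr do rewrite teleE -opprB.
rewrite sumrN (telescope_sumr (fun k => k.+1%:R^-1 : R))// opprB lerBlDr lerDl.
by rewrite invr_ge0.
Qed.

Lemma cvgC_abs (u : nat -> R[i]^o) (C : R) :
  (forall N, \sum_(k < N) normc (u k) <= C) ->
  cvgn (fun N => \sum_(k < N) u k : R[i]^o).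
Proof.
move=> uC.
have H (f : R[i] -> R) : (forall z, `|f z| <= normc z) ->
    cvgn (series (fun k => f (u k))).
  move=> fn; apply: normed_cvg; apply: nondecreasing_is_cvgn.
    by apply: nondecreasing_series => n _ _; exact: normr_ge0.
  exists C => _ [N _ <-] /=; apply: le_trans (uC N).
  by rewrite /series/= big_mkord ler_sum.
have /cvg_ex[a ua] : cvgn (series (fun k => complex.Re (u k))).
  apply: H => -[x y] /=; rewrite -sqrtr_sqr; apply: ler_wsqrtr.
  by rewrite lerDl sqr_ge0.
have /cvg_ex[b ub] : cvgn (series (fun k => complex.Im (u k))).
  apply: H => -[x y] /=; rewrite -sqrtr_sqr; apply: ler_wsqrtr.
  by rewrite lerDr sqr_ge0.
apply/cvg_ex; exists (a +i* b)%C; apply: cvgC_ReIm.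
  apply: cvg_trans ua; apply: near_eq_cvg; near=> n.
  by rewrite /series/= big_mkord (raddf_sum (@complex.Re R : Rcomplex R -> R)).
apply: cvg_trans ub; apply: near_eq_cvg; near=> n.
by rewrite /series/= big_mkord (raddf_sum (@complex.Im R : Rcomplex R -> R)).
Unshelve. all: by end_near. Qed.

(** The rate M / (N + 1) depends on the majorant alone, hence is uniform in any parameter: this
    gives uniform convergence of Fourier series and continuity of sums of functions on Z_s. *)
Lemma cseries (u : nat -> R[i]^o) (M : R) :
  (forall n, normc (u n) <= M * tele n) ->
  exists2 a : R[i]^o, (fun N => \sum_(k < N) u k : R[i]^o) @ \oo --> a &
    forall N, normc (a - \sum_(k < N) u k) <= M / N.+1%:R.
Proof.
move=> uM.
have M0 : 0 <= M.
  by rewrite -(pmulr_lge0 _ (tele_gt0 0)) (le_trans _ (uM 0%N))// normc_ge0.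
have uu p q : (p <= q)%N -> \sum_(p <= k < q) normc (u k) <= M / p.+1%:R.
  move=> pq; apply: (@le_trans _ _ (\sum_(p <= k < q) M * tele k)).
    by apply: ler_sum => k _.
  by rewrite -mulr_sumr ler_wpM2l// sum_tele.
have /cvg_ex[a ua] : cvgn (fun N => \sum_(k < N) u k : R[i]^o).
  apply: (@cvgC_abs u (M / 1)) => N.
  by rewrite -(big_mkord xpredT (fun k => normc (u k))) uu.
exists a => // N; rewrite normcBC; apply: cvgC_le ua _.
near=> n.
have Nn : (N <= n)%N by near: n; exact: nbhs_infty_ge.
rewrite normcBC -!(big_mkord xpredT u) (big_cat_nat _ Nn)//= addrAC subrr add0r.
exact: le_trans (normc_sum _ _ _) (uu _ _ Nn).
Unshelve. all: by end_near. Qed.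

End series.

(** * The inner product *)

Section dot_theory.
Context {R : realType}.
Implicit Types (x y z : ell2 R).

Lemma sum_abs_dot x y (X : seq int) : uniq X ->
  \sum_(l <- X) normc (x l * (y l)^*%C) <= l2norm x * l2norm y.
Proof.
move=> uX; under eq_bigr do rewrite Normc.normcM normc_conj.
by apply: sum_CS; rewrite ?l2norm_ge0 ?l2_ge_seq.
Qed.

(** [csum] is written with [limn], which means nothing without convergence. Absolute convergence
    supplies it, and the algebra of [dot] then follows by uniqueness of limits. *)
Lemma dot_cvg x y :
  (fun N => \sum_(l <- win N) x l * (y l)^*%C : R[i]^o) @ \oo --> (dot x y : R[i]^o).
Proof.
under eq_fun do rewrite win_sum.
have H (f : nat -> int) : injective f ->
    cvgn (fun N => \sum_(k < N) x (f k) * (y (f k))^*%C : R[i]^o).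
  move=> fi; apply: (@cvgC_abs _ (fun k => x (f k) * (y (f k))^*%C) (l2norm x * l2norm y)) => N.
  rewrite -(big_mkord xpredT (fun k => normc (x (f k) * (y (f k))^*%C))).
  rewrite -(big_map f xpredT (fun l => normc (x l * (y l)^*%C))).
  by rewrite sum_abs_dot// map_inj_uniq// iota_uniq.
by apply: cvgD; apply: H => ? ? [].
Qed.

Arguments dot_cvg : clear implicits.

Lemma dot_linearl (k : R[i]) x y z :
  dot (k *: x + z) y = k * dot x y + dot z y.
Proof.
apply: (@cvgC_unique _ _ _ _ _ _ _ (dot_cvg (k *: x + z) y)).
under eq_fun do (under eq_bigr do rewrite ell2_valD ell2_valZ mulrDl -mulrA;
  rewrite big_split/= -mulr_sumr).
by apply: cvgD; [apply: cvgMr|]; exact: dot_cvg.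
Qed.

Lemma dotC x y : dot y x = (dot x y)^*%C.
Proof.
apply: (@cvgC_unique _ _ _ _ _ _ _ (dot_cvg y x)).
rewrite [X in X @ \oo --> _](_ : _ =
    (fun N => (\sum_(l <- win N) x l * (y l)^*%C)^*%C)).
  exact: cvgC_conj (dot_cvg x y).
apply/funext => N; rewrite rmorph_sum/=; apply: eq_bigr => l _.
by rewrite rmorphM/= conjcK mulrC.
Qed.

Lemma dotBl x y z : dot (x - z) y = dot x y - dot z y.
Proof. by rewrite addrC -scaleN1r dot_linearl mulN1r addrC. Qed.

Lemma dot0l y : dot 0 y = 0.
Proof. by rewrite -(subrr 0) dotBl subrr. Qed.

Lemma dot_suml (I : Type) (r : seq I) (c : I -> R[i]) (F : I -> ell2 R) y :
  dot (\sum_(i <- r) c i *: F i) y = \sum_(i <- r) c i * dot (F i) y.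
Proof.
elim: r => [|i r IH]; first by rewrite !big_nil dot0l.
by rewrite !big_cons dot_linearl IH.
Qed.

Lemma dot_CS x y : normc (dot x y) <= l2norm x * l2norm y.
Proof.
apply: cvgC_le0 (dot_cvg x y) _; near=> N.
by apply: le_trans (normc_sum _ _ _) _; rewrite sum_abs_dot// win_uniq.
Unshelve. all: by end_near. Qed.

Lemma dot_basisl l y : dot (ell2_basis l) y = (y l)^*%C.
Proof.
apply: (@cvgC_unique _ _ _ _ _ _ _ (dot_cvg _ _)).
apply: cvg_near_cst; exists (`|l|%N.+1) => // N /= lN.
have lw : l \in win N by rewrite mem_win; lia.
rewrite (bigD1_seq l)//= ?win_uniq// basisE eqxx mul1r big1 ?addr0// => k kl.
by rewrite basisE (negPf kl) mul0r.
Qed.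

Lemma dot_basisr l x : dot x (ell2_basis l) = x l.
Proof. by rewrite dotC dot_basisl conjcK. Qed.

End dot_theory.

(** * Bounded operators *)

Section operator_theory.
Context {R : realType}.
Implicit Types (x y z : ell2 R) (A B : operator R).

(** Real constants stand in for the extended real [opnorm]; [bnd_opnorm] translates between the
    two. *)
Definition bnd A (C : R) := forall x, l2norm (A x) <= C * l2norm x.

Lemma lin_D A x y : linear A -> A (x + y) = A x + A y.
Proof. by move=> lA; have := lA 1 x y; rewrite !scale1r. Qed.

Lemma lin_0 A : linear A -> A 0 = 0.
Proof. by move=> lA; have := lA (-1) 0 0; rewrite scaler0 addr0 scaleN1r addNr. Qed.

Lemma lin_Z A (k : R[i]) x : linear A -> A (k *: x) = k *: A x.
Proof. by move=> lA; rewrite -[k *: x]addr0 lA lin_0// addr0. Qed.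

Lemma lin_B A x y : linear A -> A (x - y) = A x - A y.
Proof. by move=> lA; rewrite -scaleN1r addrC lA scaleN1r addrC. Qed.

Lemma lin_sum A (I : Type) (r : seq I) (c : I -> R[i]) (F : I -> ell2 R) :
  linear A -> A (\sum_(i <- r) c i *: F i) = \sum_(i <- r) c i *: A (F i).
Proof.
move=> lA; elim: r => [|i r IH]; first by rewrite !big_nil lin_0.
by rewrite !big_cons lA IH.
Qed.

Lemma bnd_opnorm A (C : R) : linear A -> 0 <= C ->
  (opnorm A <= C%:E)%E <-> bnd A C.
Proof.
move=> lA C0; split=> [AbC x|AbC].
  have [x0|x0] := eqVneq (l2norm x) 0.
    by rewrite (l2norm_eq0 x0) lin_0// l2norm0 mulr0.
  have xp : 0 < l2norm x by rewrite lt_def x0 l2norm_ge0.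
  set y := ((l2norm x)^-1)%:C%C *: x.
  have xy : x = (l2norm x)%:C%C *: y.
    by rewrite scalerA -rmorphM/= divff// scale1r.
  have y1 : l2norm y <= 1.
    apply: le_trans (l2normZ _ _) _.
    by rewrite normc_real ger0_norm ?invr_ge0 ?l2norm_ge0// mulVf.
  have Ay : l2norm (A y) <= C.
    by rewrite -lee_fin; apply: le_trans AbC; apply: ereal_sup_ubound; exists y.
  rewrite {1}xy lin_Z//; apply: le_trans (l2normZ _ _) _.
  by rewrite normc_real ger0_norm ?l2norm_ge0// mulrC ler_wpM2r ?l2norm_ge0.
apply: ge_ereal_sup => _ [x /= x1 <-]; rewrite lee_fin.
by apply: le_trans (AbC x) _; rewrite ler_piMr.
Qed.

Lemma opnorm_ge0 A : (0 <= opnorm A)%E.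
Proof.
apply: (@le_trans _ _ (l2norm (A 0))%:E); first by rewrite lee_fin l2norm_ge0.
by apply: ereal_sup_ubound; exists 0 => //=; rewrite l2norm0.
Qed.

Lemma bnd_le A (C D : R) : C <= D -> bnd A C -> bnd A D.
Proof. by move=> CD AbC x; apply: le_trans (AbC x) _; rewrite ler_wpM2r// l2norm_ge0. Qed.

Lemma boundedP A : bounded_operators A <->
  linear A /\ exists2 C : R, 0 <= C & bnd A C.
Proof.
split=> [[lA Aoo]|[lA [C C0 AbC]]]; split => //.
  have fA : opnorm A \is a fin_num by rewrite ge0_fin_numE// opnorm_ge0.
  exists (fine (opnorm A)); first by rewrite fine_ge0// opnorm_ge0.
  by apply/bnd_opnorm; rewrite ?fine_ge0 ?opnorm_ge0// fineK.
by apply: (@le_lt_trans _ _ C%:E); rewrite ?ltry//; apply/bnd_opnorm.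
Qed.

Lemma bounded_linear A : bounded_operators A -> linear A.
Proof. by case. Qed.

Lemma bndD A B (C D : R) : bnd A C -> bnd B D -> bnd (A + B) (C + D).
Proof.
move=> AbC BD x; rewrite mulrDl; apply: le_trans (l2norm_triangle _ _) _.
exact: lerD (AbC x) (BD x).
Qed.

Lemma bndZ (k : R[i]) A (C : R) : bnd A C -> bnd (k *: A) (normc k * C).
Proof.
move=> AbC x; apply: le_trans (l2normZ k (A x)) _.
by rewrite -mulrA ler_wpM2l ?normc_ge0.
Qed.

Lemma bnd_comp A B (C D : R) : 0 <= C -> bnd A C -> bnd B D -> bnd (A \o B) (C * D).
Proof.
move=> C0 AbC BD x; apply: le_trans (AbC _) _.
by rewrite -mulrA ler_wpM2l.
Qed.

Lemma bounded0 : bounded_operators (0 : operator R).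
Proof.
apply/boundedP; split; first by move=> k x y /=; rewrite scaler0 addr0.
by exists 0 => // x; rewrite mul0r [_ x]/(0 : ell2 R) l2norm0.
Qed.

Lemma linear_scaleD (k : R[i]) A B : linear A -> linear B -> linear (k *: A + B).
Proof.
move=> lA lB c x y.
rewrite [LHS]/(k *: A (c *: x + y) + B (c *: x + y)) lA lB.
rewrite [RHS]/(c *: (k *: A x + B x) + (k *: A y + B y)).
rewrite !scalerDr !scalerA [c * k]mulrC.
exact: addrACA.
Qed.

Lemma bounded_scaleD (k : R[i]) A B : bounded_operators A -> bounded_operators B ->
  bounded_operators (k *: A + B).
Proof.
move=> /boundedP[lA [C C0 AbC]] /boundedP[lB [D D0 BD]]; apply/boundedP.
split; first exact: linear_scaleD.
exists (normc k * C + D); first by rewrite addr_ge0// mulr_ge0// normc_ge0.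
by apply: bndD => //; exact: bndZ.
Qed.

Lemma boundedD A B : bounded_operators A -> bounded_operators B ->
  bounded_operators (A + B).
Proof. by move=> bA bB; rewrite -[A]scale1r; exact: bounded_scaleD. Qed.

Lemma boundedZ (k : R[i]) A : bounded_operators A -> bounded_operators (k *: A).
Proof. by move=> bA; rewrite -[k *: A]addr0; apply: bounded_scaleD => //; exact: bounded0. Qed.

Lemma boundedB A B : bounded_operators A -> bounded_operators B ->
  bounded_operators (A - B).
Proof. by move=> bA bB; rewrite addrC -scaleN1r; exact: bounded_scaleD. Qed.

Lemma bounded_sum (I : Type) (r : seq I) (P : pred I) (F : I -> operator R) :
  (forall i, bounded_operators (F i)) -> bounded_operators (\sum_(i <- r | P i) F i).
Proof.
move=> bF; elim/big_ind : _ => //; first exact: bounded0.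
by move=> A B; exact: boundedD.
Qed.

Lemma bounded_comp A B : bounded_operators A -> bounded_operators B ->
  bounded_operators (A \o B).
Proof.
move=> /boundedP[lA [C C0 AbC]] /boundedP[lB [D D0 BD]]; apply/boundedP.
split; first by move=> k x y /=; rewrite lB lA.
by exists (C * D); rewrite ?mulr_ge0//; exact: bnd_comp.
Qed.

Lemma bounded_id : bounded_operators (id : operator R).
Proof. by apply/boundedP; split => //; exists 1 => // x; rewrite mul1r. Qed.

Lemma op_sumE (I : Type) (r : seq I) (P : pred I) (F : I -> operator R) x :
  (\sum_(i <- r | P i) F i) x = \sum_(i <- r | P i) F i x.
Proof. by elim/big_rec2 : _ => // i y1 y2 _ <-. Qed.

Lemma op_cvgP (u : nat -> operator R) A :
  (forall n, bounded_operators (u n)) -> bounded_operators A ->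
  op_cvg u A <-> forall e : R, 0 < e -> \forall n \near \oo, bnd (u n - A) e.
Proof.
move=> bu bA; have lB n : linear (u n - A) by case: (boundedB (bu n) bA).
split=> [[_ uA] e e0|uA].
  have : \forall n \near \oo, (opnorm (u n - A)%R < e%:E)%E.
    apply: (uA [set t | (t < e%:E)%E]); exact: (lt_nbhsl (lte_tofin e0)).
  apply: filterS => n /ltW; by move/(bnd_opnorm (lB n) (ltW e0)).
split=> //; apply/fine_cvgP; split.
  apply: filterS (uA _ ltr01) => n /(bnd_opnorm (lB n) ler01) un.
  by rewrite ge0_fin_numE ?opnorm_ge0//; apply: le_lt_trans un _; rewrite ltry.
apply/cvgrPdist_le => e e0; apply: filterS (uA _ e0) => n.
move=> /(bnd_opnorm (lB n) (ltW e0)) un.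
rewrite sub0r normrN /= ger0_norm ?fine_ge0 ?opnorm_ge0//.
rewrite -lee_fin fineK// ge0_fin_numE ?opnorm_ge0//.
by apply: le_lt_trans un _; rewrite ltry.
Qed.

Lemma op_cvg_coord (u : nat -> operator R) A x l :
  (forall n, bounded_operators (u n)) -> op_cvg u A ->
  (fun n => u n x l) @ \oo --> A x l.
Proof.
move=> bu uA; have bA := uA.1; have {}uA := (op_cvgP bu bA).1 uA.
apply/cvgCP => e e0.
have d0 : 0 < e / (l2norm x + 1) by rewrite divr_gt0// ltr_wpDl// l2norm_ge0.
apply: filterS (uA _ d0) => n /(_ x) un; rewrite normcBC.
apply: le_lt_trans (coord_le ((u n - A) x) l) _; apply: le_lt_trans un _.
rewrite mulrAC -mulrA gtr_pMr// ltr_pdivrMr ?mul1r ?ltrDl//.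
by rewrite ltr_wpDl// l2norm_ge0.
Qed.

(** Boundedness carries A through the expansion of x, so a bounded operator is determined by its
    entries; [op_ext] and [has_mx_comp] rest on this. *)
Lemma op_lim A x (X : nat -> seq int) l : bounded_operators A ->
  (forall n, uniq (X n)) ->
  (forall k, x k != 0 -> \forall n \near \oo, k \in X n) ->
  (fun n => \sum_(k <- X n) x k * A (ell2_basis k) l : R[i]^o) @ \oo --> A x l.
Proof.
move=> /boundedP[lA [C C0 AbC]] uX xX; apply/cvgCP => e e0.
have C1 : 0 < C + 1 by rewrite ltr_wpDl.
have d0 : 0 < e / (C + 1) by rewrite divr_gt0.
apply: filterS (l2_approx uX xX d0) => n xn.
have -> : A x l - \sum_(k <- X n) x k * A (ell2_basis k) l =
    A (x - \sum_(k <- X n) x k *: ell2_basis k) l.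
  rewrite lin_B// ell2_valD ell2_valN lin_sum// ell2_val_sum.
  by congr (_ - _); apply: eq_bigr => k _; rewrite ell2_valZ.
apply: le_lt_trans (coord_le _ _) _; apply: le_lt_trans (AbC _) _.
apply: (@le_lt_trans _ _ (C * (e / (C + 1)))); first exact: ler_wpM2l.
by rewrite mulrCA gtr_pMr// ltr_pdivrMr// mul1r ltrDl.
Qed.

Arguments op_lim : clear implicits.

Lemma op_ext A B : bounded_operators A -> bounded_operators B ->
  (forall k l, A (ell2_basis k) l = B (ell2_basis k) l) -> A = B.
Proof.
move=> bA bB AB; apply/funext => x; apply: ell2_ext => l.
have xX k : x k != 0 -> \forall n \near \oo, k \in win n.
  by move=> _; exists (`|k|%N.+1) => // n /= kn; rewrite mem_win; lia.
apply: (@cvgC_unique _ _ _ _ _ _ _ (op_lim A x win l bA win_uniq xX)).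
under eq_fun do under eq_bigr do rewrite AB.
exact: (op_lim B x win l bB win_uniq xX).
Qed.

(** No representation theorem is invoked: the coordinates of B y are forced to be the conjugates of
    <A E_l, y>, and the point is that they are square summable, with the same constant as A. *)
Lemma adjoint_exists A : bounded_operators A ->
  exists2 B, is_adjoint A B & forall C, 0 <= C -> bnd A C -> bnd B C.
Proof.
move=> bA; have [lA [C C0 AbC]] := (boundedP A).1 bA.
pose c y l : R[i]^o := (dot (A (ell2_basis l)) y)^*%C.
have cD D : 0 <= D -> bnd A D -> forall y N,
    \sum_(l <- win N) normc (c y l) ^+ 2 <= (D * l2norm y) ^+ 2.
  move=> D0 AD y N.
  (* Testing A on the truncated candidate v gives S = <A v, y> with |v|^2 <= S, so S <= D sqrt(S)
     |y|; cancelling sqrt(S), when it is not 0, bounds S uniformly in N. *)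
  pose v : ell2 R := \sum_(l <- win N) c y l *: ell2_basis l.
  set S := (X in X <= _).
  have S0 : 0 <= S by apply: sumr_ge0 => l _; exact: sqr_ge0.
  have nv : l2norm v <= Num.sqrt S.
    apply: l2norm_le => [|N']; first exact: sqrtr_ge0.
    rewrite sqr_sqrtr//.
    have E l : normc (v l) ^+ 2 = if l \in win N then normc (c y l) ^+ 2 else 0.
      rewrite basis_comb_coord ?win_uniq//; case: ifPn => // _.
      by rewrite Normc.normc0 expr0n.
    under eq_bigr do rewrite E.
    rewrite -big_mkcond/= -big_filter.
    apply: (@ler_sum_subseq R _ _ xpredT (fun l => normc (c y l) ^+ 2)); rewrite ?filter_uniq ?win_uniq//.
    by move=> l; rewrite mem_filter => /andP[].
    by move=> l; exact: sqr_ge0.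
  have SE : S%:C%C = dot (A v) y.
    rewrite lin_sum// dot_suml rmorph_sum/=; apply: eq_bigr => l _.
    by rewrite sqr_normcE /c conjcK.
  have : S <= D * Num.sqrt S * l2norm y.
    rewrite -[leLHS]ger0_norm// -normc_real SE.
    apply: le_trans (dot_CS _ _) _; rewrite ler_wpM2r ?l2norm_ge0//.
    by apply: le_trans (AD _) _; rewrite ler_wpM2l.
  have [->|Sn0] := eqVneq S 0; first by rewrite sqr_ge0.
  have sS : 0 < Num.sqrt S by rewrite sqrtr_gt0 lt_def Sn0.
  rewrite -{1}(sqr_sqrtr S0) expr2 mulrAC ler_pM2r// => H.
  rewrite -(sqr_sqrtr S0) ler_sqr ?nnegrE ?sqrtr_ge0// mulr_ge0 ?l2norm_ge0//.
pose B y : ell2 R := mk_ell2 (c y).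
have BE y l : B y l = c y l by rewrite /B (mk_ell2E (cD C C0 AbC y)).
have Bb D : 0 <= D -> bnd A D -> bnd B D.
  move=> D0 AD y; apply: l2norm_le => [|N]; first by rewrite mulr_ge0 ?l2norm_ge0.
  by under eq_bigr do rewrite BE; exact: cD.
exists B => //; split=> [|x y].
  apply/boundedP; split; last by exists C => //; exact: Bb.
  move=> k x y; apply: ell2_ext => l; rewrite ell2_valD ell2_valZ !BE /c.
  by rewrite -!dotC dot_linearl.
apply: (@cvgC_unique _ _ \oo _ (fun n => dot (A (\sum_(l <- win n) x l *: ell2_basis l)) y)).
  apply/cvgCP => e e0.
  have K0 : 0 < C * l2norm y + 1 by rewrite ltr_wpDl// mulr_ge0 ?l2norm_ge0.
  have d0 : 0 < e / (C * l2norm y + 1) by rewrite divr_gt0.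
  apply: filterS (l2_approx_win x d0) => n xn; rewrite -dotBl -lin_B//.
  apply: le_lt_trans (dot_CS _ _) _.
  apply: (@le_lt_trans _ _ (C * (e / (C * l2norm y + 1)) * l2norm y)).
    rewrite ler_wpM2r ?l2norm_ge0//; apply: le_trans (AbC _) _.
    exact: ler_wpM2l.
  rewrite mulrAC mulrCA gtr_pMr// ltr_pdivrMr// mul1r ltrDl//.
rewrite (_ : (fun n => _) = (fun N => \sum_(l <- win N) x l * (B y l)^*%C)).
  exact: dot_cvg.
apply/funext => N; rewrite lin_sum// dot_suml.
by apply: eq_bigr => l _; rewrite BE /c conjcK.
Qed.

Lemma adj_spec A : bounded_operators A -> is_adjoint A (adj A).
Proof. by move=> /adjoint_exists[B AB _]; rewrite /adj; case: xgetP => [//|/(_ B)]. Qed.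

Lemma adj_bounded A : bounded_operators A -> bounded_operators (adj A).
Proof. by move=> /adj_spec[]. Qed.

Lemma is_adjoint_basis A B k l : is_adjoint A B ->
  B (ell2_basis k) l = (A (ell2_basis l) k)^*%C.
Proof. by move=> [_ AB]; rewrite -dot_basisr dotC -AB dot_basisr. Qed.

Lemma adj_basis A k l : bounded_operators A ->
  adj A (ell2_basis k) l = (A (ell2_basis l) k)^*%C.
Proof. by move=> /adj_spec; exact: is_adjoint_basis. Qed.

Lemma adj_bnd A (C : R) : bounded_operators A -> 0 <= C -> bnd A C -> bnd (adj A) C.
Proof.
move=> bA C0 AbC; have [B AB] := adjoint_exists bA; move=> /(_ C C0 AbC).
suff -> : B = adj A by [].
apply: op_ext (adj_bounded bA) _; first by case: AB.
by move=> k l; rewrite adj_basis// (is_adjoint_basis k l AB).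
Qed.

Lemma l2norm_sum (I : Type) (r : seq I) (F : I -> ell2 R) :
  l2norm (\sum_(i <- r) F i) <= \sum_(i <- r) l2norm (F i).
Proof.
elim/big_rec2 : _ => [|i y1 y2 _ IH]; first by rewrite l2norm0.
by apply: le_trans (l2norm_triangle _ _) _; rewrite lerD2l.
Qed.

Lemma cvgC_norm (u : nat -> R[i]^o) (a : R[i]^o) :
  u @ \oo --> a -> (fun n => normc (u n)) @ \oo --> normc a.
Proof.
move=> /cvgCP ua; apply/cvgrPdist_lt => e e0; apply: filterS (ua _ e0) => n.
have H (z w : R[i]) : normc z - normc w <= normc (z - w).
  by rewrite lerBlDr (le_trans _ (normcD _ _))// subrK.
by apply: le_lt_trans; rewrite ler_norml H andbT lerNl opprB normcBC H.
Qed.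

(** The instance of completeness of B(H) that is required. The limit is taken entry by entry; the
    tail estimate holds on each finite window for partial sums, passes to the limit there, and then
    holds in norm. *)
Lemma op_series (u : nat -> operator R) (M : R) :
  (forall n, bounded_operators (u n)) -> (forall n, bnd (u n) (M * tele n)) ->
  exists2 A, op_cvg (fun N => \sum_(k < N) u k) A & bnd A M.
Proof.
move=> bu uM.
have M0 : 0 <= M.
  have b1 : 0 < l2norm (ell2_basis 0 : ell2 R).
    apply: lt_le_trans (coord_le _ 0); by rewrite basisE eqxx Normc.normc1.
  have := le_trans (l2norm_ge0 _) (uM 0%N (ell2_basis 0)).
  by rewrite (pmulr_lge0 _ b1) (pmulr_lge0 _ (tele_gt0 0)).
have cu x l n : normc (u n x l) <= M * l2norm x * tele n.
  by apply: le_trans (coord_le _ _) _; rewrite mulrAC uM.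
have [a ua] : {a : ell2 R -> int -> R[i]^o | forall x l,
    (fun N => \sum_(k < N) u k x l : R[i]^o) @ \oo --> a x l}.
  apply: cid; exists (fun x l => xget 0 [set a : R[i]^o |
     (fun N => \sum_(k < N) u k x l : R[i]^o) @ \oo --> a]) => x l.
  case: xgetP => [//|H].
  have [b ub _] := cseries (cu x l).
  by exfalso; exact: (H b).
have aN x n N : \sum_(l <- win N) normc (a x l - \sum_(k < n) u k x l) ^+ 2 <=
    (M / n.+1%:R * l2norm x) ^+ 2.
  have H m : (n <= m)%N ->
     \sum_(l <- win N) normc (\sum_(k < m) u k x l - \sum_(k < n) u k x l) ^+ 2 <=
     (M / n.+1%:R * l2norm x) ^+ 2.
    move=> nm; pose w : ell2 R := \sum_(n <= k < m) u k x.
    have E l : \sum_(k < m) u k x l - \sum_(k < n) u k x l = w l.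
      rewrite ell2_val_sum -!(big_mkord xpredT (fun k => u k x l)).
      by rewrite (big_cat_nat _ nm)//= addrAC subrr add0r.
    under eq_bigr do rewrite E.
    apply: le_trans (l2_ge_seq _ (win_uniq N)) _.
    rewrite ler_sqr ?nnegrE ?l2norm_ge0 ?mulr_ge0 ?divr_ge0 ?l2norm_ge0//.
    apply: le_trans (l2norm_sum _ _) _.
    apply: (@le_trans _ _ (\sum_(n <= k < m) (M * l2norm x) * tele k)).
      by apply: ler_sum => k _; rewrite mulrAC; exact: uM.
    rewrite -mulr_sumr [leRHS]mulrAC; apply: ler_wpM2l; last exact: sum_tele.
    by rewrite mulr_ge0 ?l2norm_ge0.
  pose g l m := normc (\sum_(k < m) u k x l - \sum_(k < n) u k x l).
  have gN : (fun m => \sum_(l <- win N) g l m ^+ 2) @ \oo -->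
      \sum_(l <- win N) normc (a x l - \sum_(k < n) u k x l) ^+ 2.
    apply: cvg_bigsum => l; apply: (@cvgM _ _ _ _ (g l) (g l));
    by apply: cvgC_norm; apply: cvgB; [exact: ua|exact: cvg_cst].
  apply: (cvgr_to_le gN).
  near=> m; apply: H; near: m; exact: nbhs_infty_ge.
pose A x : ell2 R := mk_ell2 (a x).
have AE x l : A x l = a x l.
  apply: (@mk_ell2E _ _ ((M / 1%:R * l2norm x) ^+ 2)) => N.
  by have := aN x 0%N N; under eq_bigr do rewrite big_ord0 subr0.
have lA : linear A.
  move=> k x y; apply: ell2_ext => l; rewrite ell2_valD ell2_valZ !AE.
  apply: (@cvgC_unique _ _ _ _ _ _ _ (ua (k *: x + y) l)).
  under eq_fun do (under eq_bigr do rewrite (bounded_linear (bu _)) ell2_valD ell2_valZ;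
    rewrite big_split/= -mulr_sumr).
  by apply: cvgD; [apply: cvgMr|]; exact: ua.
have bu' n : bounded_operators (\sum_(k < n) u k) by exact: bounded_sum.
have dist n : bnd (\sum_(k < n) u k - A) (M / n.+1%:R).
  move=> x; apply: l2norm_le => [|N].
    by rewrite mulr_ge0 ?divr_ge0 ?l2norm_ge0.
  have E l : (\sum_(k < n) u k - A) x l = \sum_(k < n) u k x l - a x l.
    rewrite [LHS]/((\sum_(k < n) u k) x l - A x l).
    by rewrite op_sumE ell2_val_sum AE.
  by under eq_bigr do rewrite E normcBC; exact: aN.
have AM : bnd A M.
  move=> x; have := dist 0%N x; rewrite big_ord0 divr1.
  by rewrite sub0r -[l2norm (A x)]l2normN.
have bA : bounded_operators A by apply/boundedP; split => //; exists M.
exists A => //; apply/op_cvgP => // e e0; near=> n.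
apply: bnd_le (dist n); rewrite ler_pdivrMr// mulrC -ler_pdivrMr//.
near: n; exists (Num.bound (M / e)) => // n /= Mn.
have := archi_boundP (divr_ge0 M0 (ltW e0)) => /ltW/le_trans; apply.
by rewrite ler_nat (leq_trans Mn).
Unshelve. all: by end_near. Qed.

End operator_theory.

(** * Smooth periodic functions and Fourier series *)

Section smooth_functions.
Context {R : realType}.
Implicit Types (f g u : R -> R) (t : R).

Lemma isdD f g t (a b : R) : is_derive t 1 f a -> is_derive t 1 g b ->
  is_derive t 1 (fun t => f t + g t) (a + b).
Proof. exact: is_deriveD. Qed.

Lemma isdB f g t (a b : R) : is_derive t 1 f a -> is_derive t 1 g b ->
  is_derive t 1 (fun t => f t - g t) (a - b).
Proof. exact: is_deriveB. Qed.

Lemma isdM f g t (a b : R) : is_derive t 1 f a -> is_derive t 1 g b ->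
  is_derive t 1 (fun t => f t * g t) (a * g t + f t * b).
Proof.
move=> fa gb; have H := is_deriveM fa gb.
by apply: is_derive_eq H _; rewrite addrC [g t *: a]mulrC.
Qed.

Lemma isdC (c : R) t : is_derive t 1 (fun _ : R => c) 0.
Proof. exact: is_derive_cst. Qed.

Lemma isd_derivable f t (a : R) : is_derive t 1 f a -> derivable f t 1.
Proof. by case. Qed.

Lemma isd_val f t (a : R) : is_derive t 1 f a -> f^`()%classic t = a.
Proof. by move=> [_ fa]; rewrite derive1E. Qed.

Lemma derivable_isd f t : derivable f t 1 -> is_derive t 1 f (f^`()%classic t).
Proof. by move=> df; split => //; rewrite derive1E. Qed.

Lemma isd_fun f f' : (forall t, is_derive t 1 f (f' t)) -> f^`()%classic = f'.
Proof. by move=> ff'; apply/funext => t; exact: isd_val. Qed.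

Lemma derivable_continuous f : (forall t, derivable f t 1) -> continuous f.
Proof. by move=> df t; apply/differentiable_continuous/derivable1_diffP. Qed.

(** Smoothness cut at a finite order (n + 1 derivatives exist), so that the product rule can be
    iterated by induction: (fg)' involves f and f' alike, hence [ntimesW]. *)
Definition ntimes (n : nat) f := forall k, (k <= n)%N -> forall t, derivable (derive1n k f) t 1.

Lemma ntimesS n f : ntimes n.+1 f <->
  (forall t, derivable f t 1) /\ ntimes n (f^`()%classic).
Proof.
split=> [nf|[df nf] [|k] kn t].
- split=> [t|k kn t]; first exact: (nf 0%N).
  by have := nf k.+1 kn t; rewrite /derive1n iterSr.
- exact: df.
- by rewrite /derive1n iterSr; exact: nf.
Qed.

Lemma ntimes_derivable n f : ntimes n f -> forall t, derivable f t 1.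
Proof. by move=> nf t; exact: (nf 0%N). Qed.

Lemma ntimes0 f : (forall t, derivable f t 1) -> ntimes 0 f.
Proof. by move=> df k; rewrite leqn0 => /eqP -> t; exact: df. Qed.

Lemma ntimesW n f : ntimes n.+1 f -> ntimes n f.
Proof. by move=> nf k kn; apply: nf; exact: leqW. Qed.

Lemma ntimesD n f g : ntimes n f -> ntimes n g -> ntimes n (fun t => f t + g t).
Proof.
elim: n f g => [|n IH] f g nf ng.
  apply: ntimes0 => t; apply: isd_derivable; apply: isdD; apply: derivable_isd.
    exact: ntimes_derivable nf t.
  exact: ntimes_derivable ng t.
have df := ntimes_derivable nf; have dg := ntimes_derivable ng.
have H t : is_derive t 1 (fun t => f t + g t) (f^`()%classic t + g^`()%classic t).
  by apply: isdD; exact: derivable_isd.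
move/ntimesS : nf => [_ nf]; move/ntimesS : ng => [_ ng].
apply/ntimesS; split; first by move=> t; exact: isd_derivable (H t).
by rewrite (isd_fun H); exact: IH.
Qed.

Lemma ntimesC n (c : R) : ntimes n (fun _ => c).
Proof.
elim: n c => [|n IH] c; first by apply: ntimes0 => t; exact: isd_derivable (isdC c t).
apply/ntimesS; split; first by move=> t; exact: isd_derivable (isdC c t).
by rewrite (isd_fun (isdC c)).
Qed.

Lemma ntimesM n f g : ntimes n f -> ntimes n g -> ntimes n (fun t => f t * g t).
Proof.
elim: n f g => [|n IH] f g nf ng.
  apply: ntimes0 => t; apply: isd_derivable; apply: isdM; apply: derivable_isd.
    exact: ntimes_derivable nf t.
  exact: ntimes_derivable ng t.
have df := ntimes_derivable nf; have dg := ntimes_derivable ng.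
have H t : is_derive t 1 (fun t => f t * g t)
    (f^`()%classic t * g t + f t * g^`()%classic t).
  by apply: isdM; exact: derivable_isd.
apply/ntimesS; split; first by move=> t; exact: isd_derivable (H t).
have nf' := ntimesW nf; have ng' := ntimesW ng.
move/ntimesS : nf => [_ nf]; move/ntimesS : ng => [_ ng].
by rewrite (isd_fun H); apply: ntimesD; exact: IH.
Qed.

Definition rsmooth f := forall n t, derivable (derive1n n f) t 1.

Lemma rsmoothP f : rsmooth f <-> forall n, ntimes n f.
Proof. by split=> [sf n k _ t|nf n t]; [exact: sf|exact: (nf n)]. Qed.

Lemma rsmoothD f g : rsmooth f -> rsmooth g -> rsmooth (fun t => f t + g t).
Proof. by move=> /rsmoothP sf /rsmoothP sg; apply/rsmoothP => n; exact: ntimesD. Qed.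

Lemma rsmoothM f g : rsmooth f -> rsmooth g -> rsmooth (fun t => f t * g t).
Proof. by move=> /rsmoothP sf /rsmoothP sg; apply/rsmoothP => n; exact: ntimesM. Qed.

Lemma rsmoothC (c : R) : rsmooth (fun _ => c).
Proof. by apply/rsmoothP => n; exact: ntimesC. Qed.

Lemma rsmoothZ (c : R) f : rsmooth f -> rsmooth (fun t => c * f t).
Proof. by apply: rsmoothM; exact: rsmoothC. Qed.

Lemma rsmoothN f : rsmooth f -> rsmooth (fun t => - f t).
Proof.
move=> sf; rewrite (_ : (fun t => _) = (fun t => -1 * f t)); first exact: rsmoothZ.
by apply/funext => t; rewrite mulN1r.
Qed.

Lemma rsmooth_derivable f : rsmooth f -> forall t, derivable f t 1.
Proof. by move=> sf; exact: (sf 0%N). Qed.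

Lemma rsmooth_derive f : rsmooth f -> rsmooth (f^`()%classic).
Proof. by move=> sf n t; have := sf n.+1 t; rewrite /derive1n iterSr. Qed.

Lemma rsmooth_continuous f : rsmooth f -> continuous f.
Proof. by move=> /rsmooth_derivable; exact: derivable_continuous. Qed.

Definition rperiodic f := forall t, f (t + 1) = f t.

Lemma rperiodic_derive f : rperiodic f -> rperiodic (f^`()%classic).
Proof.
move=> pf t; rewrite /derive1.
suff -> : (fun h : R => h^-1 *: (f (h + (t + 1)) - f (t + 1))) =
    (fun h => h^-1 *: (f (h + t) - f t)) by [].
by apply/funext => h; rewrite addrA !pf.
Qed.

Lemma periodic_int (T : Type) (F : R -> T) : (forall t, F (t + 1) = F t) ->
  forall (k : int) t, F (t + k%:~R) = F t.
Proof.
move=> pF; have H (n : nat) t : F (t + n%:R) = F t.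
  elim: n t => [|n IH] t; first by rewrite addr0.
  by rewrite -natr1 addrA pF.
case=> n t; first exact: H.
by rewrite NegzE mulrNz -(H n.+1 (t - _)) subrK.
Qed.

Definition cs (m : int) t : R := cos (2 * pi * m%:~R * t).
Definition sn (m : int) t : R := sin (2 * pi * m%:~R * t).

Lemma isd_lin (c : R) t : is_derive t 1 (fun t => c * t) c.
Proof.
have := isdM (isdC c t) (@is_derive_id R R t 1).
by rewrite mul0r add0r mulr1.
Qed.

Lemma isd_coslin (c t : R) : is_derive t 1 (fun t => cos (c * t)) (- (c * sin (c * t))).
Proof.
have := @is_derive1_comp R cos (fun t => c * t) t _ _ (is_derive_cos (c * t)) (isd_lin c t).
by move=> H; apply: is_derive_eq H _; rewrite mulNr mulrC.
Qed.

Lemma isd_sinlin (c t : R) : is_derive t 1 (fun t => sin (c * t)) (c * cos (c * t)).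
Proof.
have := @is_derive1_comp R sin (fun t => c * t) t _ _ (is_derive_sin (c * t)) (isd_lin c t).
by move=> H; apply: is_derive_eq H _; rewrite mulrC.
Qed.

(** Up to constants each function is the derivative of the other, so one induction carries both. *)
Lemma rsmooth_trig (c : R) :
  rsmooth (fun t => cos (c * t)) /\ rsmooth (fun t => sin (c * t)).
Proof.
have dc t := isd_derivable (isd_coslin c t).
have ds t := isd_derivable (isd_sinlin c t).
have ec := isd_fun (isd_coslin c).
have es := isd_fun (isd_sinlin c).
suff H n : ntimes n (fun t => cos (c * t)) /\ ntimes n (fun t => sin (c * t)).
  by split; apply/rsmoothP => n; case: (H n).
elim: n => [|n [IHc IHs]]; first by split; exact: ntimes0.
split; apply/ntimesS; split; [exact: dc| |exact: ds|].
- rewrite ec (_ : (fun t => _) = (fun t => (- c) * sin (c * t))).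
    exact: (ntimesM (@ntimesC n (- c)) IHs).
  by apply/funext => t; rewrite mulNr.
- by rewrite es; exact: (ntimesM (@ntimesC n c) IHc).
Qed.

Lemma cs_cont m : continuous (cs m).
Proof. exact: rsmooth_continuous (rsmooth_trig _).1. Qed.

Lemma sn_cont m : continuous (sn m).
Proof. exact: rsmooth_continuous (rsmooth_trig _).2. Qed.

Lemma cs_sn_2pi (m : int) : cos (2 * pi * m%:~R) = 1 :> R /\ sin (2 * pi * m%:~R) = 0 :> R.
Proof.
have H (n : nat) : cos (2 * pi * n%:R) = 1 :> R /\ sin (2 * pi * n%:R) = 0 :> R.
  rewrite (_ : 2 * pi * n%:R = 0 + pi *+ 2 *+ n :> R); last first.
    by rewrite add0r mulr_natl mulr_natr.
  by rewrite (periodicn (@cosD2pi R)) (periodicn (@sinD2pi R)) cos0 sin0.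
case: m => n; first exact: H.
by rewrite NegzE mulrNz mulrN cosN sinN; have [-> ->] := H n.+1; rewrite oppr0.
Qed.

End smooth_functions.

(** * Integration over a period and decay of real Fourier coefficients *)

Section integral01.
Context {R : realType}.
Implicit Types (f g u : R -> R).

Definition I01 f : R := \int[lebesgue_measure]_(t in `[0, 1]) f t.

Lemma int01 f : continuous f ->
  (@lebesgue_measure R).-integrable `[0%R, 1%R] (EFin \o f).
Proof.
move=> cf; apply: continuous_compact_integrable; first exact: segment_compact.
exact: continuous_subspaceT.
Qed.

Lemma m01 : measurable (`[0%R, 1%R]%classic : set R).
Proof. exact: measurable_itv. Qed.

Lemma I01D f g : continuous f -> continuous g -> I01 (fun t => f t + g t) = I01 f + I01 g.
Proof. by move=> cf cg; apply: RintegralD; [exact: m01|exact: int01|exact: int01]. Qed.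

Lemma I01Z (k : R) f : continuous f -> I01 (fun t => k * f t) = k * I01 f.
Proof. by move=> cf; apply: RintegralZl; [exact: m01|exact: int01]. Qed.

Lemma I01N f : continuous f -> I01 (fun t => - f t) = - I01 f.
Proof.
move=> cf; rewrite -mulN1r -I01Z//; congr I01; apply/funext => t.
by rewrite mulN1r.
Qed.

Lemma contD f g : continuous f -> continuous g -> continuous (fun t => f t + g t).
Proof. by move=> cf cg t; apply: cvgD; [exact: cf|exact: cg]. Qed.

Lemma contM f g : continuous f -> continuous g -> continuous (fun t => f t * g t).
Proof. by move=> cf cg t; apply: cvgM; [exact: cf|exact: cg]. Qed.

Lemma contN f : continuous f -> continuous (fun t => - f t).
Proof. by move=> cf t; apply: cvgN; exact: cf. Qed.

Lemma contC (c : R) : continuous (fun _ : R => c).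
Proof. by move=> t; exact: cvg_cst. Qed.

Lemma I01B f g : continuous f -> continuous g -> I01 (fun t => f t - g t) = I01 f - I01 g.
Proof. by move=> cf cg; rewrite I01D ?I01N//; exact: contN. Qed.

Lemma I01_ge0 f : (forall t, 0 <= f t) -> 0 <= I01 f.
Proof. by move=> f0; apply: Rintegral_ge0 => t _. Qed.

Lemma I01C (c : R) : I01 (fun _ => c) = c.
Proof.
rewrite /I01 Rintegral_cst; last exact: m01.
rewrite (_ : fine _ = 1) ?mulr1//.
have := @lebesgue_measure_itv R `[0, 1].
by rewrite /= lte_fin ltr01 oppr0 adde0 => /(congr1 fine).
Qed.

Lemma I01_bound f (M : R) : continuous f -> (forall t, `|f t| <= M) -> `|I01 f| <= M.
Proof.
move=> cf fM; have mf : continuous (fun t => `|f t|).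
  by move=> t; apply: cvg_norm; exact: cf.
rewrite /I01; apply: le_trans (@le_normr_Rintegral _ _ _ (@lebesgue_measure R) _ _ m01 (int01 cf)) _.
rewrite -[leRHS]I01C; apply: le_Rintegral.
- exact: m01.
- exact: int01.
- by apply: int01; exact: contC.
- by move=> t _.
Qed.

Lemma I01_FTC (F f : R -> R) : (forall t : R, is_derive t 1 F (f t)) -> continuous f ->
  I01 f = F 1 - F 0.
Proof.
move=> Ff cf; rewrite /I01 /Rintegral (@continuous_FTC2 _ f F 0 1)//.
- exact: continuous_subspaceT.
- have cF : continuous F.
    by apply: derivable_continuous => t; exact: isd_derivable (Ff t).
  split.
  + by move=> t _; exact: isd_derivable (Ff t).
  + by apply: cvg_at_right_filter; exact: cF.
  + by apply: cvg_at_left_filter; exact: cF.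
- by move=> t _; exact: isd_val.
Qed.

(** Subtracting the integer part brings t into [0, 1], where the maximum is attained. *)
Lemma rperiodic_bounded u : continuous u -> rperiodic u ->
  exists M, forall t, `|u t| <= M.
Proof.
move=> cu pu; have cnu : continuous (fun t => `|u t|).
  by move=> t; apply: cvg_norm; exact: cu.
have [c _ cM] := @EVT_max R (fun t => `|u t|) 0 1 ler01 (@continuous_subspaceT _ _ _ _ cnu).
exists `|u c| => t; rewrite -(periodic_int pu (- Num.floor t)) rmorphN/=.
apply: cM; rewrite in_itv/= subr_ge0 floor_le_tmp//= lerBlDr addrC ltW//.
by rewrite -[1]/(1%:~R) -intrD floorD1_gt.
Qed.

Definition cos_coef u m := I01 (fun t => u t * cs m t).
Definition sin_coef u m := I01 (fun t => u t * sn m t).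

(** Integration by parts, as the fundamental theorem for the product of u and [cs m]; the boundary
    terms cancel because both factors have period 1. *)
Lemma cos_coef_derive u m : rsmooth u -> rperiodic u ->
  cos_coef (u^`()%classic) m = 2 * pi * m%:~R * sin_coef u m.
Proof.
move=> su pu; have cu := rsmooth_continuous su.
have cu' := rsmooth_continuous (rsmooth_derive su).
apply/eqP; rewrite -subr_eq0 -I01Z; last by apply: contM => //; exact: sn_cont.
have cc : continuous (fun t => u^`()%classic t * cs m t) by apply: contM => //; exact: cs_cont.
have cS : continuous (fun t => 2 * pi * m%:~R * (u t * sn m t)).
  by apply: contM; [exact: contC|apply: contM => //; exact: sn_cont].
have du : forall t, derivable u t 1 := rsmooth_derivable su.
have D (t : R) : is_derive t 1 (fun t => u t * cs m t)
    (u^`()%classic t * cs m t - 2 * pi * m%:~R * (u t * sn m t)).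
  have H := isdM (derivable_isd (du t)) (isd_coslin (2 * pi * m%:~R) t).
  by apply: is_derive_eq H _; rewrite mulrN /sn /cs; congr (_ - _); rewrite mulrCA.
rewrite -I01B// (I01_FTC D); last by apply: contD => //; exact: contN.
by rewrite -{1}[1]add0r pu /cs !mulr0 mulr1 (cs_sn_2pi m).1 cos0 subrr.
Qed.

Lemma sin_coef_derive u m : rsmooth u -> rperiodic u ->
  sin_coef (u^`()%classic) m = - (2 * pi * m%:~R * cos_coef u m).
Proof.
move=> su pu; have cu := rsmooth_continuous su.
have cu' := rsmooth_continuous (rsmooth_derive su).
apply/eqP; rewrite -addr_eq0 -I01Z; last by apply: contM => //; exact: cs_cont.
have cc : continuous (fun t => u^`()%classic t * sn m t) by apply: contM => //; exact: sn_cont.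
have cS : continuous (fun t => 2 * pi * m%:~R * (u t * cs m t)).
  by apply: contM; [exact: contC|apply: contM => //; exact: cs_cont].
have du : forall t, derivable u t 1 := rsmooth_derivable su.
have D (t : R) : is_derive t 1 (fun t => u t * sn m t)
    (u^`()%classic t * sn m t + 2 * pi * m%:~R * (u t * cs m t)).
  have H := isdM (derivable_isd (du t)) (isd_sinlin (2 * pi * m%:~R) t).
  by apply: is_derive_eq H _; rewrite /sn /cs; congr (_ + _); rewrite mulrCA.
rewrite -I01D// (I01_FTC D); last exact: contD.
by rewrite /sn !mulr0 mulr1 (cs_sn_2pi m).2 sin0 !mulr0 subrr.
Qed.

(** Each integration by parts trades a factor 2 pi m, at least |m| in size, for a derivative of u,
    and the last derivative is bounded. It also swaps cosine and sine coefficients, so both are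
    treated together. *)
Lemma trig_coef_decay k u : rsmooth u -> rperiodic u -> exists M, forall m : int,
  `|m%:~R| ^+ k * `|cos_coef u m| <= M /\ `|m%:~R| ^+ k * `|sin_coef u m| <= M.
Proof.
elim: k u => [|k IH] u su pu.
  have cu := rsmooth_continuous su.
  have [M uM] := rperiodic_bounded cu pu.
  have H (v : R -> R) : continuous v -> (forall t, `|v t| <= 1) ->
      `|I01 (fun t => u t * v t)| <= M.
    move=> cv v1; apply: I01_bound; first exact: contM.
    move=> t; rewrite normrM; apply: le_trans (uM t).
    by rewrite ler_piMr.
  exists M => m; rewrite expr0 !mul1r; split; apply: H.
  - exact: cs_cont.
  - by move=> t; exact: cos_max.
  - exact: sn_cont.
  - by move=> t; exact: sin_max.
have [M uM] := IH _ (rsmooth_derive su) (rperiodic_derive pu).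
have pi2 : 1 <= `|2 * pi : R|.
  rewrite ger0_norm ?mulr_ge0 ?pi_ge0//; have := @pi_ge2 R; lra.
have H (m : int) (x : R) : `|m%:~R| ^+ k.+1 * `|x| <=
    `|m%:~R| ^+ k * `|2 * pi * m%:~R * x|.
  rewrite exprSr -mulrA ler_wpM2l ?exprn_ge0// [leRHS]normrM [X in _ <= X * _]normrM.
  by rewrite ler_wpM2r// ler_peMl.
exists M => m; split.
- by apply: le_trans (H _ _) _; rewrite -[X in _ * X]normrN -sin_coef_derive//; case: (uM m).
- by apply: le_trans (H _ _) _; rewrite -cos_coef_derive//; case: (uM m).
Qed.

End integral01.

(** * Complex Fourier coefficients and the Bessel inequality *)

Section complex_integral.
Context {R : realType}.
Implicit Types (f g : R -> R[i]) (t : R) (m n : int).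

Local Notation Re := complex.Re.
Local Notation Im := complex.Im.

Definition ccont f := continuous (fun t => Re (f t)) /\ continuous (fun t => Im (f t)).

Lemma cReM (z w : R[i]) : Re (z * w) = Re z * Re w - Im z * Im w.
Proof. by case: z w => a b [c d]. Qed.
Lemma cImM (z w : R[i]) : Im (z * w) = Re z * Im w + Im z * Re w.
Proof. by case: z w => a b [c d] /=; rewrite addrC. Qed.
Lemma cReD (z w : R[i]) : Re (z + w) = Re z + Re w.
Proof. by case: z w => a b [c d]. Qed.
Lemma cImD (z w : R[i]) : Im (z + w) = Im z + Im w.
Proof. by case: z w => a b [c d]. Qed.
Lemma cReJ (z : R[i]) : Re (z^*)%C = Re z. Proof. by case: z. Qed.
Lemma cImJ (z : R[i]) : Im (z^*)%C = - Im z. Proof. by case: z. Qed.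

Lemma conjCM (z w : R[i]) : ((z * w)^*)%C = (z^*)%C * (w^*)%C.
Proof. exact: rmorphM. Qed.
Lemma conjCB (z w : R[i]) : ((z - w)^*)%C = (z^*)%C - (w^*)%C.
Proof. exact: rmorphB. Qed.

Lemma complexE (z : R[i]) : z = (Re z +i* Im z)%C. Proof. by case: z. Qed.

Lemma normc_Re (z : R[i]) : `|Re z| <= normc z.
Proof. by case: z => x y /=; rewrite -sqrtr_sqr; apply: ler_wsqrtr; rewrite lerDl sqr_ge0. Qed.
Lemma normc_Im (z : R[i]) : `|Im z| <= normc z.
Proof. by case: z => x y /=; rewrite -sqrtr_sqr; apply: ler_wsqrtr; rewrite lerDr sqr_ge0. Qed.

Lemma normc_leReIm (z : R[i]) : normc z <= `|Re z| + `|Im z|.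
Proof.
case: z => x y /=; rewrite -ler_sqr ?nnegrE ?sqrtr_ge0 ?addr_ge0//.
rewrite sqr_sqrtr ?addr_ge0 ?sqr_ge0// sqrrD !real_normK ?num_real//.
by rewrite addrAC lerDl mulrn_wge0// mulr_ge0.
Qed.

Lemma ccontD f g : ccont f -> ccont g -> ccont (fun t => f t + g t).
Proof.
move=> [fr fi] [gr gi]; split.
  by under eq_fun do rewrite cReD; exact: contD.
by under eq_fun do rewrite cImD; exact: contD.
Qed.

Lemma ccontM f g : ccont f -> ccont g -> ccont (fun t => f t * g t).
Proof.
move=> [fr fi] [gr gi]; split.
  under eq_fun do rewrite cReM; apply: contD; first exact: contM.
  by apply: contN; exact: contM.
by under eq_fun do rewrite cImM; apply: contD; exact: contM.
Qed.

Lemma ccontC (c : R[i]) : ccont (fun _ => c).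
Proof. by split; exact: contC. Qed.

Lemma ccontJ f : ccont f -> ccont (fun t => (f t)^*%C).
Proof.
move=> [fr fi]; split; first by under eq_fun do rewrite cReJ.
by under eq_fun do rewrite cImJ; exact: contN.
Qed.

Lemma ccontN f : ccont f -> ccont (fun t => - f t).
Proof.
move=> cf; rewrite (_ : (fun t => _) = (fun t => -1 * f t)).
  by apply: ccontM => //; exact: ccontC.
by apply/funext => t; rewrite mulN1r.
Qed.

Lemma ccontB f g : ccont f -> ccont g -> ccont (fun t => f t - g t).
Proof. by move=> cf cg; apply: ccontD => //; exact: ccontN. Qed.

Lemma cint01E f : cint01 f = (I01 (fun t => Re (f t)) +i* I01 (fun t => Im (f t)))%C.
Proof. by []. Qed.

Lemma cintD f g : ccont f -> ccont g ->
  cint01 (fun t => f t + g t) = cint01 f + cint01 g.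
Proof.
move=> [fr fi] [gr gi]; rewrite !cint01E.
under [X in (I01 X +i* _)%C]eq_fun do rewrite cReD.
under [X in (_ +i* I01 X)%C]eq_fun do rewrite cImD.
by rewrite !I01D.
Qed.

Lemma cintZ (k : R[i]) f : ccont f -> cint01 (fun t => k * f t) = k * cint01 f.
Proof.
move=> [fr fi]; rewrite !cint01E.
under [X in (I01 X +i* _)%C]eq_fun do rewrite cReM.
under [X in (_ +i* I01 X)%C]eq_fun do rewrite cImM.
have cM (a : R) h : continuous h -> continuous (fun t => a * h t).
  by move=> ch; apply: contM => //; exact: contC.
rewrite I01B ?I01D; try exact: cM.
rewrite !I01Z//; case: k => a b /=; simpc.
by congr (_ +i* _)%C; rewrite addrC.
Qed.

Lemma cintN f : ccont f -> cint01 (fun t => - f t) = - cint01 f.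
Proof.
by move=> cf; under eq_fun do rewrite -mulN1r; rewrite cintZ// mulN1r.
Qed.

Lemma cintB f g : ccont f -> ccont g ->
  cint01 (fun t => f t - g t) = cint01 f - cint01 g.
Proof. by move=> cf cg; rewrite cintD ?cintN//; exact: ccontN. Qed.

Lemma cintJ f : ccont f -> cint01 (fun t => (f t)^*%C) = (cint01 f)^*%C.
Proof.
move=> [fr fi]; rewrite !cint01E.
under [X in (I01 X +i* _)%C]eq_fun do rewrite cReJ.
under [X in (_ +i* I01 X)%C]eq_fun do rewrite cImJ.
by rewrite I01N.
Qed.

Lemma cint_bound f (M : R) : ccont f -> (forall t, normc (f t) <= M) ->
  normc (cint01 f) <= 2 * M.
Proof.
move=> [fr fi] fM; apply: le_trans (normc_leReIm _) _.
rewrite mulr_natl mulr2n cint01E/=; apply: lerD; apply: I01_bound => // t.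
  exact: le_trans (normc_Re _) (fM t).
exact: le_trans (normc_Im _) (fM t).
Qed.

Lemma cint_sqr_ge0 f : 0 <= Re (cint01 (fun t => f t * (f t)^*%C)).
Proof. by rewrite cint01E/=; apply: I01_ge0 => t; rewrite -sqr_normcE/= sqr_ge0. Qed.

(** The character exp(2 pi i m t). *)
Definition ce m t : R[i] := (cs m t +i* sn m t)%C.

Lemma ce_cont m : ccont (ce m).
Proof. by split; [exact: cs_cont|exact: sn_cont]. Qed.

Lemma ce0 t : ce 0 t = 1.
Proof. by rewrite /ce /cs /sn mulr0 mul0r cos0 sin0. Qed.

Lemma ceD m n t : ce (m + n) t = ce m t * ce n t.
Proof.
rewrite /ce /cs /sn rmorphD/= mulrDr mulrDl cosD sinD; simpc.
by congr (_ +i* _)%C; rewrite addrC.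
Qed.

Lemma ceN m t : ce (- m) t = (ce m t)^*%C.
Proof. by rewrite /ce /cs /sn rmorphN/= mulrN mulNr cosN sinN. Qed.

Lemma normc_ce m t : normc (ce m t) = 1.
Proof. by rewrite /= /cs /sn cos2Dsin2 sqrtr1. Qed.

Lemma ceJ m t : ce m t * (ce m t)^*%C = 1.
Proof. by rewrite -sqr_normcE normc_ce expr1n. Qed.

Lemma ce_periodic m t : ce m (t + 1) = ce m t.
Proof.
rewrite /ce /cs /sn mulrDr mulr1 cosD sinD (cs_sn_2pi m).1 (cs_sn_2pi m).2.
by rewrite !mulr1 !mulr0 subr0 addr0.
Qed.

Lemma ce_at0 m : ce m 0 = 1.
Proof. by rewrite /ce /cs /sn !mulr0 cos0 sin0. Qed.

Lemma cint_ce m : cint01 (ce m) = (m == 0)%:R.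
Proof.
case: eqVneq => [->|m0].
  rewrite cint01E (_ : (fun t => Re _) = fun _ => 1); last first.
    by apply/funext => t; rewrite ce0.
  rewrite (_ : (fun t => Im _) = fun _ => 0) ?I01C//.
  by apply/funext => t; rewrite ce0.
have c0 : 2 * pi * m%:~R != 0 :> R.
  by rewrite !mulf_neq0// ?intr_eq0// gt_eqF// pi_gt0.
have Dc (t : R) : is_derive t 1 (fun t => (2 * pi * m%:~R)^-1 * sn m t) (cs m t).
  have H := isdM (isdC (2 * pi * m%:~R)^-1 t) (isd_sinlin (2 * pi * m%:~R) t).
  by apply: is_derive_eq H _; rewrite mul0r add0r mulrA mulVf// mul1r.
have Ds (t : R) : is_derive t 1 (fun t => - (2 * pi * m%:~R)^-1 * cs m t) (sn m t).
  have H := isdM (isdC (- (2 * pi * m%:~R)^-1) t) (isd_coslin (2 * pi * m%:~R) t).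
  by apply: is_derive_eq H _; rewrite mul0r add0r mulrNN mulrA mulVf// mul1r.
rewrite cint01E/= (I01_FTC Dc) ?(I01_FTC Ds); [|exact: sn_cont|exact: cs_cont].
rewrite /cs /sn mulr1 mulr0 (cs_sn_2pi m).1 (cs_sn_2pi m).2 cos0 sin0.
by rewrite !subrr.
Qed.

Lemma fourier_coefE (phi : R -> R[i]) m :
  fourier_coef phi m = cint01 (fun t => phi t * (ce m t)^*%C).
Proof. by []. Qed.

Lemma fourier_linear (k : R[i]) f g m : ccont f -> ccont g ->
  fourier_coef (fun t => k * f t + g t) m = k * fourier_coef f m + fourier_coef g m.
Proof.
move=> cf cg; rewrite !fourier_coefE; under eq_fun do rewrite mulrDl -mulrA.
have cJ := ccontJ (ce_cont m).
by rewrite cintD ?cintZ//; do ?[exact: ccontM|exact: ccontC|apply: ccontM].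
Qed.

Lemma fourier_conj f m : ccont f ->
  fourier_coef (fun t => (f t)^*%C) m = (fourier_coef f (- m))^*%C.
Proof.
move=> cf; rewrite !fourier_coefE -cintJ; last first.
  by apply: ccontM => //; apply: ccontJ; exact: ce_cont.
congr cint01; apply/funext => t.
by rewrite conjCM ceN conjcK.
Qed.

Lemma fourier_ce k m : fourier_coef (ce k) m = (m == k)%:R.
Proof.
rewrite fourier_coefE; under eq_fun do rewrite -ceN -ceD.
by rewrite cint_ce subr_eq0 eq_sym.
Qed.

Lemma fourier_shift k f m : fourier_coef (fun t => ce k t * f t) m = fourier_coef f (m - k).
Proof.
rewrite !fourier_coefE; congr cint01; apply/funext => t.
by rewrite -!ceN opprB ceD [ce k t * _]mulrC -mulrA.
Qed.

Lemma fourier_bound f m (M : R) : ccont f -> (forall t, normc (f t) <= M) ->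
  normc (fourier_coef f m) <= 2 * M.
Proof.
move=> cf fM; rewrite fourier_coefE; apply: cint_bound => [|t].
  by apply: ccontM => //; apply: ccontJ; exact: ce_cont.
by rewrite Normc.normcM normc_conj normc_ce mulr1.
Qed.

(** Pythagoras for the projection orthogonal to the unit vector [ce n] of L^2(0, 1). *)
Lemma cint_sub_proj f n : ccont f ->
  Re (cint01 (fun t => (f t - fourier_coef f n * ce n t) *
    (f t - fourier_coef f n * ce n t)^*%C)) =
  Re (cint01 (fun t => f t * (f t)^*%C)) - normc (fourier_coef f n) ^+ 2.
Proof.
move=> cf; set a := fourier_coef f n.
pose f2 t := f t * (f t)^*%C.
have cf2 : ccont f2 by apply: ccontM => //; exact: ccontJ.
pose f1 t := f t * (ce n t)^*%C.
have cf1 : ccont f1 by apply: ccontM => //; apply: ccontJ; exact: ce_cont.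
have -> : (fun t => (f t - a * ce n t) * (f t - a * ce n t)^*%C) =
    (fun t => (f2 t - a^*%C * f1 t) - (a * (f1 t)^*%C - a * a^*%C)).
  apply/funext => t; rewrite /f2 /f1.
  rewrite (_ : (f t - a * ce n t)^*%C = (f t)^*%C - a^*%C * (ce n t)^*%C); last first.
    by rewrite conjCB conjCM.
  rewrite (_ : (f t * (ce n t)^*%C)^*%C = (f t)^*%C * ce n t); last first.
    by rewrite conjCM conjcK.
  transitivity (f t * (f t)^*%C - a^*%C * (f t * (ce n t)^*%C) - (a * ((f t)^*%C * ce n t) -
     a * a^*%C * (ce n t * (ce n t)^*%C))); first by ring.
  by rewrite ceJ mulr1.
have cah : ccont (fun t => a^*%C * f1 t) by apply: ccontM => //; exact: ccontC.
have cah' : ccont (fun t => a * (f1 t)^*%C).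
  by apply: ccontM; [exact: ccontC|exact: ccontJ].
have h1a : cint01 f1 = a by [].
have cst : cint01 (fun _ => a * a^*%C) = a * a^*%C.
  rewrite -[RHS]mulr1 -[1 in RHS]/((0 == 0 :> int)%:R) -cint_ce -cintZ; last exact: ce_cont.
  by congr cint01; apply/funext => t; rewrite ce0 mulr1.
rewrite cintB; last 2 first.
- exact: ccontB.
- by apply: ccontB => //; exact: ccontC.
rewrite !cintB//; last exact: ccontC.
rewrite cst (cintZ a (ccontJ cf1)) (cintZ _ cf1).
rewrite cintJ// h1a subrr subr0 [a^*%C * a]mulrC -sqr_normcE.
by case: (cint01 f2) => x y /=.
Qed.

(** Frequencies are projected away one at a time. The remainder h keeps the coefficients of f
    outside X, so the next projection removes exactly a coefficient of f; the square norm of what is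
    left is nonnegative. *)
Lemma bessel f (X : seq int) : ccont f -> uniq X ->
  \sum_(n <- X) normc (fourier_coef f n) ^+ 2 <= Re (cint01 (fun t => f t * (f t)^*%C)).
Proof.
move=> cf uX; rewrite -subr_ge0.
suff [h [ch _ ->]] : exists h, [/\ ccont h,
    (forall m, m \notin X -> fourier_coef h m = fourier_coef f m) &
    Re (cint01 (fun t => f t * (f t)^*%C)) - \sum_(n <- X) normc (fourier_coef f n) ^+ 2
    = Re (cint01 (fun t => h t * (h t)^*%C))] by exact: cint_sqr_ge0.
elim: X uX => [_|n X IH]; last rewrite cons_uniq => /andP[nX uX].
  by exists f; split => //; rewrite big_nil subr0.
have [h [ch hm hE]] := IH uX.
have ca : ccont (fun t => fourier_coef h n * ce n t).
  by apply: ccontM; [exact: ccontC|exact: ce_cont].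
exists (fun t => h t - fourier_coef h n * ce n t); split; first exact: ccontB.
  move=> m; rewrite inE negb_or => /andP[mn mX].
  rewrite -hm// (_ : (fun t => _) = (fun t => (- fourier_coef h n) * ce n t + h t)); last first.
    by apply/funext => t; rewrite mulNr addrC.
  rewrite fourier_linear ?fourier_ce ?(negPf mn) ?mulr0 ?add0r//; exact: ce_cont.
by rewrite cint_sub_proj// -hE hm// big_cons opprD addrA addrAC.
Qed.

(** By Bessel the squares of the coefficients are summable along any enumeration without repetition,
    hence tend to 0. *)
Lemma riemann_lebesgue f (o : nat -> int) : ccont f -> injective o ->
  (fun N => fourier_coef f (o N) : R[i]^o) @ \oo --> (0 : R[i]^o).
Proof.
move=> cf oi.
have H : (fun N => normc (fourier_coef f (o N)) ^+ 2) @ \oo --> (0 : R).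
  apply: cvg_series_cvg_0; apply: nondecreasing_is_cvgn.
    by apply: nondecreasing_series => n _ _; exact: sqr_ge0.
  exists (Re (cint01 (fun t => f t * (f t)^*%C))) => _ [N _ <-] /=.
  rewrite /series/= -(big_map o xpredT (fun n => normc (fourier_coef f n) ^+ 2)).
  by apply: bessel => //; rewrite map_inj_uniq// iota_uniq.
apply/cvgCP => e e0; move/cvgrPdist_lt : H => /(_ _ (exprn_gt0 2 e0)).
apply: filterS => N; rewrite !sub0r !normrN normcN ger0_norm ?sqr_ge0//.
by rewrite ltr_sqr ?nnegrE ?normc_ge0// ltW.
Qed.

End complex_integral.

(** * Pointwise convergence of Fourier series *)

Section fourier_inversion.
Context {R : realType}.
Implicit Types (p q : R -> R) (t : R).

(** At a simple zero t1 of q, Caratheodory's slope functions g and h satisfy p = g (t - t1) and q =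
    h (t - t1), and are continuous at t1 with the derivatives as values; near t1 the extended
    quotient is g / h. *)
Lemma quotient_cont p q t1 : (forall t, derivable p t 1) -> (forall t, derivable q t 1) ->
  (q t1 = 0 -> p t1 = 0 /\ q^`()%classic t1 != 0) ->
  {for t1, continuous (fun t => if q t == 0 then p^`()%classic t / q^`()%classic t else p t / q t)}.
Proof.
move=> dp dq pq0; have cp := derivable_continuous dp; have cq := derivable_continuous dq.
have [q0|q0] := eqVneq (q t1) 0; last first.
  rewrite /prop_for /continuous_at (negPf q0).
  have : (fun t => p t / q t) @ t1 --> p t1 / q t1.
    by apply: cvgM; [exact: cp|apply: cvgV => //; exact: cq].
  apply: cvg_trans; apply: near_eq_cvg; near=> t.
  case: ifPn => // /eqP qt; exfalso; move/eqP: qt; apply/negP; near: t.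
  exact: (cvgr_neq0 _ (cq t1) q0).
have [p0 q'0] := pq0 q0.
have [g [gE gc gt]] := (is_derive1_caratheodory p t1 _).1 (derivable_isd (dp t1)).
have [h [hE hc ht]] := (is_derive1_caratheodory q t1 _).1 (derivable_isd (dq t1)).
have h0 : h t1 != 0 by rewrite ht.
rewrite /prop_for /continuous_at q0 eqxx -gt -ht.
have : (fun t => g t / h t) @ t1 --> g t1 / h t1 by apply: cvgM => //; apply: cvgV.
apply: cvg_trans; apply: near_eq_cvg; near=> t.
have htn : h t != 0 by near: t; exact: (cvgr_neq0 _ hc h0).
have [->|tt1] := eqVneq t t1; first by rewrite q0 eqxx gt ht.
have tt : t - t1 != 0 by rewrite subr_eq0.
have qE : q t = h t * (t - t1) by rewrite -hE q0 subr0.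
have pE : p t = g t * (t - t1) by rewrite -gE p0 subr0.
have : q t != 0 by rewrite qE mulf_neq0.
move/negPf => ->; rewrite qE pE invfM mulrACA divff// mulr1//.
Unshelve. all: by end_near. Qed.

(** sin(pi t) has period 1 only up to sign, but 1 - 2 sin(pi t)^2 = cos(2 pi t) has period 1: this
    moves the zero to the fractional part of t, and sin(pi t) > 0 on (0, 1). *)
Lemma sinpi_eq0 (t : R) : sin (pi * t) = 0 -> exists k : int, t = k%:~R.
Proof.
move=> st; exists (Num.floor t).
have cs1 (x : R) : cs 1 x = 1 - (sin (pi * x) ^+ 2) *+ 2.
  rewrite /cs mulr1 -mulrA mulr_natl cos_mulr2n cos2sin2 !mulr2n; ring.
pose t' := t - (Num.floor t)%:~R.
have ct' : cs 1 t' = 1.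
  have := @periodic_int R _ (@cs R 1) _ (- Num.floor t) t.
  rewrite rmorphN => ->; first by rewrite cs1 st expr0n mul0rn subr0.
  by move=> x; have := @ce_periodic R 1 x => -[].
have st' : sin (pi * t') = 0.
  move: ct'; rewrite cs1 => /eqP; rewrite -subr_eq0 addrAC subrr sub0r oppr_eq0.
  by rewrite mulrn_eq0 sqrf_eq0 => /eqP.
have t'0 : 0 <= t' by rewrite subr_ge0 floor_le_tmp.
have t'1 : t' < 1.
  by rewrite ltrBlDr addrC -[1]/(1%:~R) -intrD floorD1_gt.
apply/eqP; rewrite -subr_eq0 eq_le t'0 andbT leNgt; apply/negP => t'p.
have : 0 < sin (pi * t').
  by apply: sin_gt0_pi; rewrite mulr_gt0 ?pi_gt0//= gtr_pMr// pi_gt0.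
by rewrite st' ltxx.
Qed.

(** The Dirichlet kernel is avoided. Dividing phi - phi(t0) by e(t - t0) - 1 turns the terms of the
    series into differences G(n - 1) - G(n), so partial sums telescope, and the two end terms vanish
    by Riemann-Lebesgue. *)
Lemma fourier_partial_sum (phi : R -> R[i]) (t0 : R) :
  (forall t, phi (t + 1) = phi t) ->
  (forall t, derivable (fun u => complex.Re (phi u)) t 1) ->
  (forall t, derivable (fun u => complex.Im (phi u)) t 1) ->
  (fun N => \sum_(n <- win N) fourier_coef phi n * ce n t0 : R[i]^o) @ \oo -->
    (phi t0 : R[i]^o).
Proof.
move=> pphi dRe dIm.
have cphi : ccont phi by split; exact: derivable_continuous.
pose S t : R := sin (pi * t - pi * t0).
pose C t : R := cos (pi * t - pi * t0).
have dS (t : R) : is_derive t 1 S (pi * C t).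
  have L : is_derive t 1 (fun t => pi * t - pi * t0) (pi : R).
    have H := isdB (isd_lin pi t) (isdC (pi * t0) t).
    by apply: is_derive_eq H _; rewrite subr0.
  have H := @is_derive1_comp R sin (fun t => pi * t - pi * t0) t _ _ (is_derive_sin _) L.
  by apply: is_derive_eq H _; rewrite mulrC.
have dS1 t : derivable S t 1 by exact: isd_derivable (dS t).
have cS := derivable_continuous dS1.
have cC : continuous C.
  have -> : C = (fun t => cos (pi * t) * cos (pi * t0) + sin (pi * t) * sin (pi * t0)).
    by apply/funext => t; rewrite /C cosB.
  apply: contD; apply: contM; try exact: contC.
    exact: rsmooth_continuous (rsmooth_trig pi).1.
  exact: rsmooth_continuous (rsmooth_trig pi).2.
have CS t : C t ^+ 2 + S t ^+ 2 = 1 by rewrite cos2Dsin2.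
pose r p t : R := if S t == 0 then p^`()%classic t / S^`()%classic t else p t / S t.
(* The zeros of S are the points t0 + k and all are simple; a function vanishing at all of them is
   divisible by S with a continuous quotient. *)
have key p : (forall t, derivable p t 1) -> (forall k : int, p (t0 + k%:~R) = 0) ->
    continuous (r p) /\ forall t, p t = r p t * S t.
  move=> dp p0.
  have Sp t1 : S t1 = 0 -> p t1 = 0 /\ S^`()%classic t1 != 0.
    move=> S0; rewrite (isd_val (dS t1)); split.
      have [k tk] : exists k : int, t1 - t0 = k%:~R.
        by apply: sinpi_eq0; rewrite mulrBr.
      by rewrite -(subrK t0 t1) tk addrC.
    rewrite mulf_neq0//; first by rewrite gt_eqF// pi_gt0.
    apply/eqP => C0.
    by have := CS t1; rewrite C0 S0 expr0n addr0 => /esym/eqP; rewrite oner_eq0.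
  split; first by move=> t1; apply: quotient_cont => //; exact: Sp.
  move=> t; rewrite /r; case: eqP => [St|/eqP St]; last by rewrite divfK.
  by rewrite St mulr0 (Sp _ St).1.
have pk (k : int) : phi (t0 + k%:~R) = phi t0 by exact: periodic_int.
have dB (f : R -> R) (c : R) : (forall t, derivable f t 1) ->
    forall t, derivable (fun t => f t - c) t 1.
  by move=> df t; apply: isd_derivable (isdB (derivable_isd (df t)) (isdC c t)).
have pRe (k : int) : complex.Re (phi (t0 + k%:~R)) - complex.Re (phi t0) = 0.
  by rewrite pk subrr.
have pIm (k : int) : complex.Im (phi (t0 + k%:~R)) - complex.Im (phi t0) = 0.
  by rewrite pk subrr.
have [cr1 E1] := key (fun t => complex.Re (phi t) - complex.Re (phi t0)) (dB _ _ dRe) pRe.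
have [cr2 E2] := key (fun t => complex.Im (phi t) - complex.Im (phi t0)) (dB _ _ dIm) pIm.
move: E1 E2 cr1 cr2; set r1 := r _; set r2 := r _ => E1 E2 cr1 cr2.
(* e(t - t0) - 1 = 2i sin(pi (t - t0)) exp(i pi (t - t0)), so this is the quotient
   (phi(t) - phi(t0)) / (e(t - t0) - 1) extended by continuity. *)
pose g t : R[i] := (r1 t +i* r2 t)%C * (C t -i* S t)%C * (0 +i* (- 2^-1))%C.
have cg : ccont g.
  have c1 : ccont (fun t => (r1 t +i* r2 t)%C) by split.
  have c2 : ccont (fun t => (C t -i* S t)%C) by split; [exact: cC|exact: contN].
  exact: ccontM (ccontM c1 c2) (ccontC _).
have gE t : phi t - phi t0 = g t * (ce 1 t * (ce 1 t0)^*%C - 1).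
  have -> : phi t - phi t0 = (r1 t +i* r2 t)%C * (S t)%:C%C.
    rewrite [phi t]complexE [phi t0]complexE; simpc.
    by rewrite E1 E2.
  have -> : ce 1 t * (ce 1 t0)^*%C = ((C t ^+ 2 - S t ^+ 2) +i* (2 * (S t * C t)))%C.
    rewrite /ce /cs /sn !mulr1.
    have -> : (cos (2 * pi * t) +i* sin (2 * pi * t))%C *
        ((cos (2 * pi * t0) +i* sin (2 * pi * t0))^*)%C =
        (cos (2 * pi * t - 2 * pi * t0) +i* sin (2 * pi * t - 2 * pi * t0))%C.
      by rewrite cosB sinB; simpc; congr (_ +i* _)%C; ring.
    have -> : 2 * pi * t - 2 * pi * t0 = (pi * t - pi * t0) *+ 2 by rewrite mulr2n; ring.
    rewrite cos_mulr2n sin_mulr2n -/(C t) -/(S t).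
    congr (_ +i* _)%C; last by rewrite mulr_natl mulrC.
    by rewrite -(CS t) mulr2n; ring.
  rewrite /g -!mulrA; congr (_ * _); simpc.
  have C1 : C t ^+ 2 - S t ^+ 2 - 1 = - 2 * S t ^+ 2 by have := CS t; lra.
  rewrite C1; congr (_ +i* _)%C; last by field.
  by rewrite -[LHS]mulr1 -[X in _ * X = _](CS t); field.
pose G n := ce n t0 * fourier_coef g n.
have GE n : fourier_coef phi n * ce n t0 = phi t0 * (n == 0)%:R + (G (n - 1) - G n).
  have c1 : ccont (fun t => ce 1 t * g t) by apply: ccontM => //; exact: ce_cont.
  have e1 : fourier_coef phi n = phi t0 * fourier_coef (ce 0) n +
     ((ce 1 t0)^*%C * fourier_coef (fun t => ce 1 t * g t) n + (- 1) * fourier_coef g n).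
    rewrite (_ : fourier_coef phi n = fourier_coef (fun t => phi t0 * ce 0 t +
       ((ce 1 t0)^*%C * (ce 1 t * g t) + (-1 * g t + 0))) n); last first.
      congr fourier_coef; apply/funext => t; rewrite ce0 mulr1.
      rewrite -[LHS](subrK (phi t0)) gE; ring.
    have c0 := @ccontC R 0.
    have cg' : ccont (fun t => -1 * g t + 0).
      by apply: ccontD => //; apply: ccontM => //; exact: ccontC.
    rewrite fourier_linear; [|exact: ce_cont|]; last first.
      by apply: ccontD => //; apply: ccontM => //; exact: ccontC.
    rewrite fourier_linear// fourier_linear//.
    rewrite (_ : fourier_coef (fun=> 0) n = 0) ?addr0//.
    rewrite fourier_coefE (_ : (fun t => _) = (fun=> 0 * 0)).
      by rewrite cintZ// mul0r.
    by apply/funext => t; rewrite !mul0r.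
  rewrite e1 fourier_ce fourier_shift /G -ceN mulN1r.
  have -> : ce (n - 1) t0 = ce n t0 * ce (- 1) t0 by rewrite -ceD.
  have d0 : (n == 0)%:R * ce n t0 = (n == 0)%:R :> R[i].
    by case: eqP => [->|_]; rewrite ?ce0 ?mulr1// mul0r.
  by rewrite mulrDl -[phi t0 * _ * _]mulrA d0; ring.
(* The factor (0 < N) accounts for the empty window, which misses the term n = 0. *)
have SN N : \sum_(n <- win N) fourier_coef phi n * ce n t0 =
    phi t0 * (0 < N)%:R + (G (Negz N) - G (N%:Z - 1)).
  elim: N => [|N IH].
    by rewrite big_nil mulr0 add0r sub0r NegzE subrr.
  rewrite win_sumS IH !GE mulr1 (_ : N.+1%:Z - 1 = N); last by lia.
  rewrite (_ : Negz N - 1 = Negz N.+1); last by rewrite !NegzE; lia.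
  rewrite (_ : Negz N == 0 = false)// mulr0 add0r.
  case: N IH => [|N] _; rewrite /= ?mulr0 ?mulr1.
    by rewrite sub0r add0r; ring.
  by rewrite add0r; ring.
have Gcvg (o : nat -> int) : injective o -> (fun N => G (o N) : R[i]^o) @ \oo --> (0 : R[i]^o).
  move=> oi; have := riemann_lebesgue cg oi.
  move=> /cvgCP H; apply/cvgCP => e e0; apply: filterS (H e e0) => N.
  by rewrite !sub0r !normcN /G Normc.normcM normc_ce mul1r.
have : (fun N => phi t0 + (G (Negz N) - G (Posz N - 1)) : R[i]^o) @ \oo --> (phi t0 + (0 - 0) : R[i]^o).
  apply: cvgD; first exact: cvg_cst.
  have i1 : injective Negz by move=> m n [].
  have i2 : injective (fun N : nat => N%:Z - 1) by move=> m n; lia.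
  exact: (cvgB (Gcvg _ i1) (Gcvg _ i2)).
rewrite subr0 addr0; apply: cvg_trans; apply: near_eq_cvg; near=> N.
rewrite SN (_ : (0 < N)%N = true) ?mulr1//.
by near: N; exact: nbhs_infty_gt.
Unshelve. all: by end_near. Qed.

End fourier_inversion.

(** * Smooth functions on the circle: decay, inversion and convolution *)

Section smooth_circle_theory.
Context {R : realType}.
Local Opaque fourier_coef.
Implicit Types (phi psi : R -> R[i]) (m n : int).

Lemma smooth_circleP phi : smooth_circle phi <->
  [/\ forall t, phi (t + 1) = phi t, rsmooth (fun t => complex.Re (phi t)) &
      rsmooth (fun t => complex.Im (phi t))].
Proof.
split=> [[pphi sphi]|[pphi sr si]]; split=> // n t.
- exact: (sphi n t).1.
- exact: (sphi n t).2.
Qed.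

Lemma smooth_ccont phi : smooth_circle phi -> ccont phi.
Proof. by move=> /smooth_circleP[_ sr si]; split; exact: rsmooth_continuous. Qed.

Lemma smoothD phi psi : smooth_circle phi -> smooth_circle psi ->
  smooth_circle (fun t => phi t + psi t).
Proof.
move=> /smooth_circleP[p1 r1 i1] /smooth_circleP[p2 r2 i2]; apply/smooth_circleP; split.
- by move=> t; rewrite p1 p2.
- by under eq_fun do rewrite cReD; exact: rsmoothD.
- by under eq_fun do rewrite cImD; exact: rsmoothD.
Qed.

Lemma smoothM phi psi : smooth_circle phi -> smooth_circle psi ->
  smooth_circle (fun t => phi t * psi t).
Proof.
move=> /smooth_circleP[p1 r1 i1] /smooth_circleP[p2 r2 i2]; apply/smooth_circleP; split.
- by move=> t; rewrite p1 p2.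
- under eq_fun do rewrite cReM; apply: rsmoothD; first exact: rsmoothM.
  by apply: rsmoothN; exact: rsmoothM.
- by under eq_fun do rewrite cImM; apply: rsmoothD; exact: rsmoothM.
Qed.

Lemma smoothJ phi : smooth_circle phi -> smooth_circle (fun t => (phi t)^*%C).
Proof.
move=> /smooth_circleP[p r i]; apply/smooth_circleP; split.
- by move=> t; rewrite p.
- by rewrite (_ : (fun t => _) = (fun t => complex.Re (phi t))) //; apply/funext => t; rewrite cReJ.
- by under eq_fun do rewrite cImJ; exact: rsmoothN.
Qed.

Lemma smoothC (c : R[i]) : smooth_circle (fun _ => c).
Proof. by apply/smooth_circleP; split => //; exact: rsmoothC. Qed.

Lemma smoothZ (c : R[i]) phi : smooth_circle phi -> smooth_circle (fun t => c * phi t).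
Proof. by apply: smoothM; exact: smoothC. Qed.

Lemma smooth_ce m : smooth_circle (@ce R m).
Proof.
apply/smooth_circleP; split; first exact: ce_periodic.
- exact: (rsmooth_trig _).1.
- exact: (rsmooth_trig _).2.
Qed.

Lemma absz_intr m : `|m%:~R : R| = (`|m|%N)%:R.
Proof. by rewrite -intr_norm -abszE. Qed.

Lemma fourier_decay phi (k : nat) : smooth_circle phi -> exists2 M : R, 0 <= M &
  forall m, (1 + (`|m|%N)%:R) ^+ k * normc (fourier_coef phi m) <= M.
Proof.
move=> sphi; have [pphi sr si] := (smooth_circleP phi).1 sphi.
have pr : rperiodic (fun t => complex.Re (phi t)) by move=> t; rewrite pphi.
have pi_ : rperiodic (fun t => complex.Im (phi t)) by move=> t; rewrite pphi.
have cr := rsmooth_continuous sr; have ci := rsmooth_continuous si.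
have nE m : normc (fourier_coef phi m) <=
    `|cos_coef (fun t => complex.Re (phi t)) m| + `|sin_coef (fun t => complex.Im (phi t)) m| +
    (`|cos_coef (fun t => complex.Im (phi t)) m| + `|sin_coef (fun t => complex.Re (phi t)) m|).
  apply: le_trans (normc_leReIm _) _; rewrite fourier_coefE cint01E/=.
  apply: lerD.
    under [X in I01 X]eq_fun do rewrite cReM /= mulrN opprK.
    rewrite I01D; [|by apply: contM => //; exact: cs_cont|by apply: contM => //; exact: sn_cont].
    exact: ler_normD.
  under [X in I01 X]eq_fun do rewrite cImM /= mulrN addrC.
  rewrite I01B; [|by apply: contM => //; exact: cs_cont|by apply: contM => //; exact: sn_cont].
  exact: ler_normB.
have D j : exists2 M : R, 0 <= M &
    forall m, (`|m|%N)%:R ^+ j * normc (fourier_coef phi m) <= M.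
  have [M1 H1] := trig_coef_decay j sr pr; have [M2 H2] := trig_coef_decay j si pi_.
  have H m : (`|m|%N)%:R ^+ j * normc (fourier_coef phi m) <= M1 + M2 + (M2 + M1).
    rewrite -absz_intr; apply: (le_trans (ler_wpM2l _ (nE m))); first by rewrite exprn_ge0.
    have [a1 b1] := H1 m; have [a2 b2] := H2 m.
    by rewrite !mulrDr; apply: lerD; apply: lerD.
  exists (M1 + M2 + (M2 + M1)) => //; apply: le_trans (H 0).
  by rewrite mulr_ge0 ?normc_ge0 ?exprn_ge0.
have [M0 M00 HM0] := D 0%N; have [Mk Mk0 HMk] := D k.
exists (2 ^+ k * (M0 + Mk)) => [|m]; first by rewrite mulr_ge0 ?exprn_ge0 ?addr_ge0.
have := HM0 m; have := HMk m; rewrite expr0 mul1r; set z := normc _; set a := _%:R => hk h0.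
have z0 : 0 <= z by exact: normc_ge0.
have a0 : 0 <= a by exact: ler0n.
(* Comparing a with 1 lets the bounds of orders 0 and k combine into one for the weight (1 +
   a)^k. *)
have : (1 + a) ^+ k <= 2 ^+ k * (1 + a ^+ k).
  have [a1|a1] := leP a 1.
    apply: (@le_trans _ _ (2 ^+ k)).
      by rewrite lerXn2r ?nnegrE ?addr_ge0// -[2]/(1 + 1) lerD2l.
    by rewrite ler_peMr ?exprn_ge0// lerDl exprn_ge0.
  apply: (@le_trans _ _ ((2 * a) ^+ k)).
    by rewrite lerXn2r ?nnegrE ?addr_ge0 ?mulr_ge0// mulr_natl mulr2n lerD2r ltW.
  by rewrite exprMn ler_wpM2l ?exprn_ge0// lerDr.
move=> /(ler_wpM2r z0)/le_trans; apply.
by rewrite -mulrA ler_wpM2l ?exprn_ge0// mulrDl mul1r lerD.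
Qed.

(** Decay of order 2 is the price of summability against [tele]; the 2 comes from k + 2 <= 2 (k +
    1). *)
Lemma le_tele (k : nat) (a M : R) : 0 <= a -> (1 + k%:R) ^+ 2 * a <= M ->
  a <= 2 * M * tele k.
Proof.
move=> a0 aM; rewrite /tele.
rewrite ler_pdivlMr ?mulr_gt0//; apply: (@le_trans _ _ (2 * ((1 + k%:R) ^+ 2 * a))); last first.
  by rewrite ler_pM2l.
rewrite -[k.+2%:R]natr1 -[k.+1%:R]natr1; have : 0 <= k%:R :> R by []; nra.
Qed.

Lemma fourier_decay_tele phi : smooth_circle phi -> exists2 M : R, 0 <= M &
  forall k : nat, normc (fourier_coef phi k) <= M * tele k /\
                  normc (fourier_coef phi (Negz k)) <= M * tele k.
Proof.
move=> /(@fourier_decay phi 2)[M M0 H]; exists (2 * M); first by rewrite mulr_ge0.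
move=> k; split; apply: le_tele; try exact: normc_ge0; first exact: (H (Posz k)).
apply: le_trans (H (Negz k)); rewrite ler_wpM2r ?normc_ge0//.
by rewrite lerXn2r ?nnegrE ?addr_ge0// lerD2l ler_nat.
Qed.

Lemma fourier_inversion phi t : smooth_circle phi ->
  (fun N => \sum_(n <- win N) fourier_coef phi n * ce n t : R[i]^o) @ \oo -->
    (phi t : R[i]^o).
Proof.
move=> sphi; have [pphi sr si] := (smooth_circleP phi).1 sphi.
by apply: fourier_partial_sum => //; exact: rsmooth_derivable.
Qed.

Lemma fourier_inj phi psi : smooth_circle phi -> smooth_circle psi ->
  (forall n, fourier_coef phi n = fourier_coef psi n) -> phi = psi.
Proof.
move=> sphi spsi E; apply/funext => t.
have H1 := @fourier_inversion phi t sphi; have H2 := @fourier_inversion psi t spsi.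
apply: (cvgC_unique H1); suff -> : (fun N => \sum_(n <- win N) fourier_coef phi n * ce n t) =
  (fun N => \sum_(n <- win N) fourier_coef psi n * ce n t) by [].
by apply/funext => N; apply: eq_bigr => n _; rewrite E.
Qed.

Lemma win_sum_ord (V : nmodType) (u : int -> V) N :
  \sum_(l <- win N) u l = \sum_(k < N) (u (Posz k) + u (Negz k)).
Proof. by rewrite win_sum big_split. Qed.

(** The dominated series has a limit with a rate uniform in t, and pointwise inversion identifies
    this limit as phi(t). *)
Lemma fourier_tail phi : smooth_circle phi -> exists2 M : R, 0 <= M & forall N t,
  normc (phi t - \sum_(n <- win N) fourier_coef phi n * ce n t) <= M / N.+1%:R.
Proof.
move=> sphi; have [M M0 H] := fourier_decay_tele sphi.
exists (M + M) => [|N t]; first exact: addr_ge0.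
pose u k : R[i]^o := fourier_coef phi (Posz k) * ce k t + fourier_coef phi (Negz k) * ce (Negz k) t.
have uM k : normc (u k) <= (M + M) * tele k.
  have [h1 h2] := H k; rewrite mulrDl; apply: le_trans (normcD _ _) _.
  by apply: lerD; rewrite Normc.normcM normc_ce mulr1.
have [a ua aN] := cseries uM.
have -> : phi t = a.
  have H1 := @fourier_inversion phi t sphi; apply: (cvgC_unique H1).
  rewrite (_ : (fun N => _) = (fun N => \sum_(k < N) u k)); first exact: ua.
  by apply/funext => N'; rewrite win_sum_ord.
by rewrite win_sum_ord.
Qed.

Lemma ccont_sum (r : seq int) (F : int -> R -> R[i]) : (forall n, ccont (F n)) ->
  ccont (fun t => \sum_(n <- r) F n t).
Proof.
move=> cF; elim: r => [|n r IH].
  by under eq_fun do rewrite big_nil; exact: ccontC.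
by under eq_fun do rewrite big_cons; exact: ccontD.
Qed.

Lemma fourier_sum (r : seq int) (c : int -> R[i]) (F : int -> R -> R[i]) m :
  (forall n, ccont (F n)) ->
  fourier_coef (fun t => \sum_(n <- r) c n * F n t) m = \sum_(n <- r) c n * fourier_coef (F n) m.
Proof.
move=> cF; elim: r => [|n r IH].
  rewrite big_nil fourier_coefE (_ : (fun t => _) = (fun=> 0 * 0)).
    by rewrite cintZ ?mul0r//; exact: ccontC.
  by apply/funext => t; rewrite big_nil !mul0r.
rewrite big_cons -IH -fourier_linear//; last first.
  by apply: ccont_sum => k; apply: ccontM => //; exact: ccontC.
by congr fourier_coef; apply/funext => t; rewrite big_cons.
Qed.

Lemma smooth_bounded phi : smooth_circle phi -> exists2 M : R, 0 <= M &
  forall t, normc (phi t) <= M.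
Proof.
move=> sphi; have [pphi sr si] := (smooth_circleP phi).1 sphi.
have [M1 H1] : exists M, forall t, `|complex.Re (phi t)| <= M.
  by apply: rperiodic_bounded; [exact: rsmooth_continuous|move=> t; rewrite pphi].
have [M2 H2] : exists M, forall t, `|complex.Im (phi t)| <= M.
  by apply: rperiodic_bounded; [exact: rsmooth_continuous|move=> t; rewrite pphi].
have H t : normc (phi t) <= M1 + M2 by apply: le_trans (normc_leReIm _) (lerD _ _).
by exists (M1 + M2) => //; apply: le_trans (H 0); exact: normc_ge0.
Qed.

(** For a partial sum of phi the formula is exact, since multiplying psi by [ce k] shifts its
    coefficients by k; the error is controlled by the uniform tail of phi and a bound on psi. *)
Lemma fourier_convolution phi psi n : smooth_circle phi -> smooth_circle psi ->
  (fun N => \sum_(k <- win N) fourier_coef phi k * fourier_coef psi (n - k) : R[i]^o)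
    @ \oo --> (fourier_coef (fun t => phi t * psi t) n : R[i]^o).
Proof.
move=> sphi spsi; have [M M0 HM] := fourier_tail sphi.
have [B B0 HB] := smooth_bounded spsi.
have cphi := smooth_ccont sphi; have cpsi := smooth_ccont spsi.
apply/cvgCP => e e0; near=> N.
have cF k : ccont (fun t => ce k t * psi t) by apply: ccontM => //; exact: ce_cont.
have -> : \sum_(k <- win N) fourier_coef phi k * fourier_coef psi (n - k) =
    fourier_coef (fun t => \sum_(k <- win N) fourier_coef phi k * (ce k t * psi t)) n.
  by rewrite fourier_sum//; apply: eq_bigr => k _; rewrite fourier_shift.
set F := fun t => \sum_(k <- win N) _.
have cFF : ccont F by apply: ccont_sum => k; apply: ccontM => //; exact: ccontC.
rewrite addrC -mulN1r -fourier_linear//; last exact: ccontM.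
apply: (@le_lt_trans _ _ (2 * (M / N.+1%:R * B))).
  apply: fourier_bound => [|t].
    by apply: ccontD; [apply: ccontM => //; exact: ccontC|exact: ccontM].
  rewrite mulN1r addrC (_ : _ - F t =
    (phi t - \sum_(k <- win N) fourier_coef phi k * ce k t) * psi t); last first.
    rewrite mulrBl /F mulr_suml; congr (_ - _).
    by apply: eq_bigr => k _; rewrite mulrA.
  by rewrite Normc.normcM ler_pM ?normc_ge0.
rewrite (_ : 2 * _ = 2 * (M * B) / N.+1%:R); last by rewrite -[RHS]mulrA [M * B / _]mulrAC.
rewrite ltr_pdivrMr// [e * _]mulrC -ltr_pdivrMr//.
near: N; exists (Num.bound (2 * (M * B) / e)) => // N /= hN.
have Me : 0 <= 2 * (M * B) / e by rewrite divr_ge0 ?mulr_ge0// ltW.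
apply: lt_le_trans (_ : (Num.bound (2 * (M * B) / e))%:R <= _).
  by exact: archi_boundP.
by rewrite ler_nat (leq_trans hN).
Unshelve. all: by end_near. Qed.

Lemma win_sum_reflect (V : nmodType) (u : int -> V) N :
  \sum_(l <- win N) u (- 1 - l) = \sum_(l <- win N) u l.
Proof.
rewrite !win_sum addrC; congr +%R; apply: eq_bigr => k _; congr u; lia.
Qed.

(** Moving a window by one step exchanges one term at each end, and the end terms tend to 0. *)
Lemma win_sum_shift (u : int -> R[i]^o) (a : R[i]^o) (j : nat) :
  (fun N => u (Posz N)) @ \oo --> (0 : R[i]^o) ->
  (fun N => u (Negz N)) @ \oo --> (0 : R[i]^o) ->
  (fun N => \sum_(l <- win N) u l) @ \oo --> a ->
  (fun N => \sum_(l <- win N) u (l + j%:Z)) @ \oo --> a.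
Proof.
elim: j u => [|j IH] u up un ua.
  by under eq_fun do under eq_bigr do rewrite addr0.
have -> : (fun N => \sum_(l <- win N) u (l + j.+1)) =
    (fun N => \sum_(l <- win N) (fun l => u (l + 1)) (l + j)).
  by apply/funext => N; apply: eq_bigr => l _; congr u; lia.
have E N : \sum_(l <- win N) u (l + 1) = \sum_(l <- win N) u l + (u (Posz N) - u (- N%:Z)).
  elim: N => [|N IHN]; first by rewrite !big_nil oppr0 addrN addr0.
  rewrite !win_sumS IHN (_ : Posz N + 1 = N.+1); last by lia.
  rewrite (_ : Negz N + 1 = - N%:Z); last by rewrite NegzE; lia.
  by rewrite (_ : Negz N = - N.+1%:Z)//; ring.
have un' : (fun N => u (- N%:Z)) @ \oo --> (0 : R[i]^o).
  rewrite -(cvg_shiftS (fun N : nat => u (- N%:Z))).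
  by move: un; under eq_fun do rewrite NegzE.
have up' : (fun N => u (Posz N + 1)) @ \oo --> (0 : R[i]^o).
  move: up; rewrite -(cvg_shiftS (fun N : nat => u (Posz N))).
  by under eq_fun do rewrite -addn1 PoszD.
apply: (IH (fun l => u (l + 1))); first exact: up'.
  rewrite (_ : (fun N => _) = (fun N : nat => u (- N%:Z))); first exact: un'.
  by apply/funext => N; congr u; rewrite NegzE; lia.
rewrite (_ : (fun N => _) = (fun N => \sum_(l <- win N) u l + (u (Posz N) - u (- N%:Z)))); last exact/funext.
rewrite -[a]addr0 -[X in _ + X](subrr 0).
exact: cvgD ua (cvgB up un').
Qed.

Lemma fourier_convolution_nat phi psi (j m : nat) : smooth_circle phi -> smooth_circle psi ->
  (fun N => \sum_(i <- win N) fourier_coef phi (j%:Z - i) * fourier_coef psi (i - m%:Z) : R[i]^o)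
    @ \oo --> (fourier_coef (fun t => phi t * psi t) (j%:Z - m%:Z) : R[i]^o).
Proof.
move=> sphi spsi.
pose u k : R[i]^o := fourier_coef phi k * fourier_coef psi (j%:Z - m%:Z - k).
have [B B0 HB] := smooth_bounded spsi.
have dec (o : nat -> int) : injective o -> (fun N => u (o N)) @ \oo --> (0 : R[i]^o).
  move=> oi; have /cvgCP H := riemann_lebesgue (smooth_ccont sphi) oi.
  have B1 : 0 < 2 * B + 1 by rewrite ltr_wpDl// mulr_ge0.
  apply/cvgCP => e e0; have d0 : 0 < e / (2 * B + 1) by rewrite divr_gt0.
  apply: filterS (H _ d0) => N; rewrite !sub0r !normcN Normc.normcM ltr_pdivlMr//.
  apply: le_lt_trans; rewrite ler_wpM2l ?normc_ge0//.
  apply: le_trans (@fourier_bound _ _ _ B (smooth_ccont spsi) HB) _.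
  by rewrite lerDl.
(* The substitution k = j - i is l + (j + 1) with l = -1 - i, and l -> -1 - l is the reflection
   preserving each window: hence a shift by j + 1. *)
have H1 : (fun N => \sum_(l <- win N) u (l + j.+1%:Z)) @ \oo -->
   (fourier_coef (fun t => phi t * psi t) (j%:Z - m%:Z) : R[i]^o).
  apply: (@win_sum_shift u).
  - by apply: (dec Posz) => ? ? [].
  - by apply: (dec Negz) => ? ? [].
  - exact: fourier_convolution.
rewrite (_ : (fun N => _) = (fun N => \sum_(l <- win N) u (l + j.+1%:Z))).
  exact: H1.
apply/funext => N; rewrite -(win_sum_reflect (fun l => u (l + j.+1%:Z))).
apply: eq_bigr => i _; rewrite /u; congr (fourier_coef _ _ * fourier_coef _ _); lia.
Qed.

(** The future eigenvalue of T(phi) at E_0. *)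
Lemma sum_fourier0 phi : smooth_circle phi ->
  (fun N => \sum_(n <- win N) fourier_coef phi n : R[i]^o) @ \oo --> (phi 0 : R[i]^o).
Proof.
move=> sphi; have := @fourier_inversion phi 0 sphi.
by under eq_fun do under eq_bigr do rewrite ce_at0 mulr1.
Qed.

End smooth_circle_theory.

(** * Matrices along the orbits of multiplication by s *)

Section orbits.
Context (s : nat) (hs : (2 <= s)%N).
Implicit Types (k l x : int) (m n : nat).

Local Lemma s0 : (0 < s)%N.
Proof. exact: ltn_trans hs. Qed.

(** The maximum defining [s_val] runs over k <= |l| only; nothing is lost, since k < s^k <= |l| as
    soon as s^k divides l. *)
Lemma s_valP l m : l != 0 -> (s ^ m %| `|l|)%N = (m <= s_val s l)%N.
Proof.
move=> l0; have al : (0 < `|l|)%N by rewrite absz_gt0.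
have bnd m' : (s ^ m' %| `|l|)%N -> (m' < `|l|.+1)%N.
  by move=> /(dvdn_leq al) H; rewrite ltnS; apply: leq_trans H; apply: ltnW; exact: ltn_expl.
apply/idP/idP => [sm|].
  have H := @leq_bigmax_cond _ (fun k : 'I_(`|l|.+1) => (s ^ k %| `|l|)%N)
    (fun i => nat_of_ord i) (Ordinal (bnd _ sm)) sm.
  exact: H.
have sv : (s ^ s_val s l %| `|l|)%N.
  rewrite /s_val; have [|i si ->] := @eq_bigmax_cond _ (fun k : 'I_(`|l|.+1) => (s ^ k %| `|l|)%N) val.
    by apply/card_gt0P; exists ord0; rewrite unfold_in /= expn0 dvd1n.
  exact: si.
by move=> mv; apply: dvdn_trans sv; exact: dvdn_exp2l.
Qed.

Lemma s_valE m x : ~~ (s%:Z %| x)%Z -> s_val s ((s ^ m)%N%:Z * x) = m.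
Proof.
move=> sx; have x0 : x != 0 by apply: contraNneq sx => ->; rewrite dvdz0.
have l0 : (s ^ m)%N%:Z * x != 0 by rewrite mulf_neq0// eqz_nat -lt0n expn_gt0 s0.
have sm0 : (0 < s ^ m)%N by rewrite expn_gt0 s0.
apply/eqP; rewrite eqn_leq; apply/andP; split; last first.
  by rewrite -s_valP// abszM dvdn_mulr.
rewrite leqNgt -s_valP// abszM/= expnSr dvdn_pmul2l//.
Qed.

Lemma s_unitE m x : ~~ (s%:Z %| x)%Z -> s_unit s ((s ^ m)%N%:Z * x) = x.
Proof.
move=> sx; rewrite /s_unit s_valE// mulrC mulzK//.
by rewrite eqz_nat -lt0n expn_gt0 s0.
Qed.

Lemma s_unit_val l : l != 0 -> l = (s ^ s_val s l)%N%:Z * s_unit s l.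
Proof.
move=> l0; rewrite mulrC /s_unit divzK//.
by have := s_valP (s_val s l) l0; rewrite leqnn dvdzE.
Qed.

Lemma s_unitN l : l != 0 -> ~~ (s%:Z %| s_unit s l)%Z.
Proof.
move=> l0; apply/negP => /dvdzP[q E].
have := leqnn (s_val s l).+1; rewrite -[X in (_ <= X)%N]addn0 => _.
suff : (s ^ (s_val s l).+1 %| `|l|)%N by rewrite s_valP// ltnn.
rewrite {2}(s_unit_val l0) E abszM/= expnSr abszM/= dvdn_mul// dvdn_mull//.
Qed.

Definition same k l := [&& k != 0, l != 0 & s_unit s k == s_unit s l].

Lemma same_sym k l : same k l = same l k.
Proof. by rewrite /same andbCA [s_unit s k == _]eq_sym. Qed.

Lemma same_eq_unit k l : same k l -> s_unit s k = s_unit s l.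
Proof. by move=> /and3P[_ _ /eqP]. Qed.

Definition orb x m : int := (s ^ m)%N%:Z * x.

Lemma orb_inj x : ~~ (s%:Z %| x)%Z -> injective (orb x).
Proof. by move=> sx m n E; rewrite -(s_valE m sx) -(s_valE n sx) -/(orb x m) E. Qed.

Lemma orb_neq0 x m : ~~ (s%:Z %| x)%Z -> orb x m != 0.
Proof.
move=> sx; rewrite /orb mulf_neq0//; first by rewrite eqz_nat -lt0n expn_gt0 s0.
by apply: contraNneq sx => ->; rewrite dvdz0.
Qed.

Lemma same_orb k l : same k l -> l = orb (s_unit s k) (s_val s l).
Proof. by move=> /and3P[_ l0 /eqP ->]; exact: s_unit_val. Qed.

(** 0 is fixed by multiplication by s and lies in no orbit, whence the first alternative; it becomes
    the entry at (0, 0) of the shifts. *)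
Lemma eq_mulpow m k l : (l == (s ^ m)%N%:Z * k) =
  ((k == 0) && (l == 0)) || (same k l && (m%:Z == (s_val s l)%:Z - (s_val s k)%:Z)).
Proof.
have sm0 : (s ^ m)%N%:Z != 0 :> int by rewrite eqz_nat -lt0n expn_gt0 s0.
have [->|k0] := eqVneq k 0; first by rewrite mulr0 /same eqxx/= orbF.
have [->|l0] := eqVneq l 0.
  by rewrite /same eqxx andbF/= eq_sym mulf_eq0 (negPf sm0) (negPf k0).
rewrite /same k0 l0/=; have [u0 uk] := (s_unitN k0, s_unit_val k0).
apply/eqP/andP => [E|[/eqP uE /eqP mE]].
  have E' : l = (s ^ (m + s_val s k))%N%:Z * s_unit s k.
    by rewrite E {1}uk expnD PoszM mulrA.
  by split; apply/eqP; rewrite E' ?s_unitE ?s_valE//; lia.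
rewrite (s_unit_val l0) -uE {2}uk mulrA -PoszM -expnD; congr (Posz (s ^ _) * _).
lia.
Qed.

End orbits.

(** * Matrices of shifts, diagonal operators, adjoints and products *)

Section operator_matrices.
Context {R : realType}.
Context (s : nat) (hs : (2 <= s)%N).
Implicit Types (k l : int) (A B : operator R).

Local Lemma s1 : (0 < s)%N.
Proof. exact: ltn_trans hs. Qed.

Local Lemma sz : s%:Z != 0.
Proof. by rewrite eqz_nat -lt0n s1. Qed.

Local Notation V := (@shift_op R s).
Local Notation E_ := (@ell2_basis R).

Lemma shift_linear : linear V.
Proof.
move=> c x y; apply: ell2_ext => l; rewrite ell2_valD ell2_valZ !(shift_opE _ _ s1).
by case: ifP => // _; rewrite mulr0 addr0.
Qed.

Lemma shift_bnd : bnd V 1.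
Proof.
move=> x; rewrite mul1r; apply: l2norm_le => [|N]; first exact: l2norm_ge0.
pose X := [seq (l %/ s%:Z)%Z | l <- win N & (s%:Z %| l)%Z].
have uX : uniq X.
  rewrite map_inj_in_uniq ?filter_uniq ?win_uniq// => a b.
  rewrite !mem_filter => /andP[/dvdzP[a' ->] _] /andP[/dvdzP[b' ->] _].
  by rewrite !mulzK ?sz// => ->.
apply: le_trans (l2_ge_seq x uX); rewrite /X big_map big_filter [leRHS]big_mkcond/=.
apply: ler_sum => l _; rewrite (shift_opE _ _ s1); case: ifP => // _.
by rewrite Normc.normc0 expr0n.
Qed.

Lemma shift_bounded : bounded_operators V.
Proof. by apply/boundedP; split; [exact: shift_linear|exists 1 => //; exact: shift_bnd]. Qed.

Lemma adj_shiftE y l : adj V y l = y (s%:Z * l).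
Proof.
have [_ AB] := adj_spec shift_bounded.
rewrite -[LHS]dot_basisr dotC -AB (shift_op_basis _ s1).
by rewrite dot_basisl conjcK.
Qed.

Lemma iter_shift_basis n k : iter n V (E_ k) = E_ ((s ^ n)%N%:Z * k).
Proof.
elim: n => [|n IH]; first by rewrite expn0 mul1r.
by rewrite iterS IH (shift_op_basis _ s1) mulrA -PoszM -expnS.
Qed.

Lemma iter_adj_shiftE n y l : iter n (adj V) y l = y ((s ^ n)%N%:Z * l).
Proof.
elim: n l => [|n IH] l; first by rewrite expn0 mul1r.
by rewrite iterS adj_shiftE IH mulrA -PoszM -expnSr.
Qed.

Lemma iter_bounded n A : bounded_operators A -> bnd A 1 ->
  bounded_operators (iter n A : operator R) /\ bnd (iter n A) 1.
Proof.
move=> bA A1; elim: n => [|n [IHb IH1]].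
  by split; [exact: bounded_id|move=> x; rewrite mul1r].
split; first exact: (bounded_comp bA IHb).
by rewrite -[1]mulr1; exact: (bnd_comp ler01 A1 IH1).
Qed.

Lemma shift_pow_bounded n : bounded_operators (shift_pow s n : operator R).
Proof.
case: n => n; first exact: (iter_bounded n shift_bounded shift_bnd).1.
by apply: (iter_bounded n.+1 (adj_bounded shift_bounded) _).1; exact: adj_bnd shift_bounded ler01 shift_bnd.
Qed.

Lemma shift_pow_bnd n : bnd (shift_pow s n : operator R) 1.
Proof.
case: n => n; first exact: (iter_bounded n shift_bounded shift_bnd).2.
by apply: (iter_bounded n.+1 (adj_bounded shift_bounded) _).2; exact: adj_bnd shift_bounded ler01 shift_bnd.
Qed.

(** One formula for both signs of n: on an orbit, n is the gain in valuation, and E_0 is fixed by V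
    as well as by its adjoint. *)
Lemma shift_pow_entry (n : int) k l : shift_pow s n (E_ k) l =
  (((k == 0) && (l == 0)) || (same s k l && (n == (s_val s l)%:Z - (s_val s k)%:Z)))%:R.
Proof.
case: n => n.
  by rewrite -[shift_pow s n (E_ k)]/(iter n V (E_ k)) iter_shift_basis basisE eq_mulpow.
rewrite -[shift_pow s (Negz n) (E_ k)]/(iter n.+1 (adj V) (E_ k)) iter_adj_shiftE basisE eq_sym (eq_mulpow hs).
rewrite andbC same_sym; congr (_ || (_ && _))%:R; rewrite NegzE; lia.
Qed.

Lemma diag_basis_coord (g : int -> R[i]) k l : diag_op g (E_ k) l = g k * (l == k)%:R.
Proof. by rewrite diag_op_basis ell2_valZ basisE. Qed.

Lemma diag_bounded (g : int -> R[i]) (M : R) : 0 <= M -> (forall k, normc (g k) <= M) ->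
  bounded_operators (diag_op g) /\ bnd (diag_op g) M.
Proof.
move=> M0 gM; have gE x l : diag_op g x l = g l * x l by apply: diag_opE; exists M.
have gb : bnd (diag_op g) M.
  move=> x; apply: l2norm_le => [|N]; first by rewrite mulr_ge0 ?l2norm_ge0.
  rewrite exprMn; apply: (@le_trans _ _ (\sum_(l <- win N) M ^+ 2 * normc (x l) ^+ 2)).
    apply: ler_sum => l _; rewrite gE Normc.normcM exprMn ler_wpM2r ?sqr_ge0//.
    by rewrite lerXn2r ?nnegrE ?normc_ge0.
  by rewrite -mulr_sumr ler_wpM2l ?sqr_ge0// l2_ge_seq// win_uniq.
split=> //; apply/boundedP; split; last by exists M.
by move=> c x y; apply: ell2_ext => l; rewrite ell2_valD ell2_valZ !gE mulrDr mulrCA.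
Qed.

(* The matrix of A in the basis of the E_l is c at (0, 0), K j m x on the orbit
   {s^m l'} of an integer l', not divisible by s, with digits x, and 0 elsewhere. *)
Definition has_mx A (K : nat -> nat -> padic s -> R[i]) (c : R[i]) :=
  forall k l, A (E_ k) l = if same s k l
    then K (s_val s l) (s_val s k) (padic_of_int s (s_unit s k))
    else ((k == 0) && (l == 0))%:R * c.

Lemma same00 k l : (k == 0) && (l == 0) -> same s k l = false.
Proof. by case/andP => /eqP -> _; rewrite /same eqxx. Qed.

Lemma has_mx_uniq A B K c : bounded_operators A -> bounded_operators B ->
  has_mx A K c -> has_mx B K c -> A = B.
Proof. by move=> bA bB mA mB; apply: op_ext => // k l; rewrite mA mB. Qed.

Lemma has_mx_ext A K L c : has_mx A K c ->
  (forall j m l, l != 0 -> K j m (padic_of_int s (s_unit s l)) = L j m (padic_of_int s (s_unit s l))) ->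
  has_mx A L c.
Proof.
move=> mA KL k l; rewrite mA; case: ifPn => // /and3P[k0 _ _].
by rewrite KL.
Qed.

Lemma has_mxD (a : R[i]) A B K L c d : has_mx A K c -> has_mx B L d ->
  has_mx (a *: A + B) (fun j m x => a * K j m x + L j m x) (a * c + d).
Proof.
move=> mA mB k l; rewrite [LHS]/(a * A (E_ k) l + B (E_ k) l) mA mB.
by case: ifP => // _; rewrite mulrDr mulrCA.
Qed.

Lemma has_mx_adj A K c : bounded_operators A -> has_mx A K c ->
  has_mx (adj A) (fun j m x => (K m j x)^*%C) (c^*%C).
Proof.
move=> bA mA k l; rewrite adj_basis// mA same_sym [(l == 0) && _]andbC.
case: ifPn => [/same_eq_unit ->//|_].
by rewrite conjCM; case: (_ && _); rewrite ?conjc1 ?conjc0.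
Qed.

(** B E_k is supported on the orbit of k, so A (B E_k) expands along that orbit, indexed by
    valuations i >= 0. The vector E_0 is an eigenvector of both operators. *)
Lemma has_mx_comp A B K L c d : bounded_operators A -> bounded_operators B ->
  has_mx A K c -> has_mx B L d -> forall k l,
  if same s k l then
    let x := padic_of_int s (s_unit s k) in
    (fun N => \sum_(i < N) K (s_val s l) i x * L i (s_val s k) x : R[i]^o) @ \oo -->
      (A (B (E_ k)) l : R[i]^o)
  else A (B (E_ k)) l = ((k == 0) && (l == 0))%:R * (c * d).
Proof.
move=> bA bB mA mB k l; have lA := bounded_linear bA.
have [k0|k0] := eqVneq k 0.
  rewrite k0 /same eqxx/=.
  have -> : B (E_ 0) = d *: E_ 0.
    apply: ell2_ext => i; rewrite mB ell2_valZ basisE /same eqxx/= mulrC.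
    by case: eqP.
  by rewrite lin_Z// ell2_valZ mA /same eqxx/= mulrCA [d * c]mulrC.
set x := padic_of_int s _.
have u0 := s_unitN hs k0; have oi := orb_inj hs u0.
pose o := orb s (s_unit s k).
have vo i : s_val s (o i) = i by exact: s_valE.
have uo i : s_unit s (o i) = s_unit s k by exact: s_unitE.
have o0 i : o i != 0 by exact: orb_neq0.
have X1 N : uniq (map o (iota 0 N)) by rewrite map_inj_uniq// iota_uniq.
have X2 i : B (E_ k) i != 0 -> \forall N \near \oo, i \in map o (iota 0 N).
  rewrite mB; case: ifPn => [ski _|_]; last by rewrite (negPf k0) mul0r eqxx.
  exists (s_val s i).+1 => // N /= iN; apply/mapP; exists (s_val s i).
    by rewrite mem_iota.
  exact: same_orb.
have := @op_lim R A (B (E_ k)) (fun N => map o (iota 0 N)) l bA X1 X2.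
have E N : \sum_(i <- map o (iota 0 N)) B (E_ k) i * A (E_ i) l =
    \sum_(i < N) L i (s_val s k) x * (if same s k l then K (s_val s l) i x else 0).
  rewrite big_map -(big_mkord xpredT (fun i => L i (s_val s k) x * (if same s k l then K (s_val s l) i x else 0))).
  rewrite /index_iota subn0; apply: eq_bigr => i _.
  rewrite mB mA /same k0 o0 uo eqxx vo/=.
  by case: ifP => // _; rewrite (negPf (o0 i)) mul0r.
under eq_fun do rewrite E.
case: ifPn => [skl|skl] H.
  rewrite /= (_ : (fun N => _) = (fun N => \sum_(i < N) L i (s_val s k) x * K (s_val s l) i x)).
    exact: H.
  by apply/funext => N; apply: eq_bigr => i _; rewrite mulrC.
rewrite mul0r; apply: (cvgC_unique H).
rewrite (_ : (fun N => _) = (fun _ => 0)); first exact: cvg_cst.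
by apply/funext => N; rewrite big1// => i _; rewrite mulr0.
Qed.

Lemma is_adjoint_adj A B : bounded_operators A -> is_adjoint A B -> adj A = B.
Proof.
move=> bA AB; apply: op_ext; first exact: adj_bounded.
  by case: AB.
by move=> k l; rewrite adj_basis// (is_adjoint_basis k l AB).
Qed.

Lemma adj_comp A B : bounded_operators A -> bounded_operators B ->
  adj (A \o B) = adj B \o adj A.
Proof.
move=> bA bB; apply: is_adjoint_adj; first exact: bounded_comp.
have [bA' dA] := adj_spec bA; have [bB' dB] := adj_spec bB.
split; first exact: bounded_comp.
by move=> x y /=; rewrite dA dB.
Qed.

Lemma adjK A : bounded_operators A -> adj (adj A) = A.
Proof.
move=> bA; apply: op_ext => //; first by do 2 apply: adj_bounded.
move=> k l; rewrite adj_basis; last exact: adj_bounded.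
by rewrite adj_basis// conjcK.
Qed.

Lemma adj_scaleD (a : R[i]) A B : bounded_operators A -> bounded_operators B ->
  adj (a *: A + B) = a^*%C *: adj A + adj B.
Proof.
move=> bA bB; have bAB := bounded_scaleD a bA bB.
apply: op_ext; first exact: adj_bounded.
  by apply: bounded_scaleD; exact: adj_bounded.
move=> k l; rewrite adj_basis//.
rewrite [RHS]/(a^*%C * adj A (E_ k) l + adj B (E_ k) l) !adj_basis//.
rewrite [(a *: A + B) _ _]/(a * A (E_ l) k + B (E_ l) k).
by rewrite -conjCM; exact: rmorphD.
Qed.

End operator_matrices.

Lemma continuousCP {R : realType} (T : topologicalType) (f : T -> R[i]^o) (x : T) :
  {for x, continuous f} <->
  forall e : R, 0 < e -> nbhs x [set y | normc (f x - f y) < e].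
Proof. exact: cvgCP. Qed.

(** * Continuity on Z_s *)

Section padic_topology.
Context {R : realType} (s : nat).
Implicit Types (x y : padic s) (f g : padic s -> R[i]).

(** The filter of cylinders around x converges to x for each coordinate topology, hence for their
    supremum; conversely a cylinder is a finite intersection of coordinate conditions. *)
Lemma padic_nbhsP x (U : set (padic s)) :
  nbhs x U <-> exists N, forall y, (forall j, (j < N)%N -> y j = x j) -> U y.
Proof.
pose C N := [set y : padic s | forall j, (j < N)%N -> y j = x j].
split=> [xU|[N NU]].
  pose G := filter_from [set: nat] C.
  have FG : Filter G.
    apply: filter_from_filter; first by exists 0%N.
    move=> i j _ _; exists (maxn i j) => // y yC; split=> k kl; apply: yC.
      exact: leq_trans kl (leq_maxl _ _).
    exact: leq_trans kl (leq_maxr _ _).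
  have Gx : G --> x.
    apply/cvg_sup => i U' [V] [[W] oW <-] Wx WU.
    by exists i.+1 => // y yC; apply: WU; rewrite /= yC.
  by have [N _ NU] := Gx _ xU; exists N.
apply: (@filterS _ (nbhs x) _ (C N)); first exact: NU.
elim: N {NU} => [|N IH]; first by apply: filterS filterT => y _ j.
have PN : nbhs x [set y : padic s | y N = x N].
  have := @proj_continuous nat (fun _ => discrete_topology 'Z_s) N x.
  by move=> /(_ _ (discrete_set1 (x N : discrete_topology 'Z_s))).
apply: filterS (filterI IH PN) => y [yN yeq] j; rewrite ltnS leq_eqVlt.
by move=> /orP[/eqP ->//|]; exact: yN.
Qed.

Definition padcont f := forall x (e : R), 0 < e -> exists N, forall y,
  (forall j, (j < N)%N -> y j = x j) -> normc (f x - f y) < e.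

Lemma padcontP f : continuous (f : padic s -> R[i]^o) <-> padcont f.
Proof.
split=> [cf x e e0|cf x].
  exact/padic_nbhsP/((continuousCP f x).1 (cf x)).
apply/(continuousCP f x) => e e0; have [N H] := cf x e e0.
by apply/padic_nbhsP; exists N.
Qed.

Lemma padcontC (c : R[i]) : padcont (fun _ => c).
Proof. by move=> x e e0; exists 0%N => y _; rewrite subrr Normc.normc0. Qed.

Lemma padcontD f g : padcont f -> padcont g -> padcont (fun x => f x + g x).
Proof.
move=> cf cg x e e0.
have [N Hf] := cf x _ (divr_gt0 e0 (ltr0n _ 2)).
have [M Hg] := cg x _ (divr_gt0 e0 (ltr0n _ 2)).
exists (maxn N M) => y yx.
have hf : normc (f x - f y) < e / 2 by apply: Hf => j jN; apply: yx; rewrite leq_max jN.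
have hg : normc (g x - g y) < e / 2 by apply: Hg => j jN; apply: yx; rewrite leq_max jN orbT.
rewrite opprD addrACA [ltRHS](splitr e).
by apply: le_lt_trans (normcD _ _) _; exact: ltrD.
Qed.

Lemma padcontM f g : padcont f -> padcont g -> padcont (fun x => f x * g x).
Proof.
move=> cf cg x e e0.
pose B := normc (f x) + normc (g x) + 1.
have B0 : 0 < B by rewrite ltr_wpDl// addr_ge0// normc_ge0.
have d0 : 0 < Num.min 1 (e / B) by rewrite lt_min ltr01 divr_gt0.
have [N Hf] := cf x _ d0; have [M Hg] := cg x _ d0.
exists (maxn N M) => y yx.
have : normc (f x - f y) < Num.min 1 (e / B).
  by apply: Hf => j jN; apply: yx; rewrite leq_max jN.
have : normc (g x - g y) < Num.min 1 (e / B).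
  by apply: Hg => j jN; apply: yx; rewrite leq_max jN orbT.
rewrite !lt_min !ltr_pdivlMr// => /andP[g1 ge] /andP[f1 fe].
rewrite (_ : f x * g x - f y * g y = f x * (g x - g y) + (f x - f y) * g y); last by ring.
apply: le_lt_trans (normcD _ _) _; rewrite !Normc.normcM.
have gy : normc (g y) <= normc (g x) + 1.
  have := normcD (g y - g x) (g x); rewrite subrK [normc (_ - _)]normcBC; lra.
have := normc_ge0 (f x); have := normc_ge0 (g x).
have := normc_ge0 (f x - f y); have := normc_ge0 (g x - g y).
move: ge fe gy f1 g1; rewrite /B; set a := normc (f x); set b := normc (g x).
set df := normc (f x - f y); set dg := normc (g x - g y); set b' := normc (g y).
move=> ge fe gy f1 g1 dg0 df0 b0 a0.
have : df * b' <= df * (b + 1) by rewrite ler_wpM2l.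
have [B1|B1] := leP (a + (b + 1)) 0; first by lra.
have : (a * dg + df * (b + 1)) * (a + b + 1) < e * (a + b + 1); last first.
  by rewrite ltr_pM2r; [lra|exact: B0].
have h1 : a * (dg * (a + b + 1)) <= a * e by rewrite ler_wpM2l// ltW.
have h2 : (b + 1) * (df * (a + b + 1)) < (b + 1) * e by rewrite ltr_pM2l// ltr_wpDl.
lra.
Qed.

Lemma padcontJ f : padcont f -> padcont (fun x => (f x)^*%C).
Proof.
by move=> cf x e e0; have [N H] := cf x e e0; exists N => y /H; rewrite -conjCB normc_conj.
Qed.

Lemma padcont_sum (I : Type) (r : seq I) (F : I -> padic s -> R[i]) :
  (forall i, padcont (F i)) -> padcont (fun x => \sum_(i <- r) F i x).
Proof.
move=> cF; elim: r => [|i r IH].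
  rewrite (_ : (fun x => _) = (fun _ => 0)); first exact: padcontC.
  by apply/funext => x; rewrite big_nil.
rewrite (_ : (fun x => _) = (fun x => F i x + \sum_(j <- r) F j x)); first exact: padcontD.
by apply/funext => x; rewrite big_cons.
Qed.

Lemma padcont_unif f (g : nat -> padic s -> R[i]) (M : R) : 0 <= M ->
  (forall N, padcont (g N)) -> (forall N x, normc (f x - g N x) <= M / N.+1%:R) -> padcont f.
Proof.
move=> M0 cg fg x e e0.
have [n Mn] : exists n : nat, M / n.+1%:R < e / 3.
  exists (Num.bound (M / (e / 3))); rewrite ltr_pdivrMr// mulrC -ltr_pdivrMr ?divr_gt0//.
  apply: lt_le_trans (archi_boundP _) _; first by rewrite !divr_ge0// ltW.
  by rewrite ler_nat.
have [N H] := cg n x (e / 3) (divr_gt0 e0 (ltr0n _ 3)); exists N => y /H h.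
rewrite (_ : f x - f y = (f x - g n x) + (g n x - g n y) + (g n y - f y)); last by ring.
apply: le_lt_trans (normcD _ _) _.
have := normcD (f x - g n x) (g n x - g n y).
have := fg n x; have := fg n y; rewrite normcBC; move: h Mn.
set a := normc (g n y - f y); set b := normc (f x - _); set c := normc (_ - g n y); set d := normc (_ + _); set q := M / _.
lra.
Qed.

(** On digits: division by s^m with the remainder discarded, and multiplication by s^m. *)
Definition pad_drop (m : nat) x : padic s := fun j => x (j + m)%N.
Definition pad_mul (m : nat) x : padic s := fun j => if (j < m)%N then 0 else x (j - m)%N.

Lemma padcont_drop m f : padcont f -> padcont (fun x => f (pad_drop m x)).
Proof.
move=> cf x e e0; have [N H] := cf (pad_drop m x) e e0.
by exists (N + m)%N => y yx; apply: H => j jN; apply: yx; rewrite ltn_add2r.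
Qed.

Lemma padcont_mul m f : padcont f -> padcont (fun x => f (pad_mul m x)).
Proof.
move=> cf x e e0; have [N H] := cf (pad_mul m x) e e0.
exists N => y yx; apply: H => j jN; rewrite /pad_mul; case: ifP => // _.
by apply: yx; exact: leq_ltn_trans (leq_subr _ _) jN.
Qed.

Lemma pad_mulK m x : pad_drop m (pad_mul m x) = x.
Proof. by apply/funext => j; rewrite /pad_drop /pad_mul ltnNge leq_addl/= addnK. Qed.

Lemma padcont_if (P : pred (padic s)) N f g :
  (forall x y, (forall j, (j < N)%N -> y j = x j) -> P y = P x) ->
  padcont f -> padcont g -> padcont (fun x => if P x then f x else g x).
Proof.
move=> PN cf cg x e e0; have [N1 H1] := cf x e e0; have [N2 H2] := cg x e e0.
exists (maxn N (maxn N1 N2)) => y yx.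
have y0 j : (j < N)%N -> y j = x j by move=> jN; apply: yx; rewrite leq_max jN.
have y1 j : (j < N1)%N -> y j = x j by move=> jN; apply: yx; rewrite !leq_max jN orbT.
have y2 j : (j < N2)%N -> y j = x j by move=> jN; apply: yx; rewrite !leq_max jN !orbT.
rewrite (PN x y)//; case: ifP => _; [exact: H1|exact: H2].
Qed.

Definition unitb x : bool := (x 0%N : 'Z_s) != 0.

Lemma nbhs_nat_padic (p : nat * padic s) (U : set (nat * padic s)) N :
  (forall y, (forall j, (j < N)%N -> y j = p.2 j) -> U (p.1, y)) -> nbhs p U.
Proof.
case: p => m x /= H; exists ([set m], [set y | forall j, (j < N)%N -> y j = x j]).
  by split; [exact: discrete_set1|apply/padic_nbhsP; exists N].
by case=> m' y /= [-> yx]; exact: H.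
Qed.

Lemma padic_compact : compact [set: padic s].
Proof.
have fZ (i : nat) : compact [set: discrete_topology 'Z_s].
  by apply: finite_compact; exact: (@finite_finset 'Z_s setT).
by have := tychonoff fZ; congr compact; apply/seteqP.
Qed.

(** Decay confines a superlevel set to finitely many copies of the compact Z_s, and it is closed
    there because membership in the units is decided by one digit. *)
Lemma padcont_C0_fun (F : nat * padic s -> R[i]^o) :
  (forall m, padcont (fun x => F (m, x))) ->
  (forall e : R, 0 < e -> exists N, forall m x, (N <= m)%N -> normc (F (m, x)) < e) ->
  C0_fun F.
Proof.
move=> cF F0; split.
  apply: continuous_subspaceT => -[m x]; apply/(continuousCP F (m, x)) => e e0.
  by have [N H] := cF m x e e0; apply: (@nbhs_nat_padic _ _ N).
move=> e e0; have [N HN] := F0 e e0.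
apply: (@subclosed_compact _ _ (`I_N `*` setT)); last 2 first.
- by apply: compact_setX; [apply: finite_compact; exact: finite_II|exact: padic_compact].
- move=> [m x] [_ /= eF]; split => //=; rewrite ltnNge; apply/negP => Nm.
  by have := HN m x Nm; rewrite ltNge eF.
rewrite -[X in closed X]setCK; apply: open_closedC; rewrite openE => -[m x] /= /not_andP H.
have [x0|/eqP x0] := eqVneq (x 0%N : 'Z_s) 0.
  apply: (@nbhs_nat_padic _ _ 1%N) => y /= yx [[_]].
  by rewrite /padic_unit/= yx// x0 eqxx.
have {H} Fe : normc (F (m, x)) < e.
  by case: H => [[]|/negP]; rewrite ?ltNge//; split => //; exact/eqP.
have eF : 0 < e - normc (F (m, x)) by rewrite subr_gt0.
have [M H] := cF m x _ eF; apply: (@nbhs_nat_padic _ _ M) => y /H h [_] /=.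
apply/negP; rewrite -ltNge; have := normcD (F (m, y) - F (m, x)) (F (m, x)).
by rewrite subrK [normc (_ - _)]normcBC; lra.
Qed.

(** [C0_fun] leaves F arbitrary off the units; since these are clopen, cutting F to 0 there makes
    each F(m, .) continuous on Z_s. The bound uses the level e = 1: F is bounded on the compact set
    of units where |F| >= 1. *)
Lemma C0_fun_padcont (F : nat * padic s -> R[i]^o) : C0_fun F ->
  (forall m, padcont (fun x => if unitb x then F (m, x) else 0)) /\
  exists B : R, forall m x, unitb x -> normc (F (m, x)) <= B.
Proof.
move=> [cF /(_ 1 ltr01) KF].
have oD : open ([set: nat] `*` @padic_unit s).
  rewrite openE => -[m x] [_ /= ux]; apply: (@nbhs_nat_padic _ _ 1%N) => y /= yx.
  by split => //; rewrite /padic_unit/= yx.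
split.
  have {}cF := cF; rewrite continuous_open_subspace// in cF.
  move=> m x e e0; case: (boolP (unitb x)) => ux; last first.
    exists 1%N => y yx; rewrite (_ : unitb y = false) ?subrr ?Normc.normc0//.
    by rewrite /unitb yx//; exact: negPf ux.
  have : {for (m, x), continuous F} by apply: cF; rewrite inE; split.
  move=> /(continuousCP F (m, x))/(_ e e0) -[[P Q] /= [nP nQ] PQ].
  have /padic_nbhsP[N HN] := nQ; exists N.+1 => y yx.
  rewrite {1}/unitb yx// -/(unitb x) ux; apply: (PQ (m, y)); split => /=.
    exact: nbhs_singleton nP.
  by apply: HN => j jN; apply: yx; exact: ltnW.
pose K := ([set: nat] `*` @padic_unit s) `&` [set p | 1 <= normc (F p)].
have cn : {within K, continuous (fun p => normc (F p))}.
  have cF' : {within K, continuous F} by apply: continuous_subspaceW cF => p [].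
  move=> p; have H := (continuousCP (T := subspace K) F p).1 (cF' p); apply/cvgrPdist_lt => e e0.
  apply: filterS (H _ e0) => q; apply: le_lt_trans.
  have D (z w : R[i]) : normc z - normc w <= normc (z - w).
    by rewrite lerBlDr (le_trans _ (normcD _ _))// subrK.
  by rewrite ler_norml D andbT lerNl opprB normcBC D.
have /compact_bounded[M [_ HM]] := continuous_compact cn KF.
exists (Num.max 1 (M + 1)) => m x ux; rewrite le_max; apply/orP.
have [F1|/ltW F1] := leP 1 (normc (F (m, x))); [right|by left].
have M1 : M < M + 1 by rewrite ltrDl.
apply: le_trans (ler_norm _) _; apply: (HM _ M1).
by exists (m, x).
Qed.

Context (hs : (2 <= s)%N).

Lemma Zs_intr_eq0 (l : int) : ((l%:~R : 'Z_s) == 0) = (s%:Z %| l)%Z.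
Proof.
have H (n : nat) : ((n%:R : 'Z_s) == 0) = (s %| n)%N.
  rewrite -val_eqE /= val_Zp_nat//.
case: l => n; first by rewrite H.
by rewrite NegzE mulrNz oppr_eq0 H dvdzE abszN.
Qed.

Lemma unitb_int (l : int) : unitb (padic_of_int s l) = ~~ (s%:Z %| l)%Z.
Proof. by rewrite /unitb /padic_of_int expn0 divz1 Zs_intr_eq0. Qed.

Lemma unitb_s_unit (l : int) : l != 0 -> unitb (padic_of_int s (s_unit s l)).
Proof. by move=> l0; rewrite unitb_int; exact: s_unitN. Qed.

Lemma padic_of_int0 : padic_of_int s 0 = fun _ => 0.
Proof. by apply/funext => j; rewrite /padic_of_int div0z. Qed.

Lemma padic_of_int_mul m (l : int) : padic_of_int s ((s ^ m)%N%:Z * l) = pad_mul m (padic_of_int s l).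
Proof.
have p0 j : (s ^ j)%N%:Z != 0 :> int by rewrite eqz_nat -lt0n expn_gt0 (ltn_trans _ hs).
apply/funext => j; rewrite /padic_of_int /pad_mul; case: ltnP => jm.
  apply/eqP; rewrite Zs_intr_eq0; apply/dvdzP.
  (* For j < m the quotient of s^m l by s^j is s^(m - j) l; one factor s is set apart to show that
     the digit is 0. *)
  exists ((s ^ (m - j).-1)%N%:Z * l).
  have -> : (s ^ m)%N%:Z * l = (((s ^ (m - j).-1)%N%:Z * l) * s) * (s ^ j)%N%:Z.
    rewrite -!mulrA [l * _]mulrC !mulrA -!PoszM; congr (Posz _ * _).
    by rewrite -expnSr -expnD; congr (s ^ _)%N; lia.
  by rewrite mulzK.
have -> : (s ^ j)%N%:Z = (s ^ m)%N%:Z * (s ^ (j - m))%N%:Z.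
  by rewrite -PoszM -expnD subnKC.
by rewrite divzMpl// ltz_nat expn_gt0 (ltn_trans _ hs).
Qed.

Lemma sup_unit_ge (F : nat * padic s -> R[i]^o) m x : C0_fun F -> unitb x ->
  normc (F (m, x)) <= sup [set normc (F (m, y)) | y in @padic_unit s].
Proof.
move=> /C0_fun_padcont[_ [B HB]] ux; apply: ub_le_sup; last by exists x.
by exists B => _ [y uy <-]; exact: HB.
Qed.

Lemma sup_unit_le (F : nat * padic s -> R[i]^o) m (B : R) :
  (forall x, unitb x -> normc (F (m, x)) <= B) ->
  sup [set normc (F (m, y)) | y in @padic_unit s] <= B.
Proof.
move=> HB; apply: ge_sup => [|_ [y uy <-]]; last exact: HB.
have u1 : unitb (padic_of_int s 1); last first.
  by exists (normc (F (m, padic_of_int s 1))); exists (padic_of_int s 1).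
by rewrite unitb_int dvdzE/= dvdn1 gtn_eqF.
Qed.

Lemma sup_unit_ge0 (F : nat * padic s -> R[i]^o) m :
  0 <= sup [set normc (F (m, y)) | y in @padic_unit s].
Proof.
(* When the set of values has no supremum, [sup] is 0 by default. *)
have [hS|hS] := pselect (has_sup [set normc (F (m, y)) | y in @padic_unit s]); last first.
  by rewrite sup_out.
have [[z [y uy yz]] ub] := hS; apply: le_trans (normc_ge0 (F (m, y))) _.
by apply: ub_le_sup => //; exists y.
Qed.

End padic_topology.

(** * The smooth ideal *)

Section bisum.
Context {R : realType}.

(** Both one-sided norm limits merge into one limit of window sums at each entry, the form in which
    series of operators are identified. *)
Lemma op_bisum_coord (u : int -> operator R) A : (forall n, bounded_operators (u n)) ->
  op_bisum u A -> bounded_operators A /\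
  forall x l, (fun N => \sum_(n <- win N) u n x l : R[i]^o) @ \oo --> (A x l : R[i]^o).
Proof.
move=> bu [A1 [A2 [c1 c2 ->]]]; split; first by apply: boundedD; [case: c1|case: c2].
move=> x l; have b1 n : bounded_operators (\sum_(k < n) u (Posz k)) by exact: bounded_sum.
have b2 n : bounded_operators (\sum_(k < n) u (Negz k)) by exact: bounded_sum.
have H := cvgD (@op_cvg_coord _ _ _ x l b1 c1) (@op_cvg_coord _ _ _ x l b2 c2).
rewrite (_ : (fun N => _) = (fun N => (\sum_(k < N) u (Posz k)) x l + (\sum_(k < N) u (Negz k)) x l)).
  exact: H.
apply/funext => N; rewrite win_sum !op_sumE !ell2_val_sum//.
Qed.

Lemma op_bisum_exists (u : int -> operator R) (M : R) : (forall n, bounded_operators (u n)) ->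
  (forall k : nat, bnd (u (Posz k)) (M * tele k)) ->
  (forall k : nat, bnd (u (Negz k)) (M * tele k)) -> exists A, op_bisum u A.
Proof.
move=> bu u1 u2.
have [A1 c1 _] := @op_series _ (fun k => u (Posz k)) M (fun k => bu k) u1.
have [A2 c2 _] := @op_series _ (fun k => u (Negz k)) M (fun k => bu (Negz k)) u2.
by exists (A1 + A2), A1, A2.
Qed.

(** A given entry is met by a single diagonal n, so the bilateral series is eventually constant
    there. *)
Lemma win_pick (a : int -> R[i]) (n0 : int) :
  (fun N => \sum_(n <- win N) (if n == n0 then a n else 0) : R[i]^o) @ \oo --> (a n0 : R[i]^o).
Proof.
apply: cvg_near_cst; exists (`|n0|%N.+1) => // N /= nN.
have nw : n0 \in win N by rewrite mem_win; lia.
rewrite (bigD1_seq n0)//= ?win_uniq// eqxx big1 ?addr0// => n.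
by move=> /negPf ->.
Qed.

End bisum.

(** * Rapidly decreasing matrices and their operators *)

Section smooth_ideal.
Context {R : realType} (s : nat) (hs : (2 <= s)%N).
Implicit Types (A B : operator R) (K L : nat -> nat -> padic s -> R[i]).

Local Notation E_ := (@ell2_basis R).

Definition rapid_mx K := (forall j m, padcont (K j m)) /\
  forall p : nat, exists M : R, forall j m x,
    (1 + j%:R + m%:R) ^+ p * normc (K j m x) <= M.

(* Decay away from the diagonal only, as for the matrices phi_(j - m) of T(phi). *)
Definition offdiag_mx K := (forall j m, padcont (K j m)) /\
  forall p : nat, exists M : R, forall j m x,
    (1 + (`|j%:Z - m%:Z|%N)%:R) ^+ p * normc (K j m x) <= M.

Lemma rapid_offdiag_mx K : rapid_mx K -> offdiag_mx K.
Proof.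
move=> [cK dK]; split => // p; have [M HM] := dK p; exists M => j m x.
apply: le_trans (HM j m x); rewrite ler_wpM2r ?normc_ge0// lerXn2r ?nnegrE ?addr_ge0//.
by rewrite -addrA lerD2l -natrD ler_nat; lia.
Qed.

Lemma rapid_mx_lin (a : R[i]) K L : rapid_mx K -> rapid_mx L ->
  rapid_mx (fun j m x => a * K j m x + L j m x).
Proof.
move=> [cK dK] [cL dL]; split=> [j m|p].
  by apply: padcontD => //; apply: padcontM => //; exact: padcontC.
have [M HM] := dK p; have [N HN] := dL p; exists (normc a * M + N) => j m x.
have w0 : 0 <= (1 + j%:R + m%:R : R) ^+ p by rewrite exprn_ge0 ?addr_ge0.
apply: (le_trans (ler_wpM2l w0 (normcD _ _))); rewrite mulrDr lerD//.
by rewrite Normc.normcM mulrCA ler_wpM2l ?normc_ge0.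
Qed.

Lemma rapid_mx_adj K : rapid_mx K -> rapid_mx (fun j m x => (K m j x)^*%C).
Proof.
move=> [cK dK]; split=> [j m|p]; first exact: padcontJ.
have [M HM] := dK p; exists M => j m x.
by rewrite normc_conj addrAC.
Qed.

(** The factor (1 + i)^2 pays for the summation over i. Order p = 0 gives a rate uniform in x, hence
    continuity of the sum; general p gives its decay. *)
Lemma rapid_mx_series (u : nat -> nat -> padic s -> nat -> R[i]) :
  (forall j m i, padcont (fun x => u j m x i)) ->
  (forall p : nat, exists C : R, forall j m x i,
    (1 + i%:R) ^+ 2 * ((1 + j%:R + m%:R) ^+ p * normc (u j m x i)) <= C) ->
  exists2 P, rapid_mx P & forall j m x,
    (fun N => \sum_(i < N) u j m x i : R[i]^o) @ \oo --> (P j m x : R[i]^o).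
Proof.
move=> cu du.
have D p : exists2 C : R, 0 <= C & forall j m x i,
    normc (u j m x i) <= C / (1 + j%:R + m%:R) ^+ p * tele i.
  have [C HC] := du p; exists (2 * C) => [|j m x i].
    rewrite mulr_ge0//; apply: le_trans (HC 0%N 0%N (fun=> 0) 0%N).
    by rewrite !mulr_ge0 ?normc_ge0 ?exprn_ge0 ?addr_ge0.
  have w0 : 0 < (1 + j%:R + m%:R : R) ^+ p by rewrite exprn_gt0// -addrA ltr_wpDr// addr_ge0.
  rewrite mulrAC ler_pdivlMr// mulrC; apply: le_tele (HC j m x i).
  by rewrite mulr_ge0 ?normc_ge0 ?(ltW w0).
have [C0 C00 HC0] := D 0%N.
have HC0' j m x i : normc (u j m x i) <= C0 * tele i.
  by have := HC0 j m x i; rewrite expr0 divr1.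
have [P HP] : {P : nat -> nat -> padic s -> R[i]^o | forall j m x,
    (fun N => \sum_(i < N) u j m x i : R[i]^o) @ \oo --> P j m x /\
    forall N, normc (P j m x - \sum_(i < N) u j m x i) <= C0 / N.+1%:R}.
  apply: cid; exists (fun j m x => xget 0 [set a : R[i]^o |
     (fun N => \sum_(i < N) u j m x i : R[i]^o) @ \oo --> a /\
    forall N, normc (a - \sum_(i < N) u j m x i) <= C0 / N.+1%:R]) => j m x.
  case: xgetP => [//|H]; have [a ua aN] := cseries (HC0' j m x).
  by exfalso; exact: (H a).
exists P => [|j m x]; last by case: (HP j m x).
split=> [j m|p].
  apply: (@padcont_unif R s _ (fun N x => \sum_(i < N) u j m x i) C0) => //.
    by move=> N; apply: padcont_sum.
  by move=> N x; case: (HP j m x).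
have [C _ HC] := D p; exists C => j m x.
have [a ua aN] := cseries (HC j m x).
have -> : P j m x = a by apply: cvgC_unique ua; case: (HP j m x).
have w0 : 0 < (1 + j%:R + m%:R : R) ^+ p by rewrite exprn_gt0// -addrA ltr_wpDr// addr_ge0.
by rewrite mulrC -ler_pdivlMr//; have := aN 0%N; rewrite big_ord0 subr0 divr1.
Qed.

Lemma rapid_mx_mul K L : rapid_mx K -> offdiag_mx L -> exists2 P, rapid_mx P & forall j m x,
  (fun N => \sum_(i < N) K j i x * L i m x : R[i]^o) @ \oo --> (P j m x : R[i]^o).
Proof.
move=> [cK dK] [cL dL]; apply: (@rapid_mx_series (fun j m x i => K j i x * L i m x)) => [j m i|p].
  exact: padcontM.
(* By 1 + j + m <= (1 + j + i)(1 + |i - m|), the p-th powers of both weights dominate (1 + j + m)^p;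
   the two spare powers of 1 + j + i serve the sum over i. *)
have [M HM] := dK (p + 2)%N; have [N HN] := dL p; exists (M * N) => j m x i.
rewrite Normc.normcM; apply: le_trans (ler_pM _ _ (HM j i x) (HN i m x)).
- rewrite exprD; set a := (1 + j%:R + i%:R : R); set b := (1 + (`|i%:Z - m%:Z|%N)%:R : R).
  set k := normc _; set l := normc _.
  have i0 : 0 <= (1 + i%:R : R) by rewrite addr_ge0.
  have a0 : 0 <= a by rewrite !addr_ge0.
  have b0 : 0 <= b by rewrite !addr_ge0.
  have h1 : (1 + i%:R) ^+ 2 <= a ^+ 2.
    by rewrite lerXn2r ?nnegrE// /a addrAC lerDl.
  have h2 : (1 + j%:R + m%:R) ^+ p <= a ^+ p * b ^+ p.
    rewrite -exprMn lerXn2r ?nnegrE ?mulr_ge0 ?addr_ge0//.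
    have H : (1 + j + m <= (1 + j + i) * (1 + `|i%:Z - m%:Z|))%N by nia.
    by move: H; rewrite -(ler_nat R) natrM !natrD.
  rewrite [leRHS](_ : _ = (a ^+ 2) * (a ^+ p * b ^+ p * (k * l))); last by ring.
  by apply: ler_pM; rewrite ?exprn_ge0 ?mulr_ge0 ?exprn_ge0 ?addr_ge0 ?normc_ge0//
    ler_wpM2r ?mulr_ge0 ?normc_ge0.
- by rewrite mulr_ge0 ?normc_ge0 ?exprn_ge0 ?addr_ge0.
- by rewrite mulr_ge0 ?normc_ge0 ?exprn_ge0 ?addr_ge0.
Qed.

Definition iterm (F : int -> nat * padic s -> R[i]^o) (n : int) : operator R :=
  if 0 <= n then shift_pow s n \o mult_op0 (F n) else mult_op0 (F n) \o shift_pow s n.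

Lemma mult_op0_bounded (F : nat * padic s -> R[i]^o) (C : R) : 0 <= C ->
  (forall m x, unitb x -> normc (F (m, x)) <= C) ->
  bounded_operators (mult_op0 F) /\ bnd (mult_op0 F) C.
Proof.
move=> C0 FC; apply: diag_bounded => // k; case: eqVneq => [_|k0].
  by rewrite Normc.normc0.
by apply: FC; exact: unitb_s_unit.
Qed.

Lemma iterm_bounded (F : int -> nat * padic s -> R[i]^o) n (C : R) : 0 <= C ->
  (forall m x, unitb x -> normc (F n (m, x)) <= C) ->
  bounded_operators (iterm F n) /\ bnd (iterm F n) C.
Proof.
move=> C0 FC; have [b0 bC] := mult_op0_bounded C0 FC; rewrite /iterm.
have bs := @shift_pow_bounded R s hs n; have s1 := @shift_pow_bnd R s hs n.
case: ifP => _; split; try exact: bounded_comp.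
  by rewrite -[C]mul1r; exact: bnd_comp.
by rewrite -[C]mulr1; exact: bnd_comp.
Qed.

(** In either order of composition F is evaluated at the smaller valuation: at the source when the
    shift raises it, at the target when the shift lowers it. This explains the convention in the
    definition of the ideal. *)
Lemma iterm_entry (F : int -> nat * padic s -> R[i]^o) n (C : R) k l : 0 <= C ->
  (forall m x, unitb x -> normc (F n (m, x)) <= C) ->
  iterm F n (E_ k) l = if n == (s_val s l)%:Z - (s_val s k)%:Z then
    if same s k l then F n (minn (s_val s l) (s_val s k), padic_of_int s (s_unit s k)) else 0
    else 0.
Proof.
move=> C0 FC; have [b0 bC] := mult_op0_bounded C0 FC.
rewrite /iterm; case: ifPn => n0 /=.
  rewrite {1}/mult_op0 diag_op_basis lin_Z; last exact: bounded_linear (shift_pow_bounded hs n).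
  rewrite ell2_valZ (shift_pow_entry hs).
  have [->|k0] := eqVneq k 0; first by rewrite mul0r /same eqxx; case: ifP.
  rewrite /= [_ && (n == _)]andbC; case: eqP => [nE|_] /=; last by rewrite mulr0.
  case: ifP => _; last by rewrite mulr0.
  by rewrite mulr1 (minn_idPr _)//; lia.
rewrite /mult_op0 diag_opE; last first.
  exists C => i; case: eqVneq => [_|i0]; first by rewrite Normc.normc0.
  by apply: FC; exact: unitb_s_unit.
rewrite (shift_pow_entry hs).
have [->|l0] := eqVneq l 0; first by rewrite mul0r /same eqxx andbF; case: ifP.
rewrite andbF /= [_ && (n == _)]andbC; case: eqP => [nE|_] /=; last by rewrite mulr0.
case: ifPn => [skl|_]; last by rewrite mulr0.
by rewrite mulr1 (minn_idPl _) ?(same_eq_unit skl)//; lia.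
Qed.

Lemma Ismooth_mx A : Ismooth s A ->
  bounded_operators A /\ exists2 K, rapid_mx K & has_mx A K 0.
Proof.
move=> [F [CF dF bF]].
have [B HB] : exists B : int -> R, forall n, 0 <= B n /\
    forall m x, unitb x -> normc (F n (m, x)) <= B n.
  have H n := (C0_fun_padcont (CF n)).2.
  exists (fun n => Num.max 0 (proj1_sig (cid (H n)))) => n; split.
    by rewrite le_max lexx.
  by case: (cid _) => /= C HC m x ux; rewrite le_max HC ?orbT.
have bu n : bounded_operators (iterm F n).
  by have [B0 FB] := HB n; exact: (iterm_bounded B0 FB).1.
have [bA cA] := op_bisum_coord bu bF; split=> //.
(* The n-th term fills the diagonal j - m = n, at position min(j, m); cutting to units makes K
   continuous on Z_s. *)
pose K j m x : R[i] := if unitb x then F (j%:Z - m%:Z) (minn j m, x) else 0.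
exists K.
  split=> [j m|p]; first exact: (C0_fun_padcont (CF _)).1.
  (* The factor 2^p comes from 1 + j + m <= 2 (1 + min(j, m) + |j - m|). *)
  have [M HM] := dF p; exists (2 ^+ p * M) => j m x.
  have M0 : 0 <= M by apply: le_trans (HM 0%N 0); rewrite mulr_ge0 ?exprn_ge0 ?addr_ge0.
  rewrite /K; case: ifPn => ux; last by rewrite Normc.normc0 mulr0 mulr_ge0 ?exprn_ge0.
  have := HM (minn j m) (j%:Z - m%:Z); rewrite ger0_norm ?sup_unit_ge0// => H.
  apply: le_trans (ler_wpM2l (exprn_ge0 p (ler0n _ 2)) H); rewrite mulrA -exprMn.
  apply: ler_pM; rewrite ?normc_ge0 ?exprn_ge0 ?addr_ge0 ?sup_unit_ge//.
  rewrite lerXn2r ?nnegrE ?mulr_ge0 ?addr_ge0//.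
  rewrite !mulrDr mulr1 -addrA -[in leRHS]addrA lerD// ?ler1n//.
  by rewrite -!natrM -!natrD ler_nat; lia.
move=> k l; rewrite mulr0; apply: (cvgC_unique (cA _ _)).
pose a n := if same s k l then F n (minn (s_val s l) (s_val s k), padic_of_int s (s_unit s k)) else 0.
have -> : (if same s k l then K (s_val s l) (s_val s k) (padic_of_int s (s_unit s k)) else 0) =
    a ((s_val s l)%:Z - (s_val s k)%:Z).
  by rewrite /a; case: ifPn => // /and3P[k0 _ _]; rewrite /K unitb_s_unit.
rewrite (_ : (fun N => _) = (fun N => \sum_(n <- win N) if n == (s_val s l)%:Z - (s_val s k)%:Z then a n else 0)).
  exact: win_pick.
apply/funext => N; apply: eq_bigr => n _; have [B0 FB] := HB n.
by rewrite -/(iterm F n) (iterm_entry k l B0 FB).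
Qed.

(** The diagonals of K provide the coefficients F_n. Their series converges in norm to some A' in
    the ideal, and A' = A because the matrices agree. *)
Lemma mx_Ismooth A K : bounded_operators A -> rapid_mx K -> has_mx A K 0 -> Ismooth s A.
Proof.
move=> bA rK mA; have [cK dK] := rK.
pose F (n : int) (p : nat * padic s) : R[i]^o := match n with
  | Posz k => K (p.1 + k)%N p.1 p.2 | Negz k => K p.1 (p.1 + k.+1)%N p.2 end.
pose Mf p := proj1_sig (cid (dK p)).
have FK n m x p : (1 + m%:R + (`|n|%N)%:R : R) ^+ p * normc (F n (m, x)) <=
    Mf p.
  have HM := proj2_sig (cid (dK p)); rewrite -/(Mf p) in HM.
  case: n => n; [apply: le_trans (HM (m + n)%N m x)|apply: le_trans (HM m (m + n.+1)%N x)];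
    rewrite ler_wpM2r ?normc_ge0// lerXn2r ?nnegrE ?addr_ge0// -!addrA lerD2l -!natrD ler_nat; lia.
have decF n (e : R) : 0 < e -> exists N, forall m x, (N <= m)%N -> normc (F n (m, x)) < e.
  move=> e0; set M := Mf 1%N.
  have M0 : 0 <= M.
    apply: le_trans (FK n 0%N (fun=> 0) 1%N).
    by rewrite mulr_ge0 ?exprn_ge0 ?addr_ge0 ?normc_ge0.
  exists (Num.bound (M / e)) => m x Nm; rewrite -(ltr_pM2l (_ : 0 < m.+1%:R))//.
  apply: le_lt_trans (_ : M < _).
    apply: le_trans (FK n m x 1%N); rewrite expr1 ler_wpM2r ?normc_ge0//.
    by rewrite -natr1 addrC lerDl.
  rewrite -ltr_pdivrMr//; apply: lt_le_trans (archi_boundP _) _.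
    by rewrite divr_ge0// ltW.
  by rewrite ler_nat ltnW.
have CF n : C0_fun (F n) by apply: padcont_C0_fun => [m|]; [case: n => n; exact: cK|exact: decF].
have dF : rapid_decay (fun m n => sup [set normc (F n (m, x)) | x in @padic_unit s]).
  move=> p; exists (Mf p) => m n; rewrite ger0_norm ?sup_unit_ge0// mulrC.
  have w0 : 0 < (1 + m%:R + (`|n|%N)%:R : R) ^+ p by rewrite exprn_gt0// -addrA ltr_wpDr// addr_ge0.
  rewrite -ler_pdivlMr//; apply: sup_unit_le => // x _.
  by rewrite ler_pdivlMr// mulrC; exact: FK.
have FT n m x : normc (F n (m, x)) <= 2 * Mf 2%N * tele (`|n|%N).
  apply: le_tele; first exact: normc_ge0.
  apply: le_trans (FK n m x 2%N); rewrite ler_wpM2r ?normc_ge0//.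
  by rewrite lerXn2r ?nnegrE ?addr_ge0// addrAC lerDl.
set M2 := 2 * _ in FT.
have M20 : 0 <= M2.
  by rewrite -(pmulr_lge0 _ (@tele_gt0 R 0)) (le_trans _ (FT 0 0%N (fun=> 0)))// normc_ge0.
have T0 n : 0 <= M2 * tele n :> R by rewrite mulr_ge0// ltW// tele_gt0.
have bu n : bounded_operators (iterm F n).
  exact: (iterm_bounded (T0 `|n|%N) (fun m x _ => FT n m x)).1.
have [A' bA'] : exists A', op_bisum (iterm F) A'.
  apply: (@op_bisum_exists _ _ M2) => // k.
    exact: (iterm_bounded (T0 k) (fun m x _ => FT (Posz k) m x)).2.
  (* [Negz k] has absolute value k + 1, and [tele] decreases. *)
  apply: bnd_le (iterm_bounded (T0 k.+1) (fun m x _ => FT (Negz k) m x)).2.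
  rewrite ler_wpM2l// /tele lef_pV2 ?posrE ?mulr_gt0// -!natrM ler_nat; lia.
have [bdA' cA'] := op_bisum_coord bu bA'.
suff -> : A = A' by exists F.
apply: has_mx_uniq mA _ => // k l; rewrite mulr0; apply: (cvgC_unique (cA' _ _)).
pose a n : R[i] := if same s k l then F n (minn (s_val s l) (s_val s k), padic_of_int s (s_unit s k)) else 0.
have -> : (if same s k l then K (s_val s l) (s_val s k) (padic_of_int s (s_unit s k)) else 0) =
    a ((s_val s l)%:Z - (s_val s k)%:Z).
  rewrite /a; case: ifPn => // _; set j := s_val s l; set m := s_val s k.
  rewrite /F; case E : (j%:Z - m%:Z) => [n|n] /=.
    by rewrite (minn_idPr _); [congr K; lia|lia].
  by rewrite (minn_idPl _); [congr K; rewrite ?NegzE in E; lia|lia].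
rewrite (_ : (fun N => _) = (fun N => \sum_(n <- win N) if n == (s_val s l)%:Z - (s_val s k)%:Z then a n else 0)).
  exact: win_pick.
apply/funext => N; apply: eq_bigr => n _.
by rewrite (iterm_entry k l (T0 `|n|%N) (fun m x _ => FT n m x)).
Qed.

End smooth_ideal.

(** * Toeplitz operators *)

Section smooth_algebra.
Context {R : realType} (s : nat) (hs : (2 <= s)%N).
Implicit Types (A B : operator R) (phi psi : R -> R[i]).

Local Notation E_ := (@ell2_basis R).
Local Notation I := (@Ismooth R s).
Local Notation T := (@Toeplitz R s).
Local Opaque fourier_coef.

Definition toepl_mx phi (j m : nat) (x : padic s) : R[i] := fourier_coef phi (j%:Z - m%:Z).

(** Decay of the coefficients shows that the choice behind [Toeplitz] is not the default. The
    entries follow from those of the shifts; at E_0 all of them are 1, so the coefficients add up to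
    phi(0). *)
Lemma Toeplitz_spec phi : smooth_circle phi ->
  [/\ bounded_operators (T phi), has_mx (T phi) (toepl_mx phi) (phi 0) &
      op_bisum (fun m => fourier_coef phi m *: (shift_pow s m : operator R)) (T phi)].
Proof.
move=> sphi; have [M M0 HM] := fourier_decay_tele sphi.
pose u m : operator R := fourier_coef phi m *: (shift_pow s m : operator R).
have bu n : bounded_operators (u n) by apply: boundedZ; exact: shift_pow_bounded.
have un n : bnd (u n) (normc (fourier_coef phi n)).
  by rewrite -[normc _]mulr1; apply: bndZ; exact: shift_pow_bnd.
have TT : op_bisum u (T phi).
  rewrite /Toeplitz; case: xgetP => [//|].
  have [A HA] : exists A, op_bisum u A.
    apply: (@op_bisum_exists _ _ M) => // k.
      by apply: bnd_le (un _); case: (HM k).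
    by apply: bnd_le (un _); case: (HM k).
  by move=> /(_ A).
have [bT cT] := op_bisum_coord bu TT; split=> // k l.
apply: (cvgC_unique (cT _ _)).
have uE n : u n (E_ k) l = fourier_coef phi n * (((k == 0) && (l == 0)) ||
    (same s k l && (n == (s_val s l)%:Z - (s_val s k)%:Z)))%:R.
  by rewrite -(shift_pow_entry hs).
have [kl|kl] := boolP ((k == 0) && (l == 0)).
  rewrite (same00 s kl) mul1r.
  rewrite (_ : (fun N => _) = (fun N => \sum_(n <- win N) fourier_coef phi n)).
    exact: sum_fourier0.
  by apply/funext => N; apply: eq_bigr => n _; rewrite uE kl mulr1.
rewrite mul0r.
pose a n := if same s k l then fourier_coef phi n else 0.
have -> : (if same s k l then toepl_mx phi (s_val s l) (s_val s k) (padic_of_int s (s_unit s k)) else 0) =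
    a ((s_val s l)%:Z - (s_val s k)%:Z) by [].
rewrite (_ : (fun N => _) = (fun N => \sum_(n <- win N) if n == (s_val s l)%:Z - (s_val s k)%:Z then a n else 0)).
  exact: win_pick.
apply/funext => N; apply: eq_bigr => n _; rewrite uE (negPf kl) /a /=.
by case: eqP => _; rewrite ?andbT ?andbF ?mulr0//; case: ifP; rewrite ?mulr1 ?mulr0.
Qed.

Lemma Toeplitz_bounded phi : smooth_circle phi -> bounded_operators (T phi).
Proof. by case/Toeplitz_spec. Qed.

Lemma Toeplitz_mx phi : smooth_circle phi -> has_mx (T phi) (toepl_mx phi) (phi 0).
Proof. by case/Toeplitz_spec. Qed.

Lemma toepl_offdiag_mx phi : smooth_circle phi -> offdiag_mx (toepl_mx phi).
Proof.
move=> sphi; split=> [j m|p]; first exact: padcontC.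
by have [M _ HM] := fourier_decay p sphi; exists M => j m x; exact: HM.
Qed.

Lemma Toeplitz_linear (k : R[i]) phi psi : smooth_circle phi -> smooth_circle psi ->
  T (fun t => k * phi t + psi t) = k *: T phi + T psi.
Proof.
move=> sphi spsi; have sk : smooth_circle (fun t => k * phi t + psi t).
  exact: (smoothD (smoothZ k sphi) spsi).
apply: has_mx_uniq (Toeplitz_mx sk) _; first exact: (Toeplitz_bounded sk).
  exact: (bounded_scaleD k (Toeplitz_bounded sphi) (Toeplitz_bounded spsi)).
apply: has_mx_ext (has_mxD k (Toeplitz_mx sphi) (Toeplitz_mx spsi)) _ => j m l _.
by rewrite /toepl_mx fourier_linear//; exact: smooth_ccont.
Qed.

Lemma Toeplitz_adj phi : smooth_circle phi -> adj (T phi) = T (fun t => (phi t)^*%C).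
Proof.
move=> sphi; have sJ := smoothJ sphi; have bT := Toeplitz_bounded sphi.
apply: has_mx_uniq _ (Toeplitz_mx sJ); first exact: adj_bounded.
  exact: Toeplitz_bounded.
apply: has_mx_ext (has_mx_adj bT (Toeplitz_mx sphi)) _ => j m l _.
by rewrite /toepl_mx fourier_conj ?opprB//; exact: smooth_ccont.
Qed.

Lemma Ismooth_bounded A : I A -> bounded_operators A.
Proof. by case/(Ismooth_mx hs). Qed.

Lemma Ismooth_linear (k : R[i]) A B : I A -> I B -> I (k *: A + B).
Proof.
move=> /(Ismooth_mx hs)[bA [K rK mA]] /(Ismooth_mx hs)[bB [L rL mB]].
apply: (mx_Ismooth hs (bounded_scaleD k bA bB) (rapid_mx_lin k rK rL)).
by have := has_mxD k mA mB; rewrite mulr0 addr0.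
Qed.

Lemma Ismooth0 : I 0.
Proof.
apply: (@mx_Ismooth _ _ hs _ (fun _ _ _ => 0)); first exact: bounded0.
  by split=> [j m|p]; [exact: padcontC|exists 0 => j m x; rewrite Normc.normc0 mulr0].
by move=> k l; rewrite mulr0; case: ifP.
Qed.

Lemma IsmoothD A B : I A -> I B -> I (A + B).
Proof. by move=> IA IB; rewrite -[A]scale1r; exact: Ismooth_linear. Qed.

Lemma IsmoothN A : I A -> I (- A).
Proof. by move=> IA; rewrite -[- A]addr0 -scaleN1r; apply: Ismooth_linear => //; exact: Ismooth0. Qed.

Lemma IsmoothB A B : I A -> I B -> I (A - B).
Proof. by move=> IA IB; apply: IsmoothD => //; exact: IsmoothN. Qed.

Lemma Ismooth_adj A : I A -> I (adj A).
Proof.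
move=> /(Ismooth_mx hs)[bA [K rK mA]].
apply: (mx_Ismooth hs (adj_bounded bA) (rapid_mx_adj rK)).
by have := has_mx_adj bA mA; rewrite conjc0.
Qed.

(** Stated for off-diagonal decay to cover at once right factors T(phi) and right factors in the
    ideal. *)
Lemma Ismooth_mulr A B (L : nat -> nat -> padic s -> R[i]) (d : R[i]) : I A -> bounded_operators B -> offdiag_mx L ->
  has_mx B L d -> I (A \o B).
Proof.
move=> /(Ismooth_mx hs)[bA [K rK mA]] bB aL mB.
have [P rP HP] := rapid_mx_mul hs rK aL.
apply: (mx_Ismooth hs (bounded_comp bA bB) rP) => k l.
have := has_mx_comp hs bA bB mA mB k l; case: ifP => _ /=.
  by move=> H; exact: cvgC_unique H (HP _ _ _).
by rewrite mul0r !mulr0.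
Qed.

Lemma Ismooth_mulT A phi : smooth_circle phi -> I A -> I (A \o T phi).
Proof.
move=> sphi IA.
exact: Ismooth_mulr IA (Toeplitz_bounded sphi) (toepl_offdiag_mx sphi) (Toeplitz_mx sphi).
Qed.

(** T(phi) A is the adjoint of A* T(conj phi), which reduces the left product to the right one. *)
Lemma Ismooth_Tmul A phi : smooth_circle phi -> I A -> I (T phi \o A).
Proof.
move=> sphi IA; have bA := Ismooth_bounded IA; have bT := Toeplitz_bounded sphi.
rewrite -(adjK (bounded_comp bT bA)) adj_comp// Toeplitz_adj//.
apply: Ismooth_adj; apply: Ismooth_mulT; first exact: smoothJ.
exact: Ismooth_adj.
Qed.

Lemma Ismooth_mul A B : I A -> I B -> I (A \o B).
Proof.
move=> IA /(Ismooth_mx hs)[bB [L rL mB]].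
exact: (Ismooth_mulr IA bB (rapid_offdiag_mx hs rL) mB).
Qed.

Lemma Toeplitz_mul phi psi : smooth_circle phi -> smooth_circle psi ->
  I ((T phi \o T psi) - T (fun t => phi t * psi t)).
Proof.
move=> sphi spsi; have bphi := Toeplitz_bounded sphi; have bpsi := Toeplitz_bounded spsi.
have sM := smoothM sphi spsi.
(* The entries of T(phi) T(psi) sum over i >= 0 only; Q collects the missing terms
   i < 0 of the convolution. *)
have [Q rQ HQ] : exists2 Q, rapid_mx Q & forall j m (x : padic s),
    (fun N => \sum_(i < N) fourier_coef phi (j%:Z - Negz i) * fourier_coef psi (Negz i - m%:Z) : R[i]^o)
      @ \oo --> (Q j m x : R[i]^o).
  apply: (@rapid_mx_series _ _ (fun j m x i => fourier_coef phi (j%:Z - Negz i) * fourier_coef psi (Negz i - m%:Z))).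
    by move=> j m i; exact: padcontC.
  (* The index -i - 1 is at distance j + i + 1 from j and m + i + 1 from m. The product of these
     weights dominates 1 + j + m, and two extra powers of the first make the sum over i converge. *)
  move=> p; have [M M0 HM] := fourier_decay (p + 2) sphi; have [N N0 HN] := fourier_decay p spsi.
  exists (M * N) => j m x i; rewrite Normc.normcM.
  have := HM (j%:Z - Negz i); have := HN (Negz i - m%:Z).
  set a := normc _; set b := normc _ => hb ha.
  have nj : `|j%:Z - Negz i|%N = (j + i.+1)%N by lia.
  have nm : `|Negz i - m%:Z|%N = (m + i.+1)%N by lia.
  rewrite nj in ha; rewrite nm in hb.
  have a0 : 0 <= a by exact: normc_ge0.
  have b0 : 0 <= b by exact: normc_ge0.
  apply: le_trans (ler_pM _ _ ha hb); try by rewrite mulr_ge0 ?exprn_ge0 ?addr_ge0.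
  rewrite exprD; set x1 := (1 + (j + i.+1)%:R : R); set x2 := (1 + (m + i.+1)%:R : R).
  have x10 : 0 <= x1 by rewrite addr_ge0.
  have x20 : 0 <= x2 by rewrite addr_ge0.
  have h1 : (1 + i%:R) ^+ 2 <= x1 ^+ 2.
    by rewrite lerXn2r ?nnegrE ?addr_ge0// lerD2l ler_nat; lia.
  have h2 : (1 + j%:R + m%:R) ^+ p <= x1 ^+ p * x2 ^+ p.
    rewrite -exprMn lerXn2r ?nnegrE ?mulr_ge0 ?addr_ge0//.
    rewrite /x1 /x2 -[1]/(1%:R) -!natrD -natrM ler_nat; nia.
  rewrite [leRHS](_ : _ = (x1 ^+ 2) * (x1 ^+ p * x2 ^+ p * (b * a))); last by ring.
  by apply: ler_pM; rewrite ?exprn_ge0 ?mulr_ge0 ?exprn_ge0 ?addr_ge0//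
    ler_wpM2r ?mulr_ge0.
have r0 : rapid_mx (fun (_ _ : nat) (_ : padic s) => 0 : R[i]).
  by split=> [j m|p]; [exact: padcontC|exists 0 => j m x; rewrite Normc.normc0 mulr0].
apply: (mx_Ismooth hs _ (rapid_mx_lin (-1) rQ r0)).
  by apply: boundedB; [exact: bounded_comp|exact: Toeplitz_bounded].
move=> k l; rewrite [LHS]/(T phi (T psi (E_ k)) l - T (fun t => phi t * psi t) (E_ k) l).
have := has_mx_comp hs bphi bpsi (Toeplitz_mx sphi) (Toeplitz_mx spsi) k l.
(* Off the orbits nothing remains: at E_0 the product and T(phi psi) have the same entry phi(0)
   psi(0). *)
rewrite (Toeplitz_mx sM k l); case: ifP => _; last by move=> ->; rewrite mulr0; exact: subrr.
rewrite /= mulN1r addr0; set j := s_val s l; set m := s_val s k; set x := padic_of_int _ _.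
rewrite /toepl_mx => H; have H1 := @fourier_convolution_nat _ _ _ j m sphi spsi.
have H2 : T phi (T psi (E_ k)) l + Q j m x = fourier_coef (fun t => phi t * psi t) (j%:Z - m%:Z).
  apply: cvgC_unique H1.
  rewrite (_ : (fun N => _) = (fun N => \sum_(i < N) fourier_coef phi (j%:Z - i%:Z) *
      fourier_coef psi (i%:Z - m%:Z) + \sum_(i < N) fourier_coef phi (j%:Z - Negz i) *
      fourier_coef psi (Negz i - m%:Z))); first exact: cvgD H (HQ j m x).
  by apply/funext => N; rewrite win_sum.
have Z (a b c : R[i]) : a + b = c -> a - c = - b by move=> <-; rewrite opprD addrA subrr add0r.
exact: Z H2.
Qed.

End smooth_algebra.

(** * The smooth algebra inside HS(s) *)

Section algebra_HS.
Context {R : realType} (s : nat) (hs : (2 <= s)%N).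
Implicit Types (A B : operator R) (phi psi : R -> R[i]) (f : padic s -> R[i]).

Local Notation I := (@Ismooth R s).
Local Notation T := (@Toeplitz R s).

(** Places the identity and V = T([ce 1]) in the smooth algebra, as density requires. *)
Lemma Toeplitz_ce (n : int) : T (ce n) = shift_pow s n.
Proof.
apply: op_ext; [exact: (Toeplitz_bounded hs (smooth_ce n))|exact: shift_pow_bounded|].
move=> k l; rewrite (Toeplitz_mx hs (smooth_ce n) k l) (shift_pow_entry hs) ce_at0 mulr1.
case: ifPn => [/and3P[/negPf k0 _ _]|_]; last by rewrite andFb orbF.
by rewrite k0 /= /toepl_mx fourier_ce eq_sym.
Qed.

Lemma Toeplitz_id : T (ce 0) = id.
Proof. by rewrite Toeplitz_ce. Qed.

Lemma Ismooth_HSsmooth A : I A -> HSsmooth s A.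
Proof.
move=> IA; have sz := smooth_ce (R := R) 0; have s0 := smoothZ 0 sz.
exists (fun t => 0 * ce 0 t), A; split=> //; suff -> : T (fun t => 0 * ce 0 t) = 0 by rewrite add0r.
have := Toeplitz_linear hs (-1) sz sz; rewrite scaleN1r addNr => <-; congr (T _).
by apply/funext => t; rewrite mulN1r addNr mul0r.
Qed.

(** The future q(A) = phi, kept as a relation until [symb_uniq]. Its rules for sums, products and
    adjoints serve both the algebra and the quotient. *)
Definition symb A phi := smooth_circle phi /\ I (A - T phi).

Lemma symbP A : HSsmooth s A <-> exists phi, symb A phi.
Proof.
split=> [[phi [c [sphi Ic ->]]]|[phi [sphi Ic]]].
  by exists phi; split=> //; rewrite addrAC subrr add0r.
by exists phi, (A - T phi); split=> //; rewrite addrC subrK.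
Qed.

Lemma symb_Toeplitz phi c : smooth_circle phi -> I c -> symb (T phi + c) phi.
Proof. by move=> sphi Ic; split=> //; rewrite addrAC subrr add0r. Qed.

Lemma symb_bounded A phi : symb A phi -> bounded_operators A.
Proof.
move=> [sphi /(Ismooth_bounded hs) bc]; rewrite -[A](subrK (T phi)).
exact: boundedD bc (Toeplitz_bounded hs sphi).
Qed.

Lemma symb_lin (k : R[i]) A B phi psi : symb A phi -> symb B psi ->
  symb (k *: A + B) (fun t => k * phi t + psi t).
Proof.
move=> [sphi IA] [spsi IB]; split; first exact: smoothD (smoothZ k sphi) spsi.
rewrite (Toeplitz_linear hs k sphi spsi) opprD addrACA -scalerN -scalerDr.
exact: (Ismooth_linear hs k IA IB).
Qed.

Lemma symb_mul A B phi psi : symb A phi -> symb B psi ->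
  symb (A \o B) (fun t => phi t * psi t).
Proof.
move=> [sphi IA] [spsi IB]; split; first exact: smoothM sphi spsi.
set c := A - T phi in IA; set d := B - T psi in IB.
have lT := bounded_linear (Toeplitz_bounded hs sphi).
rewrite (_ : _ - _ = (c \o d) + (c \o T psi) + (T phi \o d) +
    ((T phi \o T psi) - T (fun t => phi t * psi t))).
  exact: (IsmoothD hs (IsmoothD hs (IsmoothD hs (Ismooth_mul hs IA IB)
    (Ismooth_mulT hs spsi IA)) (Ismooth_Tmul hs sphi IB)) (Toeplitz_mul hs sphi spsi)).
have bA := Ismooth_bounded hs IA.
apply/funext => x.
have dx : B x = d x + T psi x by rewrite /d -[RHS]/(B x - T psi x + T psi x) subrK.
have cx y : A y = c y + T phi y by rewrite /c -[RHS]/(A y - T phi y + T phi y) subrK.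
rewrite -[LHS]/(A (B x) - T (fun t => phi t * psi t) x) cx dx.
rewrite (lin_D _ _ lT) (lin_D _ _ (bounded_linear bA)).
rewrite -[RHS]/(c (d x) + c (T psi x) + T phi (d x) + (T phi (T psi x) - T (fun t => phi t * psi t) x)).
by rewrite !addrA.
Qed.

Lemma symb_adj A phi : symb A phi -> symb (adj A) (fun t => (phi t)^*%C).
Proof.
move=> [sphi IA]; split; first exact: smoothJ sphi.
have bc := Ismooth_bounded hs IA; have bT := Toeplitz_bounded hs sphi.
rewrite -(Toeplitz_adj hs sphi).
have -> : adj A = adj (A - T phi) + adj (T phi).
  rewrite -[A in LHS](subrK (T phi)) -[A - T phi in LHS]scale1r (adj_scaleD _ bc bT).
  by rewrite conjc1 scale1r.
by rewrite addrK; exact: Ismooth_adj.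
Qed.

Lemma star_subalgebra_HSsmooth : star_subalgebra (HSsmooth (R := R) s).
Proof.
split.
- by move=> A /symbP[phi]; exact: symb_bounded.
- by apply: Ismooth_HSsmooth; exact: Ismooth0.
- move=> k A B /symbP[phi pA] /symbP[psi pB]; apply/symbP.
  by exists (fun t => k * phi t + psi t); exact: symb_lin.
- move=> A B /symbP[phi pA] /symbP[psi pB]; apply/symbP.
  by exists (fun t => phi t * psi t); exact: symb_mul.
- move=> A /symbP[phi pA]; apply/symbP.
  by exists (fun t => (phi t)^*%C); exact: symb_adj.
Qed.

Lemma ideal_Ismooth : two_sided_ideal I (HSsmooth s).
Proof.
split; first exact: Ismooth_HSsmooth.
- exact: Ismooth0.
- by move=> k A B; exact: Ismooth_linear.
move=> A C /symbP[phi [sphi IA]] IC; set c := A - T phi in IA.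
have bC := Ismooth_bounded hs IC.
split.
  rewrite (_ : A \o C = (c \o C) + (T phi \o C)).
    exact: (IsmoothD hs (Ismooth_mul hs IA IC) (Ismooth_Tmul hs sphi IC)).
  by apply/funext => x; rewrite -[RHS]/(A (C x) - T phi (C x) + T phi (C x)) subrK.
rewrite (_ : C \o A = (C \o c) + (C \o T phi)).
  exact: (IsmoothD hs (Ismooth_mul hs IC IA) (Ismooth_mulT hs sphi IC)).
apply/funext => x; rewrite -[RHS]/(C (c x) + C (T phi x)) -(lin_D _ _ (bounded_linear bC)).
by rewrite -[c x]/(A x - T phi x) subrK.
Qed.

(** * Closed *-algebras containing the generators *)

Section generated.
Context (S : set (operator R)) (sS : star_subalgebra S) (cS : norm_closed S)
  (VS : S (shift_op s))
  (mS : forall f, padcont f -> S (mult_op (f : padic s -> R[i]^o))).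

Lemma gen_scale (k : R[i]) A : S A -> S (k *: A).
Proof. by case: sS => _ S0 Sl _ _ SA; rewrite -[k *: A]addr0; exact: Sl. Qed.

Lemma gen_add A B : S A -> S B -> S (A + B).
Proof. by case: sS => _ S0 Sl _ _ SA SB; rewrite -[A]scale1r; exact: Sl. Qed.

Lemma gen_sum N (u : nat -> operator R) : (forall n, S (u n)) -> S (\sum_(i < N) u i).
Proof.
move=> Su; elim: N => [|N IH]; first by rewrite big_ord0; case: sS.
by rewrite big_ord_recr; exact: gen_add.
Qed.

Lemma gen_bisum (u : int -> operator R) A : (forall n, S (u n)) -> op_bisum u A -> S A.
Proof.
move=> Su [A1 [A2 [c1 c2 ->]]]; apply: gen_add.
  by apply: cS c1 => n; apply: (gen_sum n (u := fun k => u (Posz k))).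
by apply: cS c2 => n; apply: (gen_sum n (u := fun k => u (Negz k))).
Qed.

Lemma gen_id : S id.
Proof.
have <- : mult_op (fun _ : padic s => 1 : R[i]^o) = id.
  apply/funext => x; apply: ell2_ext => l; rewrite /mult_op diag_opE ?mul1r//.
  by exists 1 => _; rewrite Normc.normc1.
by apply: mS; exact: padcontC.
Qed.

Lemma gen_shift_pow n : S (shift_pow s n).
Proof.
have it m B : S B -> S (iter m B).
  move=> SB; elim: m => [|m IH]; first exact: gen_id.
  by case: sS => _ _ _ Sc _; exact: Sc SB IH.
by case: n => n; apply: it => //; case: sS => _ _ _ _; exact.
Qed.

Lemma gen_mult_op0 (F : nat * padic s -> R[i]^o) (M : R) : C0_fun F ->
  (forall m x, unitb x -> (1 + m%:R) * normc (F (m, x)) <= M) -> S (mult_op0 F).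
Proof.
move=> /C0_fun_padcont[cF _] FM.
(* f N is the part of F at valuations < N, as a continuous function on Z_s: the
   i-th term of the sum lives on the x of valuation i. *)
pose low i (x : padic s) := all (fun j => x j == 0) (iota 0 i).
pose G i (x : padic s) : R[i] := if unitb x then F (i, x) else 0.
pose f N (x : padic s) : R[i] := \sum_(i < N) if low i x then G i (pad_drop i x) else 0.
have cf N : padcont (f N).
  apply: padcont_sum => i; apply: (@padcont_if _ _ _ i).
  - move=> x y xy; apply: eq_in_all => j; rewrite mem_iota add0n => /andP[_ ji].
    by rewrite xy.
  - by apply: (@padcont_drop _ _ i (G i)); exact: cF.
  - exact: padcontC.
have M0 : 0 <= M.
  have := FM 0%N (padic_of_int s (s_unit s 1)) (unitb_s_unit hs (oner_neq0 _)).
  by apply: le_trans; rewrite mulr_ge0 ?normc_ge0 ?addr_ge0.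
have FM' N m x : unitb x -> (N <= m)%N -> normc (F (m, x)) <= M / N.+1%:R.
  move=> ux Nm; rewrite ler_pdivlMr// mulrC; apply: le_trans (FM m x ux).
  by rewrite ler_wpM2r ?normc_ge0// -[1]/(1%:R) -natrD ler_nat.
pose g (l : int) : R[i] := if l == 0 then 0 else F (s_val s l, padic_of_int s (s_unit s l)).
have fg N (l : int) : f N (padic_of_int s l) =
    if (l == 0) || (N <= s_val s l)%N then 0 else g l.
  rewrite /g; case: eqVneq => [->|l0] /=.
    by rewrite padic_of_int0 /f big1// => i _; rewrite /G /unitb eqxx; case: ifP.
  rewrite {1}(s_unit_val hs l0) (padic_of_int_mul hs).
  set m := s_val s l; set y := padic_of_int s _.
  have uy : unitb y by exact: unitb_s_unit.
  (* Only the index i = m survives: for i > m the nonzero digit y_0, in position m, violates [low];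
     for i < m the shifted number starts with the digit 0, so [G] vanishes. *)
  have t i : (if low i (pad_mul m y) then G i (pad_drop i (pad_mul m y)) else 0) =
      if i == m then F (m, y) else 0.
    case: eqVneq => [->|im].
      rewrite pad_mulK /G uy /low; case: allP => // -[] j; rewrite mem_iota add0n => /andP[_ jm].
      by rewrite /pad_mul jm.
    have [mi|mi] := ltnP m i.
      case: ifP => // /allP /(_ m); rewrite mem_iota add0n mi => /(_ isT).
      by rewrite /pad_mul ltnn subnn => /eqP y0; move: uy; rewrite /unitb y0 eqxx.
    rewrite /G (_ : unitb _ = false) ?if_same// /unitb /pad_drop /pad_mul add0n.
    by rewrite ltn_neqAle im mi eqxx.
  rewrite /f; under eq_bigr do rewrite t.
  case: leqP => mN.
    by rewrite big1// => i _; case: eqP => // im; move: (ltn_ord i); rewrite im ltnNge mN.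
  rewrite (bigD1 (Ordinal mN))//= eqxx big1 ?addr0// => i; rewrite -val_eqE /=.
  by move=> /negPf ->.
have gM : forall l, normc (g l) <= M.
  move=> l; rewrite /g; case: eqVneq => l0; first by rewrite Normc.normc0.
  by rewrite -[M]divr1; apply: (FM' 0%N) => //; exact: unitb_s_unit.
have fM N l : normc (f N (padic_of_int s l)) <= M.
  by rewrite fg; case: ifP => _; rewrite ?Normc.normc0.
have bg : bounded_operators (mult_op0 F) := (diag_bounded M0 gM).1.
have bf N : bounded_operators (mult_op (f N : padic s -> R[i]^o)) := (diag_bounded M0 (fM N)).1.
apply: (cS (u := fun N => mult_op (f N : padic s -> R[i]^o))) => [N|]; first exact: mS.
apply: (op_cvgP bf bg).2 => e e0.
exists (Num.bound (M / e)) => // N /= MN.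
have MNe : M / N.+1%:R <= e.
  rewrite ler_pdivrMr// mulrC -ler_pdivrMr//; apply: ltW; apply: lt_le_trans (archi_boundP _) _.
    by rewrite divr_ge0// ltW.
  by rewrite ler_nat ltnW.
have hb l : normc (f N (padic_of_int s l) - g l) <= e.
  rewrite fg; case: (boolP (_ || _)) => [|_]; last by rewrite subrr Normc.normc0 ltW.
  rewrite sub0r normcN /g; case: eqVneq => [_ _|l0 /= Nv]; first by rewrite Normc.normc0 ltW.
  by apply: le_trans MNe; apply: FM' => //; exact: unitb_s_unit.
have := (diag_bounded (ltW e0) hb).2.
rewrite (_ : diag_op _ = mult_op (f N : padic s -> R[i]^o) - mult_op0 F)//.
apply/funext => x; apply: ell2_ext => l; rewrite ell2_valD ell2_valN /mult_op /mult_op0.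
rewrite !diag_opE; first by rewrite -mulrBl.
- by exists M.
- by exists M => k; exact: fM.
- by exists e.
Qed.

Lemma gen_Toeplitz phi : smooth_circle phi -> S (T phi).
Proof.
move=> /(Toeplitz_spec hs)[_ _]; apply: gen_bisum => n.
by apply: gen_scale; exact: gen_shift_pow.
Qed.

Lemma gen_Ismooth A : I A -> S A.
Proof.
move=> [F [CF dF]]; apply: gen_bisum => n.
have S0 : S (mult_op0 (F n)).
  have [M HM] := dF 1%N; apply: (@gen_mult_op0 _ M (CF n)) => m x ux.
  apply: le_trans (HM m n); rewrite expr1 ger0_norm ?sup_unit_ge0//.
  by apply: ler_pM; rewrite ?normc_ge0 ?addr_ge0 ?lerDl ?sup_unit_ge.
by case: sS => _ _ _ Sc _; case: ifP => _; apply: Sc => //; exact: gen_shift_pow.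
Qed.

End generated.

Lemma HSsmooth_sub_HS : HSsmooth s `<=` HS (R := R) s.
Proof.
move=> A [phi [c [sphi Ic ->]]] S [[sS cS] GS].
have VS : S (shift_op s) by apply: GS; left.
have mS f : padcont f -> S (mult_op (f : padic s -> R[i]^o)).
  by move=> cf; apply: GS; right; exists f => //; exact/padcontP.
by apply: gen_add => //; [exact: gen_Toeplitz|exact: gen_Ismooth].
Qed.

End algebra_HS.

(** * Density of the smooth algebra *)

Section density.
Context {R : realType} (s : nat) (hs : (2 <= s)%N).
Implicit Types (A B : operator R) (phi psi : R -> R[i]) (f : padic s -> R[i]).

Local Notation I := (@Ismooth R s).
Local Notation T := (@Toeplitz R s).

Lemma padcont_bounded f : padcont f -> exists2 M : R, 0 <= M & forall x, normc (f x) <= M.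
Proof.
move=> cf.
(* Every x in Z_s is obtained from a unit by removing the first digit, so it
   suffices that functions in C_0 are bounded on units. *)
pose F (p : nat * padic s) : R[i]^o := if p.1 == 0%N then f (pad_drop 1 p.2) else 0.
have /C0_fun_padcont[_ [B FB]] : C0_fun F.
  apply: padcont_C0_fun => [m|e e0].
    case: m => [|m]; first exact: (@padcont_drop R s 1 f cf).
    exact: padcontC.
  by exists 1%N => -[//|m] x _; rewrite [F _](_ : _ = 0) ?Normc.normc0.
exists (Num.max 0 B) => [|x]; first by rewrite le_max lexx.
pose y : padic s := fun j => if j is j'.+1 then x j' else 1.
have uy : unitb y by rewrite /unitb /y oner_neq0.
have := FB 0%N y uy; rewrite /F /= (_ : pad_drop 1 y = x); first by rewrite le_max orbC => ->.
by apply/funext => j; rewrite /pad_drop /y addn1.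
Qed.

Lemma mult_op_approx f (e : R) : padcont f -> 0 < e ->
  exists2 B, HSsmooth s B & bnd (B - mult_op (f : padic s -> R[i]^o)) e.
Proof.
move=> cf e0; have [M M0 fM] := padcont_bounded cf.
pose z : padic s := fun=> 0; have [N HN] := cf z e e0.
(* f is the sum of the constant f(0), of f - f(0) at valuations < N, which gives
   an element of the ideal, and of f - f(0) at valuations >= N, which is small. *)
pose g (l : int) : R[i] := if (l == 0) || (N <= s_val s l)%N then 0 else f (padic_of_int s l) - f z.
have g2M l : normc (g l) <= 2 * M.
  rewrite /g; case: ifP => _; first by rewrite Normc.normc0 mulr_ge0.
  apply: le_trans (normcD _ _) _; rewrite normcN mulr_natl mulr2n.
  exact: lerD (fM _) (fM _).
have M20 : 0 <= 2 * M by rewrite mulr_ge0.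
have [bg _] := diag_bounded M20 g2M.
(* The point s^j x has digits [pad_mul j x]; the cut at j < N makes every power weight bounded on
   the support. *)
pose K (j m : nat) (x : padic s) : R[i] := if (j == m) && (j < N)%N then f (pad_mul j x) - f z else 0.
have Ig : I (diag_op g).
  apply: (@mx_Ismooth _ _ hs _ K) => //.
    split=> [j m|p].
      rewrite /K; case: (_ && _); last exact: padcontC.
      by apply: padcontD; [exact: (@padcont_mul R s j f cf)|exact: padcontC].
    exists ((1 + N%:R + N%:R) ^+ p * (2 * M)) => j m x.
    rewrite /K; case: ifP => [/andP[/eqP <- jN]|_]; last first.
      by rewrite Normc.normc0 mulr0 mulr_ge0 ?exprn_ge0 ?addr_ge0.
    apply: ler_pM; rewrite ?exprn_ge0 ?addr_ge0 ?normc_ge0//.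
      by rewrite lerXn2r ?nnegrE ?addr_ge0// -!addrA lerD2l -!natrD ler_nat leq_add// ltnW.
    apply: le_trans (normcD _ _) _; rewrite normcN mulr_natl mulr2n.
    exact: lerD (fM _) (fM _).
  move=> k l; rewrite diag_basis_coord mulr0 /K /g.
  have [skl|skl] := boolP (same s k l).
    have [k0 l0 _] := and3P skl; rewrite (negPf k0) /=.
    have kE := s_unit_val hs k0; have lE := s_unit_val hs l0.
    have [lk|lk] := eqVneq l k.
      rewrite lk eqxx mulr1 /= ltnNge; case: (N <= _)%N => //=.
      by rewrite {1}kE (padic_of_int_mul hs).
    rewrite mulr0; case: eqP => //= vlk; case/negP: lk; apply/eqP.
    by rewrite kE lE vlk (same_eq_unit skl).
  have [->|k0] := eqVneq k 0; first by rewrite mul0r.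
  have [lk|lk] := eqVneq l k; last by rewrite mulr0.
  by move: skl; rewrite lk /same k0 eqxx.
have sC := smooth_ce (R := R) 0.
exists (f z *: T (ce 0) + diag_op g).
  have [_ _ + _ _] := star_subalgebra_HSsmooth (R := R) hs; apply; last exact: Ismooth_HSsmooth.
  apply/symbP; exists (ce 0); split=> //; rewrite subrr; exact: Ismooth0.
have bh l : normc (f z + g l - f (padic_of_int s l)) <= e.
  rewrite /g; case: eqVneq => [->|l0] /=.
    by rewrite addr0 padic_of_int0 subrr Normc.normc0 ltW.
  case: leqP => [Nl|_]; last by rewrite addrCA subrr addr0 subrr Normc.normc0 ltW.
  rewrite addr0 ltW//; apply: HN => j jN.
  rewrite {1}(s_unit_val hs l0) (padic_of_int_mul hs) /pad_mul.
  by rewrite (leq_trans jN Nl).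
have := (diag_bounded (ltW e0) bh).2.
rewrite (_ : diag_op _ = f z *: T (ce 0) + diag_op g - mult_op (f : padic s -> R[i]^o))//.
apply/funext => x; apply: ell2_ext => l.
rewrite (Toeplitz_id hs) !ell2_valD ell2_valN ell2_valZ /mult_op !diag_opE; first by rewrite mulrBl mulrDl.
- by exists M => k; exact: fM.
- by exists (2 * M).
- by exists e.
Qed.

(** The norm closure of the smooth algebra. It is a closed *-algebra containing the generators, so
    it contains HS(s) by minimality, whatever the elements of HS(s) look like. *)
Definition approximable A := bounded_operators A /\
  forall e : R, 0 < e -> exists2 B, HSsmooth s B & bnd (B - A) e.

Lemma HSsmooth_bounded A : HSsmooth s A -> bounded_operators A.
Proof. by case: (star_subalgebra_HSsmooth (R := R) hs) => + _ _ _ _; apply. Qed.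

Lemma approximable_HSsmooth A : HSsmooth s A -> approximable A.
Proof.
move=> HA; split=> [|e e0]; first exact: HSsmooth_bounded.
by exists A => // x; rewrite subrr (_ : (0 : operator R) x = 0)// l2norm0 mulr_ge0 ?l2norm_ge0 ?ltW.
Qed.

Lemma approximable_star : star_subalgebra approximable.
Proof.
have [_ H0 Hl Hc Ha] := star_subalgebra_HSsmooth (R := R) hs; split.
- by move=> A [].
- exact: approximable_HSsmooth.
- move=> k A B [bA HA] [bB HB]; split=> [|e e0]; first exact: bounded_scaleD.
  have k0 : 0 < normc k + 1 by rewrite ltr_wpDl ?normc_ge0.
  have [A' HA' A'A] := HA (e / 2 / (normc k + 1)) (divr_gt0 (divr_gt0 e0 (ltr0Sn _ 1)) k0).
  have [B' HB' B'B] := HB (e / 2) (divr_gt0 e0 (ltr0Sn _ 1)).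
  exists (k *: A' + B'); first exact: Hl.
  rewrite opprD addrACA -scalerN -scalerDr.
  apply: bnd_le (bndD (bndZ k A'A) B'B); rewrite [leRHS](splitr e) lerD2r.
  by rewrite mulrA ler_pdivrMr// mulrC ler_wpM2l ?lerDl// ltW ?divr_gt0.
- move=> A B [bA HA] [bB HB]; split=> [|e e0]; first exact: bounded_comp.
  have [lA [M M0 AM]] := (boundedP A).1 bA; have [lB [N N0 BN]] := (boundedP B).1 bB.
  have d0 : 0 < 1 + M + N by rewrite -addrA ltr_wpDr// addr_ge0.
  (* The product of the approximants is off by at most d^2 + d N + M d, and d <= 1 bounds this by d
     (1 + M + N) <= e. *)
  pose d := Num.min 1 (e / (1 + M + N)).
  have dp : 0 < d by rewrite lt_min ltr01 divr_gt0.
  have [A' HA' A'A] := HA d dp; have [B' HB' B'B] := HB d dp.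
  exists (A' \o B'); first exact: Hc.
  have lA' := bounded_linear (HSsmooth_bounded HA').
  rewrite (_ : _ - _ = ((A' - A) \o (B' - B)) + ((A' - A) \o B) + (A \o (B' - B))).
    apply: bnd_le (bndD (bndD (bnd_comp (ltW dp) A'A B'B) (bnd_comp (ltW dp) A'A BN)) (bnd_comp M0 AM B'B)).
    apply: (@le_trans _ _ (d * (1 + M + N))).
      rewrite mulrDr mulrDr mulr1 [M * d]mulrC addrAC lerD2r lerD2r.
      by rewrite ler_piMr ?(ltW dp)// ge_min lexx.
    by rewrite -ler_pdivlMr// ge_min lexx orbT.
  apply/funext => x.
  rewrite -[LHS]/(A' (B' x) - A (B x)).
  rewrite -[RHS]/(A' (B' x - B x) - A (B' x - B x) + (A' (B x) - A (B x)) + A (B' x - B x)).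
  by rewrite (lin_B _ _ lA') addrAC subrK addrA subrK.
- move=> A [bA HA]; split=> [|e e0]; first exact: adj_bounded.
  have [A' HA' A'A] := HA e e0; exists (adj A'); first exact: Ha.
  have bA' := HSsmooth_bounded HA'.
  have -> : adj A' - adj A = adj (A' - A).
    rewrite -[A' in LHS](subrK A) -[A' - A in LHS]scale1r.
    by rewrite (adj_scaleD _ (boundedB bA' bA) bA) conjc1 scale1r addrK.
  by apply: adj_bnd (ltW e0) A'A; exact: boundedB.
Qed.

Lemma approximable_closed : norm_closed approximable.
Proof.
move=> u A Hu uA; have bA : bounded_operators A by case: uA.
split=> // e e0; have e20 : 0 < e / 2 by rewrite divr_gt0.
have [N _ /(_ N (leqnn N)) HN] := (op_cvgP (fun n => (Hu n).1) bA).1 uA _ e20.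
have [B HB BN] := (Hu N).2 _ e20; exists B => //.
by rewrite (splitr e) -[B](subrK (u N)) -addrA; exact: bndD.
Qed.

Lemma HS_approximable : HS (R := R) s `<=` approximable.
Proof.
move=> A; apply; split.
  by split; [exact: approximable_star|exact: approximable_closed].
move=> _ [->|[f cf <-]].
  apply: approximable_HSsmooth; rewrite -[shift_op s]/(shift_pow s 1) -(Toeplitz_ce hs).
  by apply/symbP; exists (ce 1); split; [exact: smooth_ce|rewrite subrr; exact: Ismooth0].
have {}cf := (padcontP f).1 cf; split.
  have [M M0 fM] := padcont_bounded cf.
  by case: (diag_bounded M0 (fun k => fM (padic_of_int s k))).
by move=> e e0; exact: mult_op_approx.
Qed.

Lemma HSsmooth_dense : dense_in (HSsmooth (R := R) s) (HS s).
Proof.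
move=> A /HS_approximable[bA HA].
have e0 n : 0 < (n.+1%:R)^-1 :> R by [].
have H n := HA _ (e0 n).
have H' n : exists B : operator R, HSsmooth s B /\ bnd (B - A) (n.+1%:R)^-1.
  by have [B HB BA] := H n; exists B.
have [u Hu] := choice H'.
exists u => [n|]; first by case: (Hu n).
apply: (op_cvgP (fun n => HSsmooth_bounded (Hu n).1) bA).2 => e ep.
exists (Num.bound e^-1) => // n /= en; apply: bnd_le (Hu n).2.
rewrite -[leRHS]invrK lef_pV2 ?posrE ?invr_gt0//; apply: ltW.
apply: lt_le_trans (archi_boundP _) _; first by rewrite invr_ge0 ltW.
by rewrite ler_nat ltnW.
Qed.

End density.

(** * The quotient *)

Section quotient.
Context {R : realType} (s : nat) (hs : (2 <= s)%N).
Implicit Types (A B : operator R) (phi psi : R -> R[i]).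

Local Notation I := (@Ismooth R s).
Local Notation T := (@Toeplitz R s).

Lemma rapid_mx_diag_const (K : nat -> nat -> padic s -> R[i]) (a b : nat) (x : padic s) (c : R[i]) :
  rapid_mx K -> (forall m, K (m + a)%N (m + b)%N x = c) -> c = 0.
Proof.
move=> [_ dK] Kc; have [M HM] := dK 1%N.
apply: Normc.eq0_normc; apply/eqP; rewrite eq_le normc_ge0 andbT.
have [//|c0] := leP; have M0 : 0 <= M.
  by apply: le_trans (HM 0%N 0%N x); rewrite mulr_ge0 ?exprn_ge0 ?addr_ge0 ?normc_ge0.
pose m := Num.bound (M / normc c).
have := HM (m + a)%N (m + b)%N x; rewrite Kc expr1 -ler_pdivlMr// => /(lt_le_trans _) H.
have := archi_boundP (divr_ge0 M0 (ltW c0)); rewrite -/m => /ltW mc.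
suff : m%:R < M / normc c by rewrite ltNge; case/negP; exact: ltW (archi_boundP (divr_ge0 M0 (ltW c0))).
by apply: H; rewrite -[1]/(1%:R) -!natrD ltr_nat; lia.
Qed.

(** The orbit of 1 is enough: on it the diagonal n of the difference is constantly phi_n - psi_n,
    while a rapidly decreasing kernel tends to 0 along diagonals. *)
Lemma Toeplitz_Ismooth_inj phi psi : smooth_circle phi -> smooth_circle psi ->
  I (T phi - T psi) -> phi = psi.
Proof.
move=> sphi spsi /(Ismooth_mx hs)[_ [K rK mK]]; apply: (fourier_inj sphi spsi) => n.
have n1 : ~~ (s%:Z %| 1)%Z by rewrite dvdz1 absz_nat; lia.
have mT : has_mx (T phi - T psi) (fun j m (x : padic s) => -1 * toepl_mx psi j m x + toepl_mx phi j m x)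
    (-1 * psi 0 + phi 0).
  rewrite [_ - _]addrC -scaleN1r; exact: (has_mxD (-1) (Toeplitz_mx hs spsi) (Toeplitz_mx hs sphi)).
have E j m : K j m (padic_of_int s 1) = fourier_coef phi (j%:Z - m%:Z) - fourier_coef psi (j%:Z - m%:Z).
  have := mT (orb s 1 m) (orb s 1 j); rewrite mK /same !orb_neq0//= /orb !s_unitE// eqxx /=.
  by rewrite !s_valE// /toepl_mx mulN1r addrC.
apply/eqP; rewrite -subr_eq0; apply/eqP.
case: n => n.
  apply: (@rapid_mx_diag_const K n 0%N (padic_of_int s 1)) => // m; rewrite E.
  by congr (fourier_coef _ _ - fourier_coef _ _); lia.
apply: (@rapid_mx_diag_const K 0%N n.+1 (padic_of_int s 1)) => // m; rewrite E.
by congr (fourier_coef _ _ - fourier_coef _ _); lia.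
Qed.

Lemma symb_uniq A phi psi : symb s A phi -> symb s A psi -> phi = psi.
Proof.
move=> [sphi IA] [spsi IA']; apply: (Toeplitz_Ismooth_inj sphi spsi).
have := IsmoothB hs IA' IA; rewrite opprB addrC addrA subrK; exact.
Qed.

(** Selects the phi with T(phi) in the coset. It exists and is unique on cosets of smooth elements,
    so the default 0 is irrelevant there. *)
Definition quot_symb (X : set (operator R)) : R -> R[i] :=
  xget (fun=> 0) [set phi | smooth_circle phi /\ X (T phi)].

Lemma coset_Toeplitz A phi : coset I A (T phi) <-> I (A - T phi).
Proof.
split=> [[c Ic <-]|IA]; first by rewrite opprD addrA subrr add0r; exact: IsmoothN.
by exists (T phi - A); [rewrite -opprB; exact: IsmoothN|rewrite addrC subrK].
Qed.

Lemma quot_symbE A phi : symb s A phi -> quot_symb (coset I A) = phi.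
Proof.
move=> [sphi IA]; rewrite /quot_symb; case: xgetP => [psi _ [spsi /coset_Toeplitz IA']|/(_ phi)[]].
  by apply: (@symb_uniq A); split.
by split; [exact: sphi|apply/coset_Toeplitz; exact: IA].
Qed.

Lemma coset_eq A B : I (A - B) -> coset I A = coset I B.
Proof.
move=> IAB; apply/seteqP; split=> _ [c Ic <-].
  by exists (A - B + c); [exact: IsmoothD|rewrite addrA [B + _]addrC subrK].
by exists (c - (A - B)); [exact: IsmoothB|rewrite opprB addrCA [A + _]addrC subrK addrC].
Qed.

Lemma HSsmooth_quotient : quotient_iso (HSsmooth s) I quot_symb.
Proof.
split.
- split.
  + by move=> _ [A /symbP[phi pA] <-]; rewrite (quot_symbE pA); case: pA.
  + move=> X Y /set_mem[A /symbP[phi pA] <-] /set_mem[B /symbP[psi pB] <-].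
    rewrite (quot_symbE pA) (quot_symbE pB) => pp; apply: coset_eq.
    move: pA pB => [_ IA] [_ IB]; rewrite pp in IA.
    have -> : A - B = (A - T psi) - (B - T psi) by rewrite opprB addrA subrK.
    exact: (IsmoothB hs IA IB).
  + move=> phi sphi; have pT : symb s (T phi) phi by split=> //; rewrite subrr; exact: Ismooth0.
    by exists (coset I (T phi)); [exists (T phi) => //; apply/symbP; exists phi|exact: quot_symbE].
- move=> k A B /symbP[phi pA] /symbP[psi pB].
  by rewrite (quot_symbE pA) (quot_symbE pB); apply: quot_symbE; exact: symb_lin.
- move=> A B /symbP[phi pA] /symbP[psi pB].
  by rewrite (quot_symbE pA) (quot_symbE pB); apply: quot_symbE; exact: symb_mul.
- move=> A /symbP[phi pA].
  by rewrite (quot_symbE pA); apply: quot_symbE; exact: symb_adj.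
Qed.

End quotient.

Theorem proposition3p8 (R : realType) (s : nat) (hs : (2 <= s)%N) :
  let I : set (operator R) := Ismooth s in
  let HSoo : set (operator R) := HSsmooth s in
  let T : (R -> R[i]) -> operator R := Toeplitz s in
  let Coo : set (R -> R[i]) := smooth_circle in
  (forall phi c, Coo phi -> I c -> I (T phi \o c) /\ I (c \o T phi)) /\
  (forall phi psi, Coo phi -> Coo psi ->
    I ((T phi \o T psi) - T (fun t => phi t * psi t))) /\
  [/\ star_subalgebra HSoo, HSoo `<=` HS s & dense_in HSoo (HS s)] /\
  (forall phi c, Coo phi -> I c ->
    I (adj c) /\ adj (T phi + c) = T (fun t => ((phi t)^*)%C) + adj c) /\
  two_sided_ideal I HSoo /\
  (exists Phi : set (operator R) -> (R -> R[i]),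
    quotient_iso HSoo I Phi /\
    let q : operator R -> (R -> R[i]) := fun a => Phi (coset I a) in
    forall phi c, Coo phi -> I c -> q (T phi + c) = phi).
Proof.
move=> I HSoo T Coo; split.
  by move=> phi c sphi Ic; split; [exact: (Ismooth_Tmul hs sphi Ic)|exact: (Ismooth_mulT hs sphi Ic)].
split; first by move=> phi psi sphi spsi; exact: (Toeplitz_mul hs sphi spsi).
split; first by split; [exact: star_subalgebra_HSsmooth|exact: HSsmooth_sub_HS|exact: HSsmooth_dense].
split.
  move=> phi c sphi Ic; split; first exact: (Ismooth_adj hs Ic).
  have bT := Toeplitz_bounded hs sphi; have bc := Ismooth_bounded hs Ic.
  rewrite -[T phi]scale1r (adj_scaleD 1 bT bc) conjc1 !scale1r.
  by congr (_ + _); exact: (Toeplitz_adj hs sphi).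
split; first exact: (ideal_Ismooth hs).
exists (@quot_symb R s); split; first exact: (HSsmooth_quotient hs).
by move=> q phi c sphi Ic; exact: (quot_symbE hs (symb_Toeplitz sphi Ic)).
Qed.
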